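(* Let $n,m\ge 1$, let $P_1,\dots,P_m\in\mathbb{Z}[x_1,\dots,x_n]$, let $d=\max_{1\le j\le m}\deg P_j$, and let $$\Gamma=\{(\mathbf{x},\mathbf{y})\in\mathbb{R}^n\times\mathbb{R}^m : y_1=P_1(\mathbf{x}),\dots,y_m=P_m(\mathbf{x})\}.$$ Let $\psi:\mathbb{N}\to\mathbb{R}^+$ be an approximation function and let $f$ be a dimension function such that: (i) for any $\delta>0$ there is a constant $c>0$ such that $f(\psi(\delta r))\le c\, f(\psi(r))$ for all sufficiently large $r$; (ii) for any $C>0$ there is a constant $c>0$ such that $f(Cx)\le c\, f(x)$ for all sufficiently small $x>0$; (iii) $r^{-n}f(r)\to\infty$ as $r\to 0$, and $r\mapsto r^{-n}f(r)$ is decreasing. Write $P_i=P_{i,0}+\dots+P_{i,d}$, where $P_{i,k}$ is homogeneous of degree $k$ (possibly zero), and suppose that the only common zero of $P_{1,d},\dots,P_{m,d}$ in $\overline{\mathbb{Q}}^{\,n}$ is $0$. Then $$\mathcal{H}^f(\mathcal{I}_\psi(\Gamma))=\begin{cases}0 & \text{if } \sum_{r=1}^\infty r^n f(\psi(r^d))<\infty,\\ \infty & \text{if } \sum_{r=1}^\infty r^n f(\psi(r^d))=\infty.\end{cases}$$ Furthermore, if $r^d\psi(r)\to 0$ as $r\to\infty$, then $\mathcal{I}_\psi(\Gamma)=\mathcal{S}_\psi(\Gamma)$.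
   Context: $\mathbb{R}^+$ denotes the positive reals. An approximation function is a decreasing function $\psi:\mathbb{N}\to\mathbb{R}^+$, where $\mathbb{N}=\{1,2,\dots\}$. For non-integer $\delta r$, $\psi(\delta r)$ means $\psi(\lceil\delta r\rceil)$. $\|\cdot\|_\infty$ is the sup-norm. For $M\subseteq\mathbb{R}^k$, $\mathcal{S}_\psi(M)$ is the set of $\mathbf{x}\in M$ for which there are infinitely many rational points $\mathbf{p}/q$ ($\mathbf{p}\in\mathbb{Z}^k$, $q\in\mathbb{N}$) with $\|\mathbf{x}-\mathbf{p}/q\|_\infty\le\psi(q)$ (ambient approximation). $\mathcal{I}_\psi(M)$ is the set of $\mathbf{x}\in M$ for which there are infinitely many rational points $\mathbf{p}/q\in\mathbb{Q}^k\cap M$ ($\mathbf{p}\in\mathbb{Z}^k$, $q\in\mathbb{N}$) with $\|\mathbf{x}-\mathbf{p}/q\|_\infty\le\psi(q)$ (intrinsic approximation). For $\Gamma$ above, $k=n+m$. A dimension function is an increasing continuous function $f:\mathbb{R}^+\to\mathbb{R}^+$ with $f(r)\to 0$ as $r\to 0$ (put $f(0)=0$). For $E\subseteq\mathbb{R}^k$, the Hausdorff $f$-measure is $\mathcal{H}^f(E)=\lim_{\delta\to 0}\mathcal{H}^f_\delta(E)$, where $\mathcal{H}^f_\delta(E)=\inf\sum_i f(|U_i|)$, the infimum being over countable covers $\{U_i\}$ of $E$ with diameters $|U_i|<\delta$. *)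

(* Defs.v *)
(* MathComp and MathComp-Analysis, over an arbitrary [R : realType].
   The notations of [mpoly] are not imported: they clash with those of
   MathComp-Analysis.  [mpoly n int] is [{mpoly int[n]}]. *)
From HB Require Import structures.
From mathcomp Require Import all_boot all_order all_algebra all_field.
From mathcomp Require Import all_classical all_reals all_analysis.
From mathcomp Require Import -(notations) mpoly.
Import Order.TTheory GRing.Theory Num.Theory.
Import numFieldNormedType.Exports.

Set Implicit Arguments.
Unset Strict Implicit.
Unset Printing Implicit Defensive.

Local Open Scope classical_set_scope.
Local Open Scope ring_scope.

(* [psi 0] is unconstrained, as the domain is {1, 2, ...}; "decreasing" is
   understood in the non-strict sense. *)
Definition approximation_function (R : realType) (psi : nat -> R) : Prop :=
  (forall q : nat, (0 < q)%N -> 0 < psi q) /\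
  (forall q r : nat, (0 < q)%N -> (q <= r)%N -> psi r <= psi q).

(* A function R^+ -> R^+ is given by a total function on R, extended by 0 at 0;
   its values at negative arguments are unconstrained.  "Increasing" is
   understood in the non-strict sense. *)
Definition dimension_function (R : realType) (f : R -> R) : Prop :=
  [/\ f 0 = 0,
      forall r, 0 < r -> 0 < f r,
      forall r s, 0 < r -> r <= s -> f r <= f s,
      forall r, 0 < r -> {for r, continuous f}
    & f r @[r --> 0^'+] --> 0].

(* [psi x] for real [x > 0]. *)
Definition psi_ceil (R : realType) (psi : nat -> R) (x : R) : R :=
  psi `|Num.ceil x|%N.

Definition rat_point (R : realType) (k : nat) (p : 'rV[int]_k) (q : nat) :
  'rV[R]_k := (q%:R)^-1 *: map_mx intr p.

(* The norm of ['rV[R]_k] is the sup-norm.  "Infinitely many rational points"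
   counts the points of Q^k, not their representations [(p, q)]. *)
Definition ambient_approx (R : realType) (k : nat) (psi : nat -> R)
    (M : set 'rV[R]_k) : set 'rV[R]_k :=
  [set x | M x /\
    infinite_set [set z | exists (p : 'rV[int]_k) (q : nat),
      [/\ (0 < q)%N, z = rat_point R p q & `|x - z| <= psi q]]].

Definition intrinsic_approx (R : realType) (k : nat) (psi : nat -> R)
    (M : set 'rV[R]_k) : set 'rV[R]_k :=
  [set x | M x /\
    infinite_set [set z | M z /\ exists (p : 'rV[int]_k) (q : nat),
      [/\ (0 < q)%N, z = rat_point R p q & `|x - z| <= psi q]]].

Definition eucl_dist (R : realType) (k : nat) (x y : 'rV[R]_k) : R :=
  Num.sqrt (\sum_(i < k) (x ord0 i - y ord0 i) ^+ 2).

(* The maximum with 0 only serves to give the empty set diameter 0. *)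
Definition diam (R : realType) (k : nat) (U : set 'rV[R]_k) : \bar R :=
  maxe 0%E (ereal_sup [set (eucl_dist x y)%:E | x in U & y in U]).

(* Countable covers are indexed by [nat]; finite ones are padded by empty sets,
   which contribute [f 0 = 0]. *)
Definition hausdorff_delta (R : realType) (k : nat) (f : R -> R) (delta : R)
    (E : set 'rV[R]_k) : \bar R :=
  ereal_inf [set (\sum_(0 <= i <oo) (f (fine (diam (U i))))%:E)%E
            | U in [set U : nat -> set 'rV[R]_k |
                    E `<=` \bigcup_i U i /\
                    forall i, (diam (U i) < delta%:E)%E]].

Definition hausdorff_measure (R : realType) (k : nat) (f : R -> R)
    (E : set 'rV[R]_k) : \bar R :=
  lim (hausdorff_delta f delta E @[delta --> 0^'+]).

Definition eval_int_poly (S : comNzRingType) (n : nat) (P : mpoly n int)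
    (x : 'I_n -> S) : S :=
  meval x (map_mpoly intr P).

Definition homog_part (n : nat) (k : nat) (P : mpoly n int) :
  mpoly n int := pihomog mdeg k P.

(* [mmeasure mdeg p] is the total degree of [p] plus one, and 0 for [p = 0]. *)
Definition max_degree (n m : nat) (P : 'I_m -> mpoly n int) : nat :=
  \max_(j < m) (mmeasure mdeg (P j)).-1.

(* R^n x R^m is identified with R^(n+m). *)
Definition poly_graph (R : realType) (n m : nat) (P : 'I_m -> mpoly n int) :
  set 'rV[R]_(n + m) :=
  [set z | forall j : 'I_m,
    rsubmx z ord0 j = eval_int_poly (P j) (fun i => lsubmx z ord0 i)].
Arguments poly_graph R {n m} P.

(* Main.v *)
(* A rational point of the graph lies above a reduced fraction [a/b], and its
   denominator [q] is comparable with [b^d]: since the leading forms have no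
   common zero but [0], the Nullstellensatz writes a multiple of a power of each
   variable in terms of them, which bounds [gcd(b^d, b^d P_1(a/b), ...)].  So,
   up to constants, [I_psi] is the lift to the graph of the set of points of R^n
   that are [psi(b^d)]-close to infinitely many fractions [a/b].

   If the series converges, the obvious covers by balls about the [a/b] give
   measure 0.  If it diverges, the statement is Jarnik's theorem.  For a cover
   by sets of diameters [r_i] with [sum f(r_i)] bounded, one builds a sequence of
   nested balls about rational points, each ball [B] of radius [rho] satisfying
   [sum f(r_i) <= eta f(rho)] over the sets meeting [B]; the limit point lies in
   no set of the cover.  The next ball is found by averaging over a finite family
   of balls with rational centers of many scales, supplied by Dirichlet's
   theorem; divergence makes the total weight of the family as large as needed,
   and the separation of its centers controls how many members a single set of
   the cover can spoil.

   Finally, if [r^d psi(r) -> 0], an ambient approximation [p/q] with large [q]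
   is on the graph because [q^d (P_j(a/q) - e/q)] is an integer smaller than 1. *)
Require Import Defs.
From HB Require Import structures.
From mathcomp Require Import all_boot all_order all_algebra all_field.
From mathcomp Require Import all_classical all_reals all_analysis.
From mathcomp Require Import -(notations) mpoly.
From mathcomp Require Import ring lra zify.
Import Order.TTheory GRing.Theory Num.Theory.
Import numFieldNormedType.Exports.
Local Open Scope classical_set_scope.
Local Open Scope ring_scope.

Set Implicit Arguments.
Unset Strict Implicit.
Unset Printing Implicit Defensive.

(** * The Nullstellensatz *)

(** The sets of the cover come in all sizes, so no single count bounds the balls of the family that
    they spoil. A set at least as wide as the spacing of a ball's level is charged by volume; a
    narrower one meets at most one ball among those whose spacing exceeds its width, and is charged
    by its value of [f]. The first charge is small only if the sets meeting the current box have
    small total volume compared with the box. As [r ^- n * f r] decreases, the bound by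
    [eta * f rho] from the previous stage implies this, so the invariant reproduces itself and no
    measure on the limit set is constructed. The second charge is bounded by the same [S / eta] at
    every stage while the boxes shrink; hence the weight [T] of the family is chosen anew for each
    box. On the arithmetic side, the hypothesis speaks of points over [algC], but a bound on
    denominators needs an identity with rational coefficients: the Nullstellensatz is proved for
    polynomial rings over [rat] with points in [algC]. *)

Definition is_ideal (A : comNzRingType) (I : set A) : Prop :=
  [/\ I 0, forall x y, I x -> I y -> I (x + y) & forall a x, I x -> I (a * x)].

Definition is_prime (A : comNzRingType) (I : set A) : Prop :=
  [/\ is_ideal I, ~ I 1 & forall x y, I (x * y) -> I x \/ I y].

Lemma idealB (A : comNzRingType) (I : set A) x y :
  is_ideal I -> I x -> I y -> I (x - y).
Proof. by case=> _ hD hM hx hy; apply: hD => //; rewrite -mulN1r; apply: hM. Qed.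

Lemma ideal_sum (A : comNzRingType) (I : set A) (T : Type) (r : seq T)
    (P : pred T) (F : T -> A) :
  is_ideal I -> (forall i, P i -> I (F i)) -> I (\sum_(i <- r | P i) F i).
Proof. by case=> h0 hD _ hF; apply: big_ind. Qed.

Lemma primeX (A : comNzRingType) (I : set A) x k :
  is_prime I -> I (x ^+ k) -> I x.
Proof.
move=> [_ h1 hp]; elim: k => [|k IH]; first by rewrite expr0.
by rewrite exprS => /hp[].
Qed.

(** An ideal maximal among those that contain [I0] and miss every power of [s] is prime: enlarging
    it by an outside element [x] or [y] captures a power of [s], and the product of the two powers
    would lie in the ideal as soon as [x * y] does. *)
Lemma ex_prime_ideal (A : comNzRingType) (I0 : set A) (s : A) :
  is_ideal I0 -> (forall k, ~ I0 (s ^+ k)) ->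
  exists I, [/\ is_prime I, I0 `<=` I & ~ I s].
Proof.
move=> hI0 hs.
pose good (I : set A) := [/\ is_ideal I, I0 `<=` I & forall k, ~ I (s ^+ k)].
have [F FP Ftot|I []] := @Zorn_bigcup A [set I | I = set0 \/ good I].
  have [allE|] := pselect (forall X, F X -> X = set0).
    left; apply/seteqP; split => // x [X FX Xx].
    by move: Xx; rewrite (allE _ FX).
  move=> /existsNP[X] /not_implyP[FX XN0].
  right.
  have gF Y y : F Y -> Y y -> good Y.
    by move=> FY Yy; case: (FP _ FY) => // Y0; move: Yy; rewrite Y0.
  have /set0P[x0 Xx0] : X != set0 by apply/eqP.
  have [[X0 _ _] IX _] := gF _ _ FX Xx0.
  split.
  - split.
    + by exists X.
    + move=> x y [Y FY Yx] [Z FZ Zy].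
      have [[_ YD _] _ _] := gF _ _ FY Yx; have [[_ ZD _] _ _] := gF _ _ FZ Zy.
      have [YZ|ZY] := Ftot _ _ FY FZ.
        by exists Z => //; apply: ZD => //; apply: YZ.
      by exists Y => //; apply: YD => //; apply: ZY.
    + move=> a x [Y FY Yx]; have [[_ _ YM] _ _] := gF _ _ FY Yx.
      by exists Y => //; apply: YM.
  - by move=> x I0x; exists X => //; apply: IX.
  - by move=> k [Y FY Yx]; have [_ _ h] := gF _ _ FY Yx; apply: (h k).
have g0 : good I0 by split.
case=> [->|gI] maxI.
  exfalso; apply: (maxI I0); last by right.
  split; last by move=> /(_ 0); apply; case: hI0.
  by [].
have maxI' J : good J -> I `<=` J -> J `<=` I.
  move=> gJ IJ; apply: contrapT => nJI; apply: (maxI J); last by right.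
  by split.
have [iI I0I Is] := gI; have [I_0 ID IM] := iI.
pose ad x := [set z | exists a y, I y /\ z = a * x + y].
have iad x : is_ideal (ad x).
  split.
  - by exists 0, 0; rewrite mul0r addr0.
  - move=> _ _ [a [y [Iy ->]]] [b [z [Iz ->]]]; exists (a + b), (y + z).
    by split; [apply: ID|rewrite mulrDl addrACA].
  - move=> b _ [a [y [Iy ->]]]; exists (b * a), (b * y).
    by split; [apply: IM|rewrite mulrDr mulrA].
have Iad x : I `<=` ad x.
  by move=> y Iy; exists 0, y; rewrite mul0r add0r.
have adx x : ad x x by exists 1, 0; rewrite mul1r addr0.
have key x : ~ I x -> exists k, ad x (s ^+ k).
  move=> nIx; apply: contrapT => /forallNP h; apply: nIx.
  apply: (maxI' (ad x)) => //.
  by split => // y /I0I /Iad.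
exists I; split => //; last by move=> /= Iss; apply: (Is 1%N); rewrite expr1.
split => //; first by move=> I1; apply: (Is 0%N); rewrite expr0.
move=> x y Ixy; apply: contrapT => /not_orP[/key[k [a [u [Iu ek]]]] /key[l [b [v [Iv el]]]]].
apply: (Is (k + l)%N); rewrite exprD ek el.
have -> : (a * x + u) * (b * y + v) = a * b * (x * y) + (b * y + v) * u + a * x * v.
  by ring.
exact: (ID _ _ (ID _ _ (IM _ _ Ixy) (IM _ _ Iu)) (IM _ _ Iv)).
Qed.

(** A form that survives adjoining a variable: besides the element to be avoided, [s] can absorb the
    leading coefficients that must not vanish at the point. *)
Definition nullstellensatz (A : comNzRingType) : Prop :=
  forall (I : set A) (s : A), is_prime I -> ~ I s ->
  exists2 phi : {rmorphism A -> algC}, (forall x, I x -> phi x = 0) & phi s != 0.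

Lemma nullstellensatz_rat : nullstellensatz rat.
Proof.
move=> I s [[I_0 _ IM] I1 _] Is.
exists (ratr : {rmorphism rat -> algC}) => [x Ix|].
  have [->|x0] := eqVneq x 0; first by rewrite rmorph0.
  by exfalso; apply: I1; rewrite -(mulVf x0); apply: IM.
by rewrite fmorph_eq0; apply/eqP => s0; apply: Is; rewrite s0.
Qed.

Lemma coef_ideal_poly (A : comNzRingType) (I : set {poly A}) (p : {poly A}) :
  is_ideal I -> (forall i, I (p`_i)%:P) -> I p.
Proof.
move=> hI hp; rewrite -[p]coefK poly_def; apply: ideal_sum => // i _.
by case: hI => _ _ hM; rewrite -mul_polyC mulrC; apply: hM.
Qed.

Import Pdiv.Idomain.

(* Pseudo-division by an element [g] of [I] of minimal degree among those not
   in [I'[X]], where [I'] is the trace of [I] on [A]. *)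
Lemma nullstellensatz_poly (A : idomainType) :
  nullstellensatz A -> nullstellensatz {poly A}.
Proof.
move=> NA I s pI Is; have [iI I1 Ip] := pI; have [I_0 ID IM] := iI.
pose I' : set A := [set c | I c%:P].
have I'E c : I' c = I c%:P by [].
have iI' : is_ideal I'.
  split; first by rewrite I'E polyC0.
    by move=> x y Ix Iy; rewrite I'E polyCD; apply: ID.
  by move=> a x Ix; rewrite I'E polyCM; apply: IM.
have [I'0 I'D I'M] := iI'.
have pI' : is_prime I'.
  split => //.
  by move=> x y; rewrite !I'E polyCM => /Ip.
pose IX : set {poly A} := [set p | forall i, I' p`_i].
have IXI p : IX p -> I p by move=> h; apply: coef_ideal_poly.
pose ev (phi : {rmorphism A -> algC}) (xi : algC) : {rmorphism {poly A} -> algC} :=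
  horner_eval xi \o map_poly phi.
have evE phi xi p : ev phi xi p = (map_poly phi p).[xi] by [].
have IX0 (phi : {rmorphism A -> algC}) p :
    (forall x, I' x -> phi x = 0) -> IX p -> map_poly phi p = 0.
  by move=> h hp; apply/polyP => i; rewrite coef_map coef0; apply: h; apply: hp.
have notIX p : ~ IX p -> exists i, ~ I' p`_i by move=> /existsNP.
have [Isub|] := pselect (I `<=` IX).
  (* Here [I] is [I'[X]]: a point of [A] that keeps a coefficient of [s] alive extends by any value
     of the variable that is not a root of the image of [s]. *)
  have [i si] : exists i, ~ I' s`_i by apply: notIX => /IXI.
  have [phi phi0 phis] := NA _ _ pI' si.
  have sN0 : map_poly phi s != 0.
    by apply: contraNneq phis => /polyP/(_ i); rewrite coef_map coef0 => /eqP.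
  have /closed_nonrootP[xi rxi] := sN0.
  exists (ev phi xi) => [p /Isub /IX0 h|]; last by rewrite evE.
  by rewrite evE h // horner0.
move=> /existsNP[g0 /not_implyP[Ig0 Xg0]].
(* If the leading coefficient were in [I'], removing the leading term would leave an element of [J]
   of smaller degree, hence in [I'[X]], and [g] itself would be there. *)
have minel (J : set {poly A}) : is_ideal J -> I `<=` J -> (exists2 p, J p & ~ IX p) ->
    exists g, [/\ J g, ~ I' (lead_coef g), g != 0 &
      forall p, J p -> (size p < size g)%N -> IX p].
  move=> iJ IJ [p0 Jp0 Xp0].
  have ex : exists k, `[< exists p, [/\ J p, ~ IX p & size p = k] >].
    by exists (size p0); apply/asboolP; exists p0.
  case: (ex_minnP ex) => k /asboolP[g [Jg Xg sg]] kmin.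
  have mins p : J p -> (size p < size g)%N -> IX p.
    move=> Jp lpg; apply: contrapT => Xp.
    have := kmin (size p) (introT (asboolP _) (ex_intro _ p (And3 Jp Xp erefl))).
    by rewrite -sg leqNgt lpg.
  have gN0 : g != 0.
    by apply/eqP => g0E; apply: Xg => i; rewrite g0E coef0.
  exists g; split => // Il; apply: Xg.
  have JM : J (g - lead_coef g *: 'X^((size g).-1)).
    apply: idealB => //; case: iJ => _ _ hM; rewrite -mul_polyC mulrC.
    by apply: hM; apply: IJ.
  have lt : (size (g - lead_coef g *: 'X^((size g).-1))%R < size g)%N.
    have sg0 : (0 < size g)%N by rewrite size_poly_gt0.
    suff : (size (g - lead_coef g *: 'X^((size g).-1))%R <= (size g).-1)%N by lia.
    apply/leq_sizeP => j lj.
    rewrite coefB coefZ coefXn; case: eqVneq => [->|nj].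
      by rewrite mulr1 /lead_coef subrr.
    rewrite mulr0 subr0 nth_default //.
    by rewrite -(prednK sg0) ltn_neqAle eq_sym nj.
  move=> i; have := mins _ JM lt i.
  rewrite coefB coefZ coefXn => h.
  have -> : g`_i = (g`_i - lead_coef g * (i == (size g).-1)%:R)
      + (i == (size g).-1)%:R * lead_coef g by ring.
  by apply: I'D => //; apply: I'M.
have [g [Ig lg gN0 gmin]] := minel I iI (fun _ h => h) (ex_intro2 _ _ g0 Ig0 Xg0).
have lgX k : ~ I' (lead_coef g ^+ k) by move=> /(primeX pI').
have modg h : I h -> IX (h %% g).
  move=> Ih; apply: gmin; last by rewrite ltn_modp.
  have -> : h %% g = lead_coef g ^+ scalp h g *: h - h %/ g * g.
    by rewrite divp_eq addrC addKr.
  by apply: idealB => //; rewrite -?mul_polyC; apply: IM.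
(* The ideal generated by [I] and [s]. Its element [p] of minimal degree outside [I'[X]] turns out
   to be a constant, and a point that kills [I] but not this constant cannot kill [s]. *)
pose J := [set p | exists a y, I y /\ p = a * s + y].
have iJ : is_ideal J.
  split.
  - by exists 0, 0; rewrite mul0r addr0.
  - move=> _ _ [a [y [Iy ->]]] [b [z [Iz ->]]]; exists (a + b), (y + z).
    by split; [apply: ID|rewrite mulrDl addrACA].
  - move=> b _ [a [y [Iy ->]]]; exists (b * a), (b * y).
    by split; [apply: IM|rewrite mulrDr mulrA].
have IJ : I `<=` J by move=> y Iy; exists 0, y; rewrite mul0r add0r.
have Js : J s by exists 1, 0; rewrite mul1r addr0.
have [p [Jp lp pN0 pmin]] := minel J iJ IJ (ex_intro2 _ _ s Js (fun h => Is (IXI _ h))).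
have modp h : J h -> IX (h %% p).
  move=> Jh; apply: pmin; last by rewrite ltn_modp.
  have -> : h %% p = lead_coef p ^+ scalp h p *: h - h %/ p * p.
    by rewrite divp_eq addrC addKr.
  by case: (iJ) => _ _ hM; apply: idealB => //; rewrite -?mul_polyC; apply: hM.
have unscale c h : ~ I' c -> I (c *: h) -> I h.
  by move=> nc; rewrite -mul_polyC => /Ip[].
have IpF : ~ I p.
  move=> Ip'; apply: Is; apply: (unscale (lead_coef p ^+ scalp s p)).
    by move=> /(primeX pI').
  rewrite divp_eq; apply: ID; first exact: IM.
  by apply: IXI; apply: modp.
(* Otherwise the pseudo-quotient of [g] by [p], which lies in [I] since [p] does not, has smaller
   degree than [g]; so it is in [I'[X]], and the leading coefficient of [g] would be in [I']. *)
have sp : size p = 1.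
  apply/eqP/negPn/negP => sp1.
  have pS : (1 < size p)%N by rewrite ltn_neqAle eq_sym sp1 size_poly_gt0.
  have : I (g %/ p * p).
    have -> : g %/ p * p = lead_coef p ^+ scalp g p *: g - g %% p.
      by rewrite divp_eq addrK.
    apply: idealB => //; first by rewrite -mul_polyC; apply: IM.
    by apply: IXI; apply: modp; apply: IJ.
  case/Ip => // Iq.
  have Xq : IX (g %/ p).
    apply: gmin => //; rewrite size_divp //.
    by rewrite -subn1; have := size_poly_gt0 g; rewrite gN0; lia.
  have : I' (lead_coef p ^+ scalp g p * lead_coef g).
    have -> : lead_coef p ^+ scalp g p * lead_coef g =
        (lead_coef p ^+ scalp g p *: g)`_(size g).-1 by rewrite coefZ.
    rewrite divp_eq coefD; apply: I'D; last by apply: modp; apply: IJ.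
    by rewrite coefM; apply: ideal_sum => // j _; rewrite mulrC; apply: I'M.
  by have [_ _ f] := pI'; move=> /f[/(primeX pI')|].
have [c cN0 pE] : exists2 c, c != 0 & p = c%:P.
  by have /eqP/size_poly1P := sp.
have Ic : ~ I' c by move: lp; rewrite pE lead_coefC.
have lgc : ~ I' (lead_coef g * c) by have [_ _ f] := pI'; move=> /f[].
(* Keeping [lead_coef g] alive preserves the positive degree of [g], and a root of its image kills
   [I], whose elements are pseudo-multiples of [g] modulo [I'[X]]. Keeping [c] alive spares [s]. *)
have [phi phi0 phic] := NA _ _ pI' lgc.
have phig : phi (lead_coef g) != 0.
  by apply: contraNneq phic; rewrite rmorphM => ->; rewrite mul0r.
have phic' : phi c != 0.
  by apply: contraNneq phic; rewrite rmorphM => ->; rewrite mulr0.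
have /closed_rootP[xi /rootP rxi] : size (map_poly phi g) != 1.
  rewrite size_map_poly_id0 //; apply/eqP => sg.
  have /eqP/size_poly1P[e eN0 gE] := sg.
  by apply: lg; rewrite gE lead_coefC; move: Ig; rewrite gE.
have [a [y [Iy pas]]] := Jp.
have phiX k : phi (lead_coef g ^+ k) != 0.
  elim: k => [|k IH]; first by rewrite expr0 rmorph1 oner_eq0.
  by rewrite exprS rmorphM mulf_neq0.
have evI h : I h -> ev phi xi h = 0.
  move=> Ih; have := congr1 (ev phi xi) (divp_eq h g).
  rewrite rmorphD rmorphM -mul_polyC rmorphM !evE map_polyC hornerC.
  rewrite rxi mulr0 (IX0 _ (h %% g) phi0 (modg _ Ih)) horner0 addr0.
  move/eqP; rewrite mulf_eq0 => /orP[h0|/eqP//].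
  by exfalso; move/negP: (phiX (scalp h g)); apply.
exists (ev phi xi) => //.
move: (congr1 (ev phi xi) pas); rewrite rmorphD (evI y) // addr0 rmorphM.
rewrite pE !evE map_polyC hornerC => phicE.
by apply: contraNneq phic'; rewrite phicE => ->; rewrite mulr0.
Qed.

(** * Denominators of the rational points of the graph *)

Lemma eval_int_polyZX (S : comNzRingType) (n : nat) (c : int) (m : multinom n)
    (x : 'I_n -> S) :
  eval_int_poly (c *: mpolyX int m) x = c%:~R * \prod_i x i ^+ m i.
Proof. by rewrite /eval_int_poly map_mpolyZ map_mpolyX mevalZ mevalX. Qed.

Lemma homog_partE (S : comNzRingType) (n k : nat) (P : mpoly n int) (x : 'I_n -> S) :
  eval_int_poly (homog_part k P) x =
  \sum_(m <- msupp P | mdeg m == k) (mcoeff m P)%:~R * \prod_i x i ^+ m i.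
Proof.
rewrite /eval_int_poly /homog_part /pihomog [map_mpoly _ _]raddf_sum [meval x _]raddf_sum.
by apply: eq_bigr => m _; apply: eval_int_polyZX.
Qed.

Lemma eval_int_polyE (S : comNzRingType) (n : nat) (P : mpoly n int) (x : 'I_n -> S) :
  eval_int_poly P x =
  \sum_(m <- msupp P) (mcoeff m P)%:~R * \prod_i x i ^+ m i.
Proof.
rewrite [in LHS](mpolyE P) /eval_int_poly [map_mpoly _ _]raddf_sum [meval x _]raddf_sum.
by apply: eq_bigr => m _; apply: eval_int_polyZX.
Qed.

Lemma rmorph_eval_int_poly (S T : comNzRingType) (phi : {rmorphism S -> T})
    (n : nat) (P : mpoly n int) (x : 'I_n -> S) :
  phi (eval_int_poly P x) = eval_int_poly P (fun i => phi (x i)).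
Proof.
rewrite !eval_int_polyE rmorph_sum; apply: eq_bigr => m _.
rewrite rmorphM rmorph_int rmorph_prod; congr (_ * _).
by apply: eq_bigr => i _; rewrite rmorphXn.
Qed.

Lemma ex_common_denom (m : nat) (I : Type) (Q : I -> Prop) (u : 'I_m -> I -> rat) :
  (forall j, exists2 c : nat, (0 < c)%N & forall a, exists z : int, c%:R * u j a = z%:~R) ->
  exists2 c : nat, (0 < c)%N & forall j a, exists z : int, c%:R * u j a = z%:~R.
Proof.
move=> h; have /choice[c hc] : forall j, exists c : nat, (0 < c)%N /\
    forall a, exists z : int, c%:R * u j a = z%:~R.
  by move=> j; have [c c0 hc] := h j; exists c.
exists (\prod_j c j)%N; first by rewrite prodn_gt0 // => j; case: (hc j).
move=> j a; have [_ /(_ a)[z hz]] := hc j.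
exists ((\prod_(i | i != j) c i)%N%:R * z).
by rewrite (bigD1 j) //= natrM rmorphM /= -hz rmorph_nat; ring.
Qed.

(* [A] is the iterated polynomial ring over [rat] in the variables [x 0], ...,
   [x n.-1], and [ev a] is the evaluation at the integer point [a]. *)
Lemma ex_polynomial_ring (n : nat) :
  exists (A : idomainType) (x : nat -> A) (ev : (nat -> int) -> {rmorphism A -> rat}),
  [/\ nullstellensatz A,
      forall a i, (i < n)%N -> ev a (x i) = (a i)%:~R
    & forall u, exists2 c : nat, (0 < c)%N &
        forall a, exists z : int, c%:R * ev a u = z%:~R].
Proof.
elim: n => [|n [A [x [ev [nA evx evZ]]]]].
  exists rat, (fun=> 0), (fun=> idfun); split => //; first exact: nullstellensatz_rat.
  move=> u; exists `|denq u|%N; first by rewrite absz_gt0 denq_neq0.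
  by move=> _; exists (numq u); rewrite numqE mulrC natr_absz ger0_norm.
pose x' i : {poly A} := if (i < n)%N then (x i)%:P else 'X.
pose ev' (a : nat -> int) : {rmorphism {poly A} -> rat} :=
  horner_eval ((a n)%:~R) \o map_poly (ev a).
have ev'E a p : ev' a p = (map_poly (ev a) p).[(a n)%:~R] by [].
exists {poly A}, x', ev'; split; first exact: nullstellensatz_poly.
  move=> a i; rewrite ltnS leq_eqVlt ev'E /x' => /orP[/eqP ->|li].
    by rewrite ltnn map_polyX hornerX.
  by rewrite li map_polyC hornerC; apply: evx.
elim/poly_ind => [|p v [c c0 hc]].
  by exists 1%N => // a; exists 0; rewrite rmorph0 mulr0.
have [b b0 hb] := evZ v.
exists (c * b)%N; first by rewrite muln_gt0 c0.
move=> a; have [z hz] := hc a; have [w hw] := hb a.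
exists (b%:R * z * a n + c%:R * w).
have evX : ev' a 'X = (a n)%:~R by rewrite ev'E map_polyX hornerX.
have evC : ev' a v%:P = ev a v by rewrite ev'E map_polyC hornerC.
rewrite (rmorphD (ev' a)) (rmorphM (ev' a)) evX evC.
by rewrite natrM [RHS]rmorphD !(rmorphM intr) /= !rmorph_nat -hz -hw; ring.
Qed.

(* A power of [x_l] lies in the ideal generated by the [E j] over the rational
   polynomials; evaluating this one identity at [a] makes [c] and [N]
   independent of [a]. *)
Lemma ideal_contains_power (n m : nat) (E : 'I_m -> mpoly n int)
    (hE : forall z : 'I_n -> algC, (forall j, eval_int_poly (E j) z = 0) ->
          forall l, z l = 0) (l : 'I_n) :
  exists (c N : nat), (0 < c)%N /\ forall a : 'I_n -> int,
    exists B : 'I_m -> int,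
      c%:R * a l ^+ N = \sum_j B j * eval_int_poly (E j) a.
Proof.
have [A [x [ev [nA evx evZ]]]] := ex_polynomial_ring n.
pose I0 : set A := [set y | exists B : 'I_m -> A,
  y = \sum_j B j * eval_int_poly (E j) (fun i => x (val i))].
have iI0 : is_ideal I0.
  split.
  - by exists (fun=> 0); rewrite big1 // => j _; rewrite mul0r.
  - move=> _ _ [B ->] [C ->]; exists (fun j => B j + C j).
    by rewrite -big_split; apply: eq_bigr => j _; rewrite mulrDl.
  - move=> b _ [B ->]; exists (fun j => b * B j).
    by rewrite big_distrr /=; apply: eq_bigr => j _; rewrite mulrA.
(* Otherwise a prime containing [I0] but not [x l] would give a common zero of the [E j] in [algC]
   with nonzero [l]-th coordinate. *)
have [N [B xB]] : exists N, I0 (x (val l) ^+ N).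
  apply: contrapT => /forallNP nI.
  have [I [pI I0I Ix]] := ex_prime_ideal iI0 nI.
  have [phi phi0 /eqP phix] := nA _ _ pI Ix; apply: phix.
  apply: (hE (fun i => phi (x (val i)))) => j.
  rewrite -rmorph_eval_int_poly; apply: phi0; apply: I0I.
  exists (fun i => (i == j)%:R); rewrite (bigD1 j) //= eqxx mul1r big1 ?addr0 //.
  by move=> i /negbTE ->; rewrite mul0r.
have [c c0 hc] := @ex_common_denom m (nat -> int) (fun=> True)
  (fun j a => ev a (B j)) (fun j => evZ (B j)).
exists c, N; split => // a.
pose a' (i : nat) : int := if insub i is Some k then a k else 0.
have a'E (i : 'I_n) : a' i = a i by rewrite /a' valK.
have /choice[C hC] := fun j => hc j a'.
exists C; apply: (@intr_inj rat).
have := congr1 (ev a') xB.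
rewrite rmorphXn /= evx // a'E rmorph_sum /= => h.
rewrite rmorphM rmorphXn /= rmorph_nat h big_distrr rmorph_sum /=.
apply: eq_bigr => j _.
rewrite rmorphM rmorph_eval_int_poly /= mulrA hC rmorphM /=; congr (_ * _).
rewrite (rmorph_eval_int_poly (intr : {rmorphism int -> rat})) /=.
by congr (eval_int_poly _ _); apply/funext => i; rewrite evx // a'E.
Qed.

(* The value at [(a, b)] of the homogenization of [P] in degree [d]. *)
Definition homog_eval (n : nat) (P : mpoly n int) (d : nat) (a : 'I_n -> int)
    (b : int) : int :=
  \sum_(m <- msupp P) mcoeff m P * \prod_i a i ^+ m i * b ^+ (d - mdeg m).

Lemma homog_evalE (K : numFieldType) (n : nat) (P : mpoly n int) (d : nat)
    (a : 'I_n -> int) (b : int) :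
  (forall m, m \in msupp P -> (mdeg m <= d)%N) -> b != 0 ->
  (homog_eval P d a b)%:~R =
  b%:~R ^+ d * eval_int_poly P (fun i => (a i)%:~R / b%:~R) :> K.
Proof.
move=> hd b0; rewrite eval_int_polyE rmorph_sum big_distrr /=.
rewrite big_seq [RHS]big_seq; apply: eq_bigr => m /hd lemd.
have bK : b%:~R != 0 :> K by rewrite intr_eq0.
have -> : \prod_i ((a i)%:~R / b%:~R) ^+ m i =
    (\prod_i a i ^+ m i)%:~R / b%:~R ^+ mdeg m :> K.
  rewrite mdegE -prodrXr -prodfV rmorph_prod -big_split /=.
  by apply: eq_bigr => i _; rewrite expr_div_n rmorphXn.
rewrite !rmorphM rmorphXn /= -[in RHS](subnK lemd) exprD.
by field; rewrite expf_neq0.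
Qed.

(** Every monomial below degree [d] carries a factor [b], so modulo [b] only the leading form
    remains, on which the hypothesis bears. *)
Lemma homog_eval_mod (n : nat) (P : mpoly n int) (d : nat) (a : 'I_n -> int)
    (b : int) :
  (forall m, m \in msupp P -> (mdeg m <= d)%N) ->
  exists e, homog_eval P d a b = eval_int_poly (homog_part d P) a + b * e.
Proof.
move=> hd; rewrite homog_partE /homog_eval (bigID (fun m => mdeg m == d)) /=.
exists (\sum_(m <- msupp P | mdeg m != d)
  mcoeff m P * \prod_i a i ^+ m i * b ^+ (d - mdeg m).-1).
congr (_ + _).
  by apply: eq_bigr => m /eqP ->; rewrite subnn expr0 mulr1 intz.
rewrite big_distrr /= big_seq_cond [RHS]big_seq_cond; apply: eq_bigr => m.
move=> /andP[/hd le ne]; have lt : (0 < d - mdeg m)%N by rewrite subn_gt0 ltn_neqAle ne.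
by rewrite -[in LHS](prednK lt) exprS; ring.
Qed.

Lemma max_degree_msupp (n m : nat) (P : 'I_m -> mpoly n int) (j : 'I_m) mu :
  mu \in msupp (P j) -> (mdeg mu <= max_degree P)%N.
Proof.
move=> h; have := mmeasure_mnm_lt mdeg h => lt.
apply: leq_trans (leq_bigmax_cond (F := fun j => (mmeasure mdeg (P j)).-1) j isT).
by case: (mmeasure mdeg (P j)) lt.
Qed.

(* Modulo [b ^ d], the [d]-th power of [c * a_l ^ N = u - b * w] is a multiple
   of [u], and [b ^ d] divides [q * u]; as [a] and [b] have no common prime
   factor, [b ^ d] divides a constant multiple of [q]. *)
Lemma homog_denominator_bound (n m : nat) (P : 'I_m -> mpoly n int) (d : nat)
    (hd : forall j mu, mu \in msupp (P j) -> (mdeg mu <= d)%N)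
    (hzero : forall z : 'I_n -> algC,
      (forall j, eval_int_poly (homog_part d (P j)) z = 0) -> forall l, z l = 0) :
  exists2 C : nat, (0 < C)%N & forall (a : 'I_n -> int) (b q : nat), (0 < b)%N ->
    (forall p, prime p -> (p %| b)%N -> exists l, ~~ (p %| `|a l|)%N) ->
    (forall j, (b%:Z ^+ d %| q%:Z * homog_eval (P j) d a b%:Z)%Z) ->
    (b ^ d %| C * q)%N.
Proof.
have /choice[c /choice[N hc]] := ideal_contains_power hzero.
exists (\prod_l c l ^ d)%N.
  by rewrite prodn_gt0 // => l; rewrite expn_gt0; case: (hc l) => ->.
move=> a b q b0 cop hF.
set C := (\prod_l c l ^ d)%N.
have dvl l : (b ^ d %| C * q * `|a l| ^ (N l * d))%N.
  have [_ /(_ a)[B hB]] := hc l.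
  have /choice[e he] := fun j => homog_eval_mod a b%:Z (hd j).
  pose u := \sum_j B j * homog_eval (P j) d a b%:Z.
  pose w := \sum_j B j * e j.
  have eq1 : (c l)%:R * a l ^+ N l = u - b%:Z * w.
    rewrite hB /u /w big_distrr -sumrB; apply: eq_bigr => j _.
    by rewrite he /=; ring.
  have dvu : (b%:Z ^+ d %| q%:Z * u)%Z.
    rewrite /u big_distrr /=; apply: (big_ind (fun x => (b%:Z ^+ d %| x)%Z)) => [|x y hx hy|j _].
    - exact: dvdz0.
    - by rewrite rpredD.
    - by rewrite mulrCA dvdz_mull.
  have dv : (b%:Z ^+ d %| q%:Z * ((c l)%:R * a l ^+ N l) ^+ d)%Z.
    have -> : q%:Z * ((c l)%:R * a l ^+ N l) ^+ d =
        q%:Z * ((u - b%:Z * w) ^+ d - (- (b%:Z * w)) ^+ d) + q%:Z * (- (b%:Z * w)) ^+ d.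
      by rewrite eq1; ring.
    apply: rpredD.
      by rewrite subrXX opprK subrK mulrA dvdz_mulr.
    by rewrite -mulrN exprMn mulrCA dvdz_mulr.
  have : (b ^ d %| q * (c l * `|a l| ^ N l) ^ d)%N.
    by move: dv; rewrite dvdzE !abszM !abszX !abszM !abszX natz !absz_nat.
  rewrite expnMn -expnM => h; rewrite /C (bigD1 l) //=.
  have -> : (c l ^ d * (\prod_(i < n | i != l) c i ^ d) * q * `|a l| ^ (N l * d) =
    (\prod_(i < n | i != l) c i ^ d) * (q * (c l ^ d * `|a l| ^ (N l * d))))%N by ring.
  exact: dvdn_mull.
(* [b ^ d %/ g] is coprime to [C * q %/ g], so it divides each power of [a l] in [dvl]; a prime
   factor of it would divide [b] and all the [a l]. *)
pose g := gcdn (b ^ d) (C * q).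
have bd0 : (0 < b ^ d)%N by rewrite expn_gt0 b0.
have g0 : (0 < g)%N by rewrite gcdn_gt0 bd0.
suff h1 : (b ^ d %/ g = 1)%N.
  have := dvdn_gcdr (b ^ d) (C * q); rewrite -/g.
  by rewrite -[(b ^ d)%N](divnK (dvdn_gcdl _ (C * q))) -/g h1 mul1n.
apply/eqP/negPn/negP => h1.
have hg1 : (1 < b ^ d %/ g)%N.
  by rewrite ltn_neqAle eq_sym h1 divn_gt0 // dvdn_leq // dvdn_gcdl.
have [p pp ph] : exists2 p, prime p & (p %| b ^ d %/ g)%N.
  by exists (pdiv (b ^ d %/ g)); rewrite ?pdiv_prime ?pdiv_dvd.
have pb : (p %| b)%N.
  have : (p %| b ^ d)%N by apply: dvdn_trans ph _; apply: dvdn_div; apply: dvdn_gcdl.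
  by rewrite Euclid_dvdX // => /andP[].
have [l /negP] := cop p pp pb; apply.
suff : (p %| `|a l| ^ (N l * d))%N by rewrite Euclid_dvdX // => /andP[].
apply: dvdn_trans ph _.
have := dvl l; rewrite -{1}[(b ^ d)%N](divnK (dvdn_gcdl _ (C * q))) -/g.
rewrite -[(C * q)%N](divnK (dvdn_gcdr (b ^ d) _)) -/g mulnAC.
rewrite dvdn_pmul2r // Gauss_dvdr //.
rewrite /coprime -(eqn_pmul2r g0) muln_gcdl mul1n.
by rewrite !divnK ?dvdn_gcdl ?dvdn_gcdr.
Qed.

(** Take the least [b] that clears the denominators: a prime common to [b] and all the [a l] could
    be cancelled. *)
Lemma ex_reduced_fraction (n : nat) (p : 'I_n -> int) (q : nat) : (0 < q)%N ->
  exists (a : 'I_n -> int) (b : nat), [/\ (0 < b)%N,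
    forall l, p l * b%:Z = a l * q%:Z
  & forall r, prime r -> (r %| b)%N -> exists l, ~~ (r %| `|a l|)%N].
Proof.
move=> q0.
have ex : exists b, `[< (0 < b)%N /\ exists a : 'I_n -> int,
    forall l, p l * b%:Z = a l * q%:Z >].
  by exists q; apply/asboolP; split => //; exists p.
case: (ex_minnP ex) => b /asboolP[b0 [a ha]] bmin.
exists a, b; split => // r pr rb; apply: contrapT => /forallNP h.
have ra l : (r %| `|a l|)%N by apply/negPn/negP; apply: h.
have r0 : (0 < r)%N := prime_gt0 pr.
have : (b <= b %/ r)%N.
  apply: bmin; apply/asboolP; split; first by rewrite divn_gt0 // dvdn_leq.
  exists (fun l => (a l %/ r%:Z)%Z) => l.
  have rz : r%:Z != 0 by rewrite -lt0n.
  apply: (mulIf rz); rewrite -mulrA -PoszM divnK // ha mulrAC divzK //.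
  by rewrite dvdzE; apply: ra.
by rewrite leqNgt ltn_Pdiv // prime_gt1.
Qed.

(** * Dirichlet's theorem and well-spaced rational points *)

Section Counting.
Variable R : realType.

Lemma indicator_prod (I : finType) (b : I -> bool) :
  \prod_i (b i)%:R = [forall i, b i]%:R :> R.
Proof.
case: forallP => [h|h]; first by apply: big1 => i _; rewrite h.
have [i /negbTE bi] : exists i, ~~ b i.
  by apply: contrapT => /forallNP h'; apply: h => i; apply/negPn/negP/h'.
by rewrite (bigD1 i) //= bi mul0r.
Qed.

Lemma count_union (T I : finType) (r : pred I) (P : pred T) (Q : I -> pred T) :
  (forall j, P j -> exists2 t, r t & Q t j) ->
  \sum_j (P j)%:R <= \sum_(t | r t) \sum_j (Q t j)%:R :> R.
Proof.
move=> h; rewrite exchange_big; apply: ler_sum => j _.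
case: (boolP (P j)) => [/h[t rt Qt]|_]; last by apply: sumr_ge0.
rewrite (bigD1 t) //= Qt lerDl; apply: sumr_ge0 => //.
Qed.

Lemma count_box (n J : nat) (S : 'I_n -> pred 'I_J) (B : R) :
  (forall i, \sum_u (S i u)%:R <= B) ->
  \sum_(j : {ffun 'I_n -> 'I_J}) [forall i, S i (j i)]%:R <= B ^+ n.
Proof.
move=> h.
under eq_bigr do rewrite -indicator_prod.
rewrite -(bigA_distr_bigA (fun i u => (S i u)%:R)) /=.
rewrite -[n in B ^+ n]card_ord -prodr_const; apply: ler_prod => i _.
by rewrite h andbT; apply: sumr_ge0.
Qed.

Lemma count_diff_le (J : nat) (A : pred 'I_J) (L : R) : 0 <= L ->
  (forall u v, A u -> A v -> u%:R - v%:R <= L) ->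
  \sum_u (A u)%:R <= L + 1.
Proof.
move=> L0 h.
have [[u0 Au0]|nA] := pselect (exists u, A u); last first.
  rewrite big1 ?addr_ge0 // => u _; case: (boolP (A u)) => // Au.
  by exfalso; apply: nA; exists u.
case: (@arg_minnP _ u0 A (fun u : 'I_J => nat_of_ord u) Au0) => v Av vmin.
set F := Num.truncn L.
have -> : \sum_u (A u)%:R = #|A|%:R :> R.
  by rewrite -sum1_card natr_sum [RHS]big_mkcond; apply: eq_bigr => u _; rewrite unfold_in; case: (A u).
apply: le_trans (_ : F.+1%:R <= _); last first.
  by rewrite -natr1 lerD2r; have /andP[] := truncn_itv L0.
rewrite ler_nat -[F.+1]card_ord.
apply: (@leq_card_in _ _ (fun u : 'I_J => inord (u - v) : 'I_F.+1)) => u w.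
rewrite !unfold_in => Au Aw.
have le z : A z -> (z - v < F.+1)%N.
  move=> Az; rewrite ltnS truncn_ge_nat // natrB; first exact: h.
  exact: vmin.
move=> /(congr1 val); rewrite /= !inordK ?le // => e.
apply: val_inj => /=.
by rewrite -(subnK (vmin _ Au)) -(subnK (vmin _ Aw)) e.
Qed.

Lemma count_near (J : nat) (c s y rho : R) : 0 < s -> 0 <= rho ->
  \sum_(u < J) (`|c + s * u%:R - y| <= rho)%R%:R <= 2 * rho / s + 1.
Proof.
move=> s0 r0; apply: count_diff_le => [|u v].
  by rewrite divr_ge0 ?mulr_ge0 // ltW.
rewrite !ler_norml => /andP[_ hu] /andP[hv _].
rewrite ler_pdivlMr //; lra.
Qed.

(** At most [b * s * J + 2 * rho + 1] integers are within reach of the progression, and each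
    accounts for the points of an interval of half-width [rho / b]. *)
Lemma count_near_int (J : nat) (c s b rho : R) : 0 < s -> 0 < b -> 0 <= rho ->
  \sum_(u < J) `[< exists a : int, `|b * (c + s * u%:R) - a%:~R| <= rho >]%:R
  <= (b * s * J%:R + 2 * rho + 1) * (2 * rho / (b * s) + 1).
Proof.
move=> s0 b0 r0.
set T := Num.truncn (b * s * J%:R + 2 * rho).
have L0 : 0 <= b * s * J%:R + 2 * rho.
  by rewrite addr_ge0 ?mulr_ge0 // ltW.
have bs0 : 0 < b * s by rewrite mulr_gt0.
pose a0 : int := Num.ceil (b * c - rho).
apply: (@le_trans _ _ (\sum_(t < T.+1) \sum_(u < J)
    (`|b * c + b * s * u%:R - (a0 + t%:Z)%:~R| <= rho)%R%:R)).
  apply: count_union => u /asboolP[a]; rewrite ler_norml => /andP[h1 h2].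
  have uJ : u%:R <= J%:R :> R by rewrite ler_nat ltnW.
  have su : b * s * u%:R <= b * s * J%:R by rewrite ler_pM2l.
  have su0 : 0 <= b * s * u%:R by rewrite mulr_ge0 // ltW.
  have le_a : a0 <= a by rewrite /a0 ceil_le_int; lra.
  have aE : a = a0 + `|a - a0|%N%:Z by rewrite gez0_abs ?subr_ge0 // subrKC.
  have ca : b * c - rho <= a0%:~R by apply: ceil_ge.
  have lt : (`|a - a0| < T.+1)%N.
    rewrite ltnS truncn_ge_nat // pmulrn gez0_abs ?subr_ge0 // intrB; lra.
  exists (Ordinal lt) => //=.
  rewrite -aE ler_norml; apply/andP; split; lra.
apply: (@le_trans _ _ (\sum_(t < T.+1) (2 * rho / (b * s) + 1))).
  by apply: ler_sum => t _; apply: count_near.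
rewrite sumr_const card_ord -[X in X <= _]mulr_natl; apply: ler_wpM2r.
  by rewrite addr_ge0 // divr_ge0 ?mulr_ge0 // ltW.
by rewrite -natr1 lerD2r; have /andP[] := truncn_itv L0.
Qed.

(** Pigeonhole: the fractional parts of [t * x] for the [M ^ n + 1] values [t <= M ^ n] fall into
    [M ^ n] cubes of side [1 / M]. *)
Lemma dirichlet (n : nat) (x : 'I_n -> R) (M : nat) : (0 < M)%N ->
  exists (b : nat) (a : 'I_n -> int),
  [/\ (0 < b)%N, (b <= M ^ n)%N & forall i, `|b%:R * x i - (a i)%:~R| <= M%:R^-1].
Proof.
case: M => // M _.
pose fr (t : nat) (i : 'I_n) : R := t%:R * x i - (Num.floor (t%:R * x i))%:~R.
have fr01 t i : 0 <= fr t i < 1.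
  have := floor_itv (t%:R * x i); rewrite intrD /fr; lra.
pose g (t : 'I_(M.+1 ^ n).+1) : {ffun 'I_n -> 'I_M.+1} :=
  [ffun i => inord (Num.truncn (M.+1%:R * fr t i))].
have lt t i : (Num.truncn (M.+1%:R * fr t i) < M.+1)%N.
  have /andP[f0 f1] := fr01 t i.
  rewrite truncn_lt_nat ?mulr_ge0 // -[ltRHS]mulr1 ltr_pM2l //.
have /injectivePn[t1 [t2 ne12 g12]] : ~~ injectiveb g.
  apply/injectiveP => /leq_card; rewrite card_ffun !card_ord ltnn //.
wlog lt12 : t1 t2 ne12 g12 / (t1 < t2)%N.
  move=> H; have [l|l|e] := ltngtP t1 t2; first exact: (H t1 t2).
    by apply: (H t2 t1) => //; rewrite eq_sym.
  by move: ne12; rewrite (val_inj e) eqxx.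
exists (t2 - t1)%N, (fun i => Num.floor (t2%:R * x i) - Num.floor (t1%:R * x i)).
split; first by rewrite subn_gt0.
  by apply: leq_trans (leq_subr _ _) _; rewrite -ltnS.
move=> i; rewrite natrB 1?ltnW // intrB.
have -> : (t2%:R - t1%:R) * x i -
   ((Num.floor (t2%:R * x i))%:~R - (Num.floor (t1%:R * x i))%:~R) = fr t2 i - fr t1 i.
  by rewrite /fr; ring.
have M0 : 0 < M.+1%:R :> R by [].
have /ffunP/(_ i)/(congr1 val) := g12.
rewrite !ffunE /= !inordK // => e.
have h1 : 0 <= M.+1%:R * fr t1 i by rewrite mulr_ge0 //; case/andP: (fr01 t1 i).
have h2 : 0 <= M.+1%:R * fr t2 i by rewrite mulr_ge0 //; case/andP: (fr01 t2 i).
have := truncn_itv h1; have := truncn_itv h2; rewrite e -[(Num.truncn _).+1%:R]natr1.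
set T := (Num.truncn _)%:R => /andP[a1 a2] /andP[a3 a4].
rewrite -[X in _ <= X]mul1r ler_pdivlMr // -[X in _ * X](gtr0_norm M0) -normrM ler_norml.
by apply/andP; split; lra.
Qed.

End Counting.

Section Level.
Variable R : realType.

Lemma exists_nat_ge (x : R) : exists N : nat, forall M, (N <= M)%N -> x <= M%:R.
Proof.
exists (Num.truncn `|x|).+1 => M le.
apply: le_trans (ler_norm x) _; apply: ltW.
have /andP[_ h] := truncn_itv (normr_ge0 x).
by apply: lt_le_trans h _; rewrite ler_nat.
Qed.

(* Grid points whose Dirichlet denominator is below [M ^ n / denom_ratio n] make
   up at most the fraction [2 * 24 ^ n / denom_ratio n = 1 / 4] of the grid. *)
Definition denom_ratio (n : nat) : nat := (8 * 24 ^ n)%N.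
(** With [K = denom_ratio n], two grid points [(2 * K + 4) * s] apart, each moved by at most [K * s]
    to a rational point, stay [4 * s] apart: more than two radii at most [s] and a set of diameter
    below [s] can bridge. *)
Definition grid_ratio (n : nat) : nat := (2 * denom_ratio n + 4)%N.
(** Dirichlet's theorem approximates within [1 / (b * M)], which is of this order when [b] is
    comparable with its maximum [M ^ n]. *)
Definition spacing (n M : nat) : R := (M%:R ^+ n.+1)^-1.
Definition grid_step (n M : nat) : R := (grid_ratio n)%:R * spacing n M.
Definition grid_size (n M : nat) (phi : R) : nat :=
  Num.truncn (phi / (2 * grid_step n M)).
(** The grid fills the middle half of the box, which leaves room for moving its points to rational
    ones and for the balls around these. *)
Definition grid_point (n M J : nat) (c : 'I_n -> R) (phi : R)
    (j : {ffun 'I_n -> 'I_J}) (i : 'I_n) : R :=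
  c i + phi / 4 + grid_step n M * (j i)%:R.

Definition good_grid_point (n M J : nat) (c : 'I_n -> R) (phi : R)
    (j : {ffun 'I_n -> 'I_J}) : Prop :=
  exists (b : nat) (a : 'I_n -> int), [/\ (0 < b)%N, (b <= M ^ n)%N
    & forall i, `|grid_point M c phi j i - (a i)%:~R / b%:R|
        <= (denom_ratio n)%:R * spacing n M].

Lemma spacing_gt0 n M : (0 < M)%N -> 0 < spacing n M.
Proof. by move=> M0; rewrite invr_gt0 exprn_gt0 // ltr0n. Qed.

Lemma grid_step_gt0 n M : (0 < M)%N -> 0 < grid_step n M.
Proof. by move=> M0; rewrite mulr_gt0 ?spacing_gt0 // ltr0n /grid_ratio addn_gt0 orbT. Qed.

Lemma grid_size_le n M (phi : R) : (0 < M)%N -> 0 < phi ->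
  (grid_size n M phi)%:R <= phi / (2 * grid_step n M).
Proof.
move=> M0 p0; rewrite truncn_le divr_ge0 // ?mulr_ge0 // ltW //.
exact: spacing_gt0.
Qed.

Lemma grid_size_ge n M (phi : R) : (0 < M)%N -> 0 < phi -> grid_step n M <= phi / 8 ->
  phi / (4 * grid_step n M) <= (grid_size n M phi)%:R.
Proof.
move=> M0 p0; have := grid_step_gt0 n M0; rewrite /grid_size.
move: (grid_step n M) => s s0 le.
have /andP[_] : (Num.truncn (phi / (2 * s)))%:R <= phi / (2 * s)
   < (Num.truncn (phi / (2 * s))).+1%:R.
  by apply: truncn_itv; rewrite divr_ge0 // ?mulr_ge0 // ltW.
rewrite -[(Num.truncn _).+1%:R]natr1; move: (Num.truncn _)%:R => J.
have -> : phi / (2 * s) = 2 * (phi / (4 * s)) by field; rewrite lt0r_neq0.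
have : 1 <= phi / (4 * s) by rewrite ler_pdivlMr ?mulr_gt0 //; lra.
lra.
Qed.

(** A grid point that is not good is within [1 / (b * M)] of a fraction whose denominator [b] is
    below [M ^ n / denom_ratio n]; these neighbourhoods, summed over [b], contain at most a quarter
    of the grid. *)
Lemma level_grid (n : nat) (c : 'I_n -> R) (phi : R) : (0 < n)%N -> 0 < phi ->
  exists M0, forall M, (M0 <= M)%N ->
  [/\ (0 < M)%N, grid_step n M <= phi / 8
    & 3 / 4 * (grid_size n M phi)%:R ^+ n <=
      \sum_(j : {ffun 'I_n -> 'I_(grid_size n M phi)})
        `[< good_grid_point M c phi j >]%:R :> R].
Proof.
move=> n0 p0.
set K := denom_ratio n; set lam := grid_ratio n.
have K0 : 0 < K%:R :> R by rewrite ltr0n /K /denom_ratio muln_gt0 expn_gt0.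
(* For [b >= 6 / phi] the fractions are dense enough for the count in the box to be of the order of
   its volume. The fewer than [B0] smaller denominators obey a cruder bound, absorbed by [hM2] for
   large [M]. *)
pose B0 := (Num.truncn (6 / phi)).+1.
have [M1 hM1] := exists_nat_ge (8 * lam%:R / phi).
have [M2 hM2] := exists_nat_ge (B0%:R * (phi + 3) ^+ n * K%:R / phi ^+ n).
exists (M1 + M2 + K).+1 => M le.
have M0 : (0 < M)%N by apply: leq_trans le.
have MR0 : 0 < M%:R :> R by rewrite ltr0n.
have MR1 : 1 <= M%:R :> R by rewrite ler1n.
have {}hM1 := hM1 M ltac:(lia).
have {}hM2 := hM2 M ltac:(lia).
have leMX k : (0 < k)%N -> M%:R <= M%:R ^+ k :> R by move=> k0; apply: ler_eXnr.
have s0 : 0 < grid_step n M := grid_step_gt0 n M0; have sp0 := spacing_gt0 n M0.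
have sle : grid_step n M <= phi / 8.
  rewrite /grid_step /spacing ler_pdivrMr ?exprn_gt0 //.
  apply: le_trans (_ : phi / 8 * M%:R <= _).
    by move: hM1; rewrite ler_pdivrMr // /lam; lra.
  by rewrite ler_pM2l ?divr_gt0 // leMX.
split => //.
set J := grid_size n M phi.
have [s sE] : exists s, s = grid_step n M by exists (grid_step n M).
rewrite -sE in s0 sle.
have Jle : J%:R <= phi / (2 * s) by rewrite sE; apply: grid_size_le.
have Jge : phi / (4 * s) <= J%:R by rewrite sE; apply: grid_size_ge => //; rewrite -sE.
pose rho : R := M%:R^-1.
have rho0 : 0 <= rho by rewrite invr_ge0 ltW.
have rho1 : rho <= 1 by rewrite invf_le1.
pose S (b : nat) (i : 'I_n) (u : 'I_J) :=
  `[< exists a : int, `|b%:R * (c i + phi / 4 + s * u%:R) - a%:~R| <= rho >].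
pose rB := [pred b : 'I_(M ^ n).+1 | (0 < b)%N && (b * K < M ^ n)%N].
have bad : \sum_(j : {ffun 'I_n -> 'I_J}) (~~ `[< good_grid_point M c phi j >])%:R
   <= \sum_(b | rB b) \sum_(j : {ffun 'I_n -> 'I_J}) [forall i, S b i (j i)]%:R :> R.
  apply: count_union => j /asboolPn ng.
  have [b [a [b0 bM ha]]] := dirichlet (grid_point M c phi j) M0.
  have bR0 : 0 < b%:R :> R by rewrite ltr0n.
  have bK : (b * K < M ^ n)%N.
    rewrite ltnNge; apply/negP => leK; apply: ng; exists b, a; split => // i.
    rewrite -(ler_pM2l bR0) -{1}(gtr0_norm bR0) -normrM mulrBr.
    have -> : b%:R * ((a i)%:~R / b%:R) = (a i)%:~R :> R by field; rewrite lt0r_neq0.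
    apply: le_trans (ha i) _.
    rewrite /spacing exprS invfM -/K.
    rewrite [X in _ <= X](_ : _ = M%:R^-1 * ((b%:R * K%:R) / M%:R ^+ n)); last by ring.
    rewrite ler_peMr // ler_pdivlMr ?exprn_gt0 // mul1r -natrX -natrM ler_nat.
    exact: leK.
  have bl : (b < (M ^ n).+1)%N by rewrite ltnS.
  exists (Ordinal bl); rewrite /= ?b0 ?bK //.
  by apply/forallP => i; apply/asboolP; exists (a i); rewrite sE; apply: ha.
have sumb (b : 'I_(M ^ n).+1) : rB b ->
    \sum_(j : {ffun 'I_n -> 'I_J}) [forall i, S b i (j i)]%:R <=
    (6 / (M%:R * s)) ^+ n * (phi ^+ n + (b < B0)%N%:R * (phi + 3) ^+ n).
  move=> /andP[b0 bK].
  have bR0 : 0 < b%:R :> R by rewrite ltr0n.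
  have bR1 : 1 <= b%:R :> R by rewrite ler1n.
  apply: le_trans (count_box (fun i => count_near_int J (c i + phi / 4) s0 bR0 rho0)) _.
  apply: (@le_trans _ _ ((6 / (M%:R * s) * (phi / 2 + 3 / b%:R)) ^+ n)).
    rewrite lerXn2r ?nnegrE //.
    - by rewrite mulr_ge0 // addr_ge0 // ?addr_ge0 ?mulr_ge0 // ?invr_ge0 ?mulr_ge0 // ltW.
    - by rewrite mulr_ge0 // ?addr_ge0 ?divr_ge0 ?mulr_ge0 // ltW.
    have Js : s * J%:R <= phi / 2.
      by rewrite mulrC; move: Jle; rewrite ler_pdivlMr ?mulr_gt0 //; lra.
    apply: (@le_trans _ _ ((b%:R * (phi / 2) + 3) * (6 / (M%:R * s) / b%:R))); last first.
      rewrite le_eqVlt; apply/orP; left; apply/eqP; field.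
      by rewrite !lt0r_neq0.
    apply: ler_pM.
    - by rewrite !addr_ge0 // !mulr_ge0 // ltW.
    - by rewrite addr_ge0 // divr_ge0 ?mulr_ge0 // ltW.
    - rewrite -mulrA; have : b%:R * (s * J%:R) <= b%:R * (phi / 2) by rewrite ler_pM2l.
      by move: rho1; lra.
    - have -> : 6 / (M%:R * s) / b%:R = 2 * rho / (b%:R * s) + 4 * (rho / (b%:R * s)).
        by rewrite /rho; field; rewrite !lt0r_neq0.
      rewrite lerD2l.
      have lam0 : 0 < lam%:R :> R by rewrite ltr0n /lam /grid_ratio addn_gt0 orbT.
      have -> : rho / (b%:R * s) = (M%:R ^+ n) / (b%:R * lam%:R).
        rewrite /rho sE /grid_step /spacing exprS -/lam; field.
        by rewrite expf_neq0 !lt0r_neq0.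
      rewrite mulrA ler_pdivlMr ?mulr_gt0 // mul1r.
      have : b%:R * K%:R <= M%:R ^+ n :> R.
        by rewrite -natrX -natrM ler_nat ltnW.
      have : lam%:R <= 4 * K%:R :> R.
        rewrite -natrM ler_nat /lam /grid_ratio -/K.
        have K2 : (2 <= K)%N.
          by rewrite /K /denom_ratio (leq_trans _ (leq_pmulr 8 _)) // expn_gt0.
        have -> : (4 * K = 2 * K + 2 * K)%N by rewrite -mulnDl.
        by rewrite leq_add2l (leq_mul2l 2 2 K).
      rewrite -(ler_pM2l bR0); lra.
  rewrite exprMn ler_wpM2l //.
    by rewrite exprn_ge0 // divr_ge0 // mulr_ge0 // ltW.
  have [lb|lb] := ltnP b B0.
    rewrite mul1r; apply: (@le_trans _ _ ((phi + 3) ^+ n)); last first.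
      by rewrite lerDr exprn_ge0 // ltW.
    apply: lerXn2r; rewrite ?nnegrE ?addr_ge0 ?divr_ge0 // ?(ltW p0) //.
    have : 3 / b%:R <= 3 :> R by rewrite ler_pdivrMr //; lra.
    by move: p0; lra.
  rewrite mul0r addr0; apply: lerXn2r; rewrite ?nnegrE ?addr_ge0 ?divr_ge0 // ?(ltW p0) //.
  have : 3 / b%:R <= phi / 2 :> R; last by lra.
  rewrite ler_pdivrMr //.
  have : 6 / phi <= b%:R.
    have /andP[_ h] : (Num.truncn (6 / phi))%:R <= 6 / phi < B0%:R.
      by apply: truncn_itv; rewrite divr_ge0 // ltW.
    by apply: le_trans (ltW h) _; rewrite ler_nat.
  by rewrite ler_pdivrMr //; lra.
have BK1 : 1 <= M%:R ^+ n / K%:R :> R.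
  rewrite ler_pdivlMr // mul1r; apply: le_trans (leMX n n0); rewrite ler_nat.
  exact: leq_trans (leqW (leq_addl _ _)) le.
have cntb : \sum_(b | rB b) 1 <= M%:R ^+ n / K%:R :> R.
  rewrite big_mkcond /= (eq_bigr (fun b => (rB b)%:R)); last by move=> b _ /=; case: (_ && _).
  rewrite -[X in _ <= X](subrK 1); apply: count_diff_le; first by rewrite subr_ge0.
  move=> u v /andP[_ hu] /andP[v0 _]; apply: lerB; last by rewrite ler1n.
  by rewrite ler_pdivlMr // -natrX -natrM ler_nat ltnW.
have cntB0 : \sum_(b | rB b) (b < B0)%N%:R <= B0%:R :> R.
  apply: (@le_trans _ _ (\sum_(b < (M ^ n).+1) (b < B0)%N%:R)).
    by rewrite big_mkcond; apply: ler_sum => b _; case: ifP.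
  rewrite -[X in _ <= X](subrK 1).
  apply: (@count_diff_le R (M ^ n).+1 (fun b => (b < B0)%N)); first by rewrite subr_ge0 ler1n.
  move=> u v hu _; have : u.+1%:R <= B0%:R :> R by rewrite ler_nat.
  by rewrite -natr1; have : 0 <= v%:R :> R by []; lra.
have {}bad : \sum_(j : {ffun 'I_n -> 'I_J}) (~~ `[< good_grid_point M c phi j >])%:R
    <= 1 / 4 * J%:R ^+ n :> R.
  apply: le_trans bad _.
  apply: le_trans (ler_sum _ (fun b hb => sumb b hb)) _.
  rewrite -big_distrr /= big_split /= -big_distrl /=.
  rewrite (eq_bigr (fun b => phi ^+ n * 1)); last by move=> b _; rewrite mulr1.
  rewrite -big_distrr /=.
  apply: (@le_trans _ _ ((6 / (M%:R * s)) ^+ n * (2 * (M%:R ^+ n / K%:R) * phi ^+ n))).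
    rewrite ler_wpM2l //; first by rewrite exprn_ge0 // divr_ge0 // mulr_ge0 // ltW.
    have h1 : phi ^+ n * (\sum_(b | rB b) 1) <= phi ^+ n * (M%:R ^+ n / K%:R).
      by rewrite ler_wpM2l // exprn_ge0 // ltW.
    have h2 : (\sum_(b | rB b) (b < B0)%N%:R) * (phi + 3) ^+ n <= B0%:R * (phi + 3) ^+ n.
      by rewrite ler_wpM2r // exprn_ge0 // addr_ge0 // ltW.
    have h3 : B0%:R * (phi + 3) ^+ n <= phi ^+ n * (M%:R ^+ n / K%:R).
      rewrite mulrA ler_pdivlMr // mulrC -[X in _ <= X]mulrC.
      rewrite -ler_pdivrMr ?exprn_gt0 //.
      by apply: le_trans (leMX n n0); rewrite mulrC.
    lra.
  have -> : (6 / (M%:R * s)) ^+ n * (2 * (M%:R ^+ n / K%:R) * phi ^+ n) =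
      2 / K%:R * 24 ^+ n * (phi / (4 * s)) ^+ n.
    have -> : 6 / (M%:R * s) = M%:R^-1 * (24 * (4 * s)^-1).
      by field; rewrite !lt0r_neq0.
    rewrite !exprMn exprVn; field.
    by rewrite !lt0r_neq0 // exprn_gt0.
  have -> : 2 / K%:R * 24 ^+ n = 1 / 4 :> R.
    rewrite /K /denom_ratio natrM natrX; field.
    by rewrite lt0r_neq0 // exprn_gt0.
  rewrite ler_pM2l ?divr_gt0 // lerXn2r ?nnegrE //.
  by rewrite divr_ge0 // ?mulr_ge0 // ltW.
have tot : \sum_(j : {ffun 'I_n -> 'I_J}) 1 = J%:R ^+ n :> R.
  by rewrite sumr_const card_ffun !card_ord natrX.
have : \sum_(j : {ffun 'I_n -> 'I_J}) `[< good_grid_point M c phi j >]%:R +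
   \sum_(j : {ffun 'I_n -> 'I_J}) (~~ `[< good_grid_point M c phi j >])%:R = J%:R ^+ n :> R.
  by rewrite -big_split -tot; apply: eq_bigr => j _; case: asboolP => _ /=; ring.
lra.
Qed.

End Level.

(** * Divergent series *)

Section DivergentSeries.
Variable R : realType.

Lemma exprD_le_2X (x y : R) n : 0 <= x -> 0 <= y ->
  (x + y) ^+ n <= 2 ^+ n * (x ^+ n + y ^+ n).
Proof.
move=> x0 y0; wlog le : x y x0 y0 / x <= y.
  move=> H; have [le|/ltW le] := leP x y; first exact: H.
  by rewrite addrC [x ^+ n + _]addrC; apply: H.
apply: (@le_trans _ _ ((2 * y) ^+ n)).
  by apply: lerXn2r; rewrite ?nnegrE ?addr_ge0 ?mulr_ge0 //; lra.
by rewrite exprMn ler_wpM2l ?exprn_ge0 // lerDr exprn_ge0.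
Qed.

Lemma sum_geometric_le (q : R) (k : nat) : 0 <= q <= 1 / 2 ->
  \sum_(i < k) q ^+ (k - i) <= 2 * q.
Proof.
move=> /andP[q0 q2]; elim: k => [|k IH]; first by rewrite big_ord0 mulr_ge0.
rewrite big_ord_recr /= subSnn expr1.
rewrite (eq_bigr (fun i : 'I_k => q * q ^+ (k - i))); last first.
  by move=> i _; rewrite subSn ?exprS // ltnW.
rewrite -big_distrr /=.
have : q * \sum_(i < k) q ^+ (k - i) <= 1 / 2 * (2 * q).
  by apply: ler_pM => //; apply: sumr_ge0 => i _; rewrite exprn_ge0.
lra.
Qed.

Definition diverges (u : nat -> R) : Prop :=
  forall S, exists N, S <= \sum_(i < N) u i.

Lemma diverges_shift (u : nat -> R) k0 : diverges u -> (forall k, 0 <= u k) ->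
  diverges (fun k => u (k0 + k)%N).
Proof.
move=> du u0 S; have [N hN] := du (S + \sum_(i < k0) u i).
exists N.
have : \sum_(i < N) u i <= \sum_(i < k0 + N) u i.
  rewrite -!(big_mkord xpredT u) [leRHS](@big_cat_nat _ _ _ N) //=; last by rewrite leq_addl.
  by rewrite lerDl sumr_ge0.
rewrite big_split_ord /=; lra.
Qed.

(** Either [u] is eventually at most [1] and a tail is unchanged, or infinitely many terms become
    [1]. *)
Lemma diverges_min1 (u : nat -> R) : diverges u -> (forall k, 0 <= u k) ->
  diverges (fun k => Num.min (u k) 1).
Proof.
move=> du u0.
have m0 k : 0 <= Num.min (u k) 1 by rewrite le_min u0 /=.
have [[k1 hk1]|h] := pselect (exists k1, forall k, (k1 <= k)%N -> u k <= 1).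
  move=> S; have [N hN] := diverges_shift k1 du u0 S.
  exists (k1 + N)%N; rewrite big_split_ord /=.
  apply: le_trans hN _; rewrite -[leLHS]add0r; apply: lerD.
    exact: sumr_ge0.
  by apply: ler_sum => i _; rewrite min_l // hk1 // leq_addr.
have cnt : forall m, exists N, m%:R <= \sum_(i < N) Num.min (u i) 1.
  elim=> [|m [N hN]]; first by exists 0%N; rewrite big_ord0.
  have [k [Nk uk]] : exists k, (N <= k)%N /\ 1 < u k.
    apply: contrapT => /forallNP hk; apply: h; exists N => k Nk.
    by rewrite leNgt; apply/negP => ?; apply: (hk k).
  exists k.+1; rewrite big_ord_recr /= (min_r (ltW uk)) -natr1 lerD2r.
  apply: le_trans hN _; rewrite -!(big_mkord xpredT (fun i => Num.min (u i) 1)).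
  rewrite [leRHS](@big_cat_nat _ _ _ N) //=.
  by rewrite lerDl sumr_ge0.
move=> S; have [m hm] := exists_nat_ge S.
by have [N hN] := cnt m; exists N; apply: le_trans (hm m (leqnn m)) hN.
Qed.

(** Cauchy condensation: the block from [Q ^ k] to [Q ^ k.+1] has at most [Q ^ k.+1] terms, each at
    most [(Q ^ k.+1) ^ n * g (Q ^ k)]. *)
Lemma condensation (n Q : nat) (g : nat -> R) : (1 < Q)%N ->
  (forall b, (0 < b)%N -> 0 <= g b) ->
  (forall b b', (0 < b)%N -> (b <= b')%N -> g b' <= g b) ->
  (forall S, exists N, S <= \sum_(1 <= b < N) b%:R ^+ n * g b) ->
  diverges (fun k => ((Q ^ k)%N%:R) ^+ n.+1 * g (Q ^ k)%N).
Proof.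
move=> Q1 g0 gdecr dg.
have Q0 k : (0 < Q ^ k)%N by rewrite expn_gt0 ltnW.
have blocks K : \sum_(1 <= b < Q ^ K) b%:R ^+ n * g b <=
    Q%:R ^+ n.+1 * \sum_(k < K) ((Q ^ k)%N%:R) ^+ n.+1 * g (Q ^ k)%N.
  elim: K => [|K IH]; first by rewrite big_geq // big_ord0 mulr0.
  rewrite (@big_cat_nat _ _ _ (Q ^ K)) //=; last by rewrite leq_exp2l.
  rewrite big_ord_recr /= mulrDr; apply: lerD => //.
  apply: (@le_trans _ _ (\sum_(Q ^ K <= b < Q ^ K.+1) ((Q ^ K.+1)%N%:R ^+ n * g (Q ^ K)%N))).
    apply: ler_sum_nat => b /andP[lb ub].
    apply: ler_pM; rewrite ?exprn_ge0 ?g0 //.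
    - by apply: leq_trans lb.
    - by apply: lerXn2r; rewrite ?nnegrE // ler_nat ltnW.
    - exact: gdecr.
  rewrite sumr_const_nat -[X in X <= _]mulr_natl mulrA.
  apply: (@le_trans _ _ ((Q ^ K.+1)%N%:R * (Q ^ K.+1)%N%:R ^+ n * g (Q ^ K)%N)).
    apply: ler_wpM2r; first exact: g0.
    by apply: ler_wpM2r; [apply: exprn_ge0|rewrite ler_nat leq_subr].
  by rewrite -exprS expnS natrM exprMn mulrA.
move=> S.
have Qp : 0 < Q%:R ^+ n.+1 :> R by rewrite exprn_gt0 // ltr0n ltnW.
have [N hN] := dg (Q%:R ^+ n.+1 * S).
exists N; rewrite -(ler_pM2l Qp); apply: le_trans hN (le_trans _ (blocks N)).
have NQ : (N <= Q ^ N)%N by rewrite ltnW // ltn_expl.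
case: N NQ => [|N] NQ; first by rewrite big_geq // big_geq.
rewrite [leRHS](@big_cat_nat _ _ _ N.+1) //=.
rewrite lerDl big_nat; apply: sumr_ge0 => b /andP[lb _].
by rewrite mulr_ge0 ?exprn_ge0 // g0 // (leq_trans _ lb).
Qed.

(** The first partial sum that reaches [T] overshoots by at most one term. The lower bound gives the
    family its total weight, the upper one its packing bound. *)
Lemma diverges_window (u : nat -> R) (T : R) : 0 <= T ->
  (forall k, 0 <= u k <= 1) -> diverges u ->
  exists N, T <= \sum_(i < N) u i <= T + 1.
Proof.
move=> T0 u01 du.
have ex : exists N, T <= \sum_(i < N) u i by apply: du.
case: (ex_minnP ex) => [[|N]] hN Nmin.
  by exists 0%N; rewrite hN big_ord0 addr_ge0.
exists N.+1; rewrite hN big_ord_recr /=.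
have : \sum_(i < N) u i < T.
  by rewrite ltNge; apply/negP => /Nmin; rewrite ltnn.
by have /andP[_] := u01 N; lra.
Qed.

End DivergentSeries.

(** * Jarnik's theorem *)

Section FamilyAux.
Variable R : realType.

Lemma spacingD (n q k e : nat) : (0 < q)%N ->
  spacing R n (q ^ (k + e)) = spacing R n (q ^ k) * (q%:R^-1 ^+ e) ^+ n.+1.
Proof.
move=> q0; have q0' : q%:R != 0 :> R by rewrite pnatr_eq0 -lt0n.
by rewrite /spacing !natrX exprD exprMn invfM !exprVn.
Qed.

(** Bounds the points of spacing [s] discarded on account of a lower level with spacing [s'] and
    radii [p']. The first term is the share of volume of the lower balls; the second comes from
    margins proportional to [s] around them, and is small because spacings decrease
    geometrically. *)
Lemma discarded_bound (n : nat) (phi s s' p' K lam J' q : R) :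
  0 < phi -> 0 < s -> 0 < s' -> 0 <= p' -> 0 <= K -> lam = 2 * K + 4 ->
  0 <= J' -> J' <= phi / (2 * (lam * s')) -> (s / s') ^+ n <= q ->
  J' ^+ n * (2 * (p' + (3 + K) * s) / (lam * s) + 1) ^+ n <=
  (phi / (4 * (lam * s))) ^+ n * (8 ^+ n * (p' / s') ^+ n + 12 ^+ n * q).
Proof.
move=> phi0 s0 s'0 p'0 K0 lamE J0 Jle le_q.
have lam1 : 1 <= lam by rewrite lamE; lra.
have lam0 : 0 < lam by lra.
have ls0 : 0 < lam * s by rewrite mulr_gt0.
have ls'0 : 0 < lam * s' by rewrite mulr_gt0.
set A := phi / (4 * (lam * s)).
have A0 : 0 <= A by rewrite divr_ge0 ?mulr_ge0 // ltW.
have st1 : 2 * (p' + (3 + K) * s) / (lam * s) + 1 <= 2 * p' / (lam * s) + 3.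
  have : (2 * (3 + K) * s) / (lam * s) <= 2.
    rewrite ler_pdivrMr // mulrA ler_pM2r // lamE; lra.
  have -> : 2 * (p' + (3 + K) * s) / (lam * s) =
    2 * p' / (lam * s) + (2 * (3 + K) * s) / (lam * s) by ring.
  lra.
have st0 : 0 <= 2 * (p' + (3 + K) * s) / (lam * s) + 1.
  by rewrite addr_ge0 // divr_ge0 ?(ltW ls0) // mulr_ge0 // addr_ge0 // mulr_ge0 ?addr_ge0 // ltW.
have x0 : 0 <= 2 * p' / (lam * s) by rewrite divr_ge0 ?mulr_ge0 // ltW.
have r0 : 0 <= s / s' by rewrite divr_ge0 // ltW.
have JA : J' <= A * (2 * (s / s')).
  apply: le_trans Jle _; rewrite le_eqVlt; apply/orP; left; apply/eqP.
  by rewrite /A; field; rewrite !lt0r_neq0.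
clearbody A.
apply: (@le_trans _ _ ((A * (2 * (s / s'))) ^+ n * (2 * p' / (lam * s) + 3) ^+ n)).
  apply: ler_pM; [by apply: exprn_ge0|by apply: exprn_ge0| |];
    apply: lerXn2r; rewrite ?nnegrE //; first by apply: mulr_ge0 => //; apply: mulr_ge0.
  by rewrite addr_ge0.
rewrite exprMn -[X in X <= _]mulrA ler_wpM2l ?exprn_ge0 //.
apply: (@le_trans _ _ ((2 * (s / s')) ^+ n * (2 ^+ n * ((2 * p' / (lam * s)) ^+ n + 3 ^+ n)))).
  apply: ler_wpM2l; last exact: exprD_le_2X.
  by apply: exprn_ge0; apply: mulr_ge0.
have -> : (2 * (s / s')) ^+ n * (2 ^+ n * ((2 * p' / (lam * s)) ^+ n + 3 ^+ n)) =
   8 ^+ n * (p' / (lam * s')) ^+ n + 12 ^+ n * (s / s') ^+ n.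
  rewrite mulrA -exprMn mulrDr -!exprMn; congr (_ ^+ _ + _ ^+ _); last by ring.
  by field; rewrite !lt0r_neq0.
apply: lerD; (apply: ler_wpM2l; first exact: exprn_ge0) => //.
apply: lerXn2r; rewrite ?nnegrE ?divr_ge0 ?(ltW s'0) ?(ltW ls'0) //.
by rewrite ler_wpM2l // lef_pV2 ?posrE // ler_peMl // ltW.
Qed.

End FamilyAux.

Definition sup_close (R : realType) (n : nat) (x y : 'I_n -> R) (r : R) : Prop :=
  forall i, `|x i - y i| <= r.

Section Jarnik.
Variables (R : realType) (n : nat) (f : R -> R) (Phi : nat -> R).
Hypothesis n0 : (0 < n)%N.
Hypothesis fpos : forall r : R, 0 < r -> 0 < f r.
Hypothesis fmono : forall r s : R, 0 < r -> r <= s -> f r <= f s.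
Hypothesis flim0 : forall e : R, 0 < e -> exists2 r0 : R, 0 < r0 &
  forall r : R, 0 < r -> r <= r0 -> f r <= e.
Hypothesis flim : forall A : R, exists2 r0 : R, 0 < r0 &
  forall r : R, 0 < r -> r <= r0 -> A * r ^+ n <= f r.
Hypothesis fdecr : forall r s : R, 0 < r -> r <= s -> r ^+ n * f s <= s ^+ n * f r.
Hypothesis Ppos : forall b, (0 < b)%N -> 0 < Phi b.
Hypothesis Pmono : forall b b', (0 < b)%N -> (b <= b')%N -> Phi b' <= Phi b.
Hypothesis Pdiv : forall S : R, exists N, S <= \sum_(1 <= b < N) b%:R ^+ n * f (Phi b).

(** With [q = 1 / level_base], the margins of all lower levels cost at most [12 ^ n * (q + q ^ 2 +
    ...) <= 12 ^ n * 2 * q = 1 / 8] of a grid. *)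
Definition level_base : nat := (16 * 12 ^ n)%N.

Let base1 : (1 < level_base)%N.
Proof. by rewrite /level_base (@leq_trans 16) // leq_pmulr // expn_gt0. Qed.

(* Truncating [Phi] at [eps * s] costs nothing, since [f (eps * s) >= s ^+ n]
   for small [s], and makes the balls small compared with the spacing [s]. *)
Lemma ex_levels (k1 : nat) (eps : R) : 0 < eps -> eps <= 1 ->
  exists k0, (k1 <= k0)%N /\
  let M i := (level_base ^ (k0 + i))%N in
  let s i := spacing R n (M i) in
  let ph i := Num.min (Phi (M i ^ n)%N) (eps * s i) in
  exists t : nat -> R,
  [/\ forall i, 0 <= t i <= 1, diverges t,
      forall i, t i * s i ^+ n <= f (ph i)
    & forall i, ph i ^+ n <= eps * (t i * s i ^+ n)].
Proof.
move=> eps0 eps1.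
have [r1 r10 hr1] := flim (eps ^- n).
have [N1 hN1] := exists_nat_ge (r1^-1).
exists (k1 + N1)%N; split; first exact: leq_addr.
move=> M s ph.
have M0 i : (0 < M i)%N by rewrite expn_gt0 ltnW.
have s0 i : 0 < s i by apply: spacing_gt0.
have P0 i : 0 < Phi (M i ^ n)%N by rewrite Ppos // expn_gt0 M0.
have sr i : s i <= r1.
  have MN : (N1 <= M i)%N.
    apply: (@leq_trans (k1 + N1 + i)); first by rewrite -addnA addnCA leq_addr.
    by rewrite ltnW // ltn_expl.
  rewrite /s /spacing -[r1]invrK lef_pV2 ?posrE ?invr_gt0 ?exprn_gt0 ?ltr0n //.
  apply: le_trans (hN1 _ MN) _; rewrite exprS ler_peMr // exprn_ege1 //.
  by rewrite ler1n.
have es0 i : 0 < eps * s i by rewrite mulr_gt0.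
have esr i : eps * s i <= r1.
  by apply: le_trans (sr i); rewrite ler_piMl // ltW.
have sn0 i : 0 < s i ^+ n by rewrite exprn_gt0.
have ph0 i : 0 < ph i by rewrite /ph lt_min P0 es0.
(* The weight per cell of volume [s i ^+ n], capped at [1] so that partial sums can be stopped near
   [T]. Before capping this is the condensed series for [Q = level_base ^ n], as
   [s i ^- n = (M i ^ n) ^ n.+1]. *)
pose t i := Num.min (f (Phi (M i ^ n)%N) / s i ^+ n) 1.
have tE i : t i * s i ^+ n = Num.min (f (Phi (M i ^ n)%N)) (s i ^+ n).
  by rewrite /t minr_pMl ?(ltW (sn0 i)) // divfK ?lt0r_neq0 // mul1r.
exists t; split.
- move=> i; rewrite /t ge_min lexx orbT andbT le_min ler01 andbT.
  by rewrite divr_ge0 ?ltW // fpos.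
- have Q1 : (1 < level_base ^ n)%N by rewrite -(exp1n n) ltn_exp2r.
  have := @condensation R n (level_base ^ n) (fun b => f (Phi b)) Q1.
  move=> /(_ (fun b b0 => ltW (fpos (Ppos b0)))).
  move=> /(_ (fun b b' b0 le => fmono (Ppos (leq_trans b0 le)) (Pmono b0 le)) Pdiv) du.
  have u0 k : 0 <= ((level_base ^ n) ^ k)%N%:R ^+ n.+1 * f (Phi ((level_base ^ n) ^ k)%N).
    by rewrite mulr_ge0 ?exprn_ge0 // ltW // fpos // Ppos // !expn_gt0 ltnW.
  have := diverges_min1 (diverges_shift (k1 + N1) du u0) (fun k => u0 _).
  congr (diverges _); apply/funext => i; rewrite /t /s /spacing /M.
  congr (Num.min _ _).
  rewrite exprVn invrK -!exprM [in RHS]mulrC; congr (_ * f (Phi _)); last by rewrite expnAC.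
  by rewrite !natrX -!exprM; congr (_ ^+ _); ring.
- move=> i; rewrite tE /ph; have [le|le] := leP (Phi (M i ^ n)%N) (eps * s i).
    by rewrite ge_min lexx.
  rewrite ge_min; apply/orP; right.
  have := hr1 _ (es0 i) (esr i); rewrite exprMn mulrA mulVf ?mul1r //.
  by rewrite expf_neq0 // lt0r_neq0.
- move=> i; rewrite tE minr_pMr ?(ltW eps0) // le_min; apply/andP; split.
    have : ph i <= r1 by rewrite /ph ge_min esr orbT.
    move=> /(hr1 _ (ph0 i)) h.
    apply: (@le_trans _ _ (eps * f (ph i))); last first.
      by rewrite ler_pM2l // fmono // /ph ge_min lexx.
    rewrite -ler_pdivrMl //; apply: le_trans h; rewrite ler_pM2r ?exprn_gt0 //.
    rewrite lef_pV2 ?posrE ?exprn_gt0 //.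
    by rewrite -(prednK n0) exprS ler_piMr ?(ltW eps0) // exprn_ile1 // ltW.
  apply: (@le_trans _ _ ((eps * s i) ^+ n)).
    by apply: lerXn2r; rewrite ?nnegrE ?(ltW (ph0 i)) ?(ltW (es0 i)) // /ph ge_min lexx orbT.
  rewrite exprMn ler_pM2r //.
  by rewrite -(prednK n0) exprS ler_piMr ?(ltW eps0) // exprn_ile1 // ltW.
Qed.

Let K : R := (denom_ratio n)%:R.
Let lam : R := (grid_ratio n)%:R.

Let K0 : 0 <= K. Proof. exact: ler0n. Qed.
Let lamE : lam = 2 * K + 4.
Proof. by rewrite /lam /K /grid_ratio natrD natrM. Qed.

(** [z], [ph] and [w] are centers, radii and weights, and [s p] is the spacing of the level of [p].
    Separation handles a set narrower than the spacings; packing handles one at least as wide, for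
    which the weight behaves like [T + 1] times Lebesgue measure. *)
Record family_spec (c : 'I_n -> R) (phi T : R) (I : finType) (kept : pred I)
    (z : I -> 'I_n -> R) (s ph w : I -> R) : Prop := FamilySpec {
  family_bounds : forall p, kept p ->
    [/\ 0 < s p, 0 < ph p, ph p <= s p, ph p <= phi / 2 & 0 <= w p <= f (ph p)];
  family_rational : forall p, kept p -> exists (b : nat) (a : 'I_n -> int),
    [/\ (0 < b)%N, ph p <= Phi b & forall i, z p i = (a i)%:~R / b%:R];
  family_inside : forall p i, kept p ->
    c i + ph p < z p i /\ z p i + ph p <= c i + phi;
  family_separated : forall p q r, kept p -> kept q -> r < s p -> r < s q ->
    sup_close (z p) (z q) (ph p + ph q + r) -> p = q;
  family_packing : forall y r, 0 < r ->
    \sum_(p | [&& kept p, s p <= r & `[< sup_close (z p) y (2 * r) >]]) w p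
      <= 2 ^+ n * (T + 1) * r ^+ n;
  family_total :
    1 / 2 * (phi / (4 * lam)) ^+ n * T <= \sum_(p | kept p) w p }.

(* A point of level [i] is kept unless it lies within [3 s_i] of a ball of a
   lower level.  Hence a set of diameter less than the spacing [s p] can meet at
   most one ball of that or a lower level, although the weights [w] of all
   levels together exceed the volume of the box by the factor [T]. *)
Lemma ex_family (c : 'I_n -> R) (phi T : R) : 0 < phi -> 1 <= T ->
  exists (I : finType) (kept : pred I) (z : I -> 'I_n -> R) (s ph w : I -> R),
    family_spec c phi T kept z s ph w.
Proof.
move=> phi0 T1.
(* Makes the balls of all lower levels cost at most [8 ^ n * eps * (T + 1) = 1 / 8] of a grid. *)
pose eps : R := (8 * 8 ^+ n * (T + 1))^-1.
have T10 : 0 < T + 1 by lra.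
have eps0 : 0 < eps by rewrite invr_gt0 !mulr_gt0 // exprn_gt0.
have eps1 : eps <= 1.
  rewrite invf_le1 ?mulr_gt0 ?exprn_gt0 //.
  have h8 : 1 <= 8 ^+ n :> R by apply: exprn_ege1; rewrite ler1n.
  have : 1 * 1 <= 8 ^+ n * (T + 1) by apply: ler_pM => //; lra.
  by rewrite -mulrA; lra.
have [M0 hM0] := level_grid c n0 phi0.
have [k0 [Mk0 [t]]] := ex_levels M0 eps0 eps1.
pose M i := (level_base ^ (k0 + i))%N.
pose s i := spacing R n (M i).
pose ph i := Num.min (Phi (M i ^ n)%N) (eps * s i).
move=> -[t01 tdiv tf0 pht0].
have tf i : t i * s i ^+ n <= f (ph i) by apply: tf0.
have pht i : ph i ^+ n <= eps * (t i * s i ^+ n) by apply: pht0.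
have base0 : (0 < level_base)%N by rewrite /level_base muln_gt0 expn_gt0.
have lvl i : [/\ (0 < M i)%N, grid_step R n (M i) <= phi / 8
    & 3 / 4 * (grid_size n (M i) phi)%:R ^+ n <=
      \sum_(j : {ffun 'I_n -> 'I_(grid_size n (M i) phi)})
        `[< good_grid_point (M i) c phi j >]%:R :> R].
  apply: hM0; apply: leq_trans Mk0 _; apply: (leq_trans (leq_addr i _)).
  rewrite ltnW // ltn_expl // /level_base (@leq_trans 16) // leq_pmulr // expn_gt0 //.
have M_gt0 i : (0 < M i)%N by case: (lvl i).
have s0 i : 0 < s i by apply: spacing_gt0.
have es0 i : 0 < eps * s i by rewrite mulr_gt0.
have ph0 i : 0 < ph i by rewrite /ph lt_min es0 andbT Ppos // expn_gt0 M_gt0.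
have phs i : ph i <= s i.
  apply: (@le_trans _ _ (eps * s i)); first by rewrite /ph ge_min lexx orbT.
  by rewrite ler_piMl // ltW.
have stepE i : grid_step R n (M i) = lam * s i by [].
have lam4 : 4 <= lam by rewrite lamE; move: K0; lra.
have lam_gt0 : 0 < lam by lra.
have step8 i : lam * s i <= phi / 8 by rewrite -stepE; case: (lvl i).
have Ks i : K * s i + s i <= lam * s i.
  by rewrite -[X in _ + X]mul1r -mulrDl ler_pM2r // lamE; move: K0; lra.
have T0 : 0 <= T by lra.
have [N /andP[TN NT]] := diverges_window T0 t01 tdiv.
pose J (i : 'I_N) := grid_size n (M i) phi.
pose I := {i : 'I_N & {ffun 'I_n -> 'I_(J i)}}.
pose x (p : I) := grid_point (M (tag p)) c phi (tagged p).
pose G (p : I) := `[< good_grid_point (M (tag p)) c phi (tagged p) >].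
have /choice[ba hba] : forall p : I, exists ba : nat * ('I_n -> int), G p ->
    [/\ (0 < ba.1)%N, (ba.1 <= M (tag p) ^ n)%N
      & forall i, `|x p i - (ba.2 i)%:~R / ba.1%:R| <= K * s (tag p)].
  move=> p; case: (boolP (G p)) => [/asboolP[b [a h]]|_]; first by exists (b, a).
  by exists (0%N, fun=> 0).
pose z (p : I) (i : 'I_n) : R := ((ba p).2 i)%:~R / (ba p).1%:R.
have hz p i : G p -> `|x p i - z p i| <= K * s (tag p) by move=> /hba[].
(* The margin [3 * s] exceeds the radius of [p] plus the width of a set narrower than [s]. The lower
   point [p'] is asked to be good rather than kept, which avoids a recursion over the levels. *)
pose bad (p : I) := `[< exists p' : I, [/\ (tag p' < tag p)%N, G p'
   & sup_close (z p) (z p') (ph (tag p') + 3 * s (tag p))] >].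
pose kept p := G p && ~~ bad p.
exists I, kept, z, (fun p : I => s (tag p)), (fun p : I => ph (tag p)),
  (fun p : I => t (tag p) * s (tag p) ^+ n).
have xlo p i : c i + phi / 4 <= x p i.
  by rewrite /x /grid_point stepE lerDl !mulr_ge0 // ltW.
have xhi p i : x p i <= c i + 3 / 4 * phi.
  rewrite /x /grid_point stepE.
  have : (tagged p i)%:R <= phi / (2 * (lam * s (tag p))).
    rewrite -stepE; apply: le_trans (grid_size_le n (M_gt0 _) phi0).
    by rewrite ler_nat ltnW.
  by rewrite ler_pdivlMr ?mulr_gt0 //; lra.
have pos_ls i : 0 < lam * s i by rewrite mulr_gt0.
split.
- move=> p /andP[Gp _]; split => //.
  + apply: le_trans (phs _) _; have := Ks (tag p); have := step8 (tag p).
    by have := mulr_ge0 K0 (ltW (s0 (tag p))); lra.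
  + by rewrite tf andbT mulr_ge0 ?exprn_ge0 ?(ltW (s0 _)) //; case/andP: (t01 (tag p)).
- move=> p /andP[Gp _]; have [b0 bM _] := hba p Gp.
  exists (ba p).1, (ba p).2; split => //.
  apply: (@le_trans _ _ (Phi (M (tag p) ^ n)%N)); last exact: Pmono.
  by rewrite /ph ge_min lexx.
- move=> p i /andP[Gp _].
  have := hz p i Gp; rewrite ler_norml => /andP[h1 h2].
  have := xlo p i; have := xhi p i; have := Ks (tag p); have := step8 (tag p).
  by have := phs (tag p); have := phi0; split; lra.
- move=> p q r.
  wlog le : p q / (tag q <= tag p)%N.
    move=> H kp kq rp rq h; have [le|/ltnW le] := leqP (tag q) (tag p); first exact: H.
    apply/esym; apply: H => // i; rewrite distrC [ph (tag q) + _]addrC; exact: h.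
  move=> /andP[Gp nbp] /andP[Gq _] rp rq h.
  move: le; rewrite leq_eqVlt => /orP[/eqP|] e; last first.
    exfalso; move/asboolPn: nbp; apply; exists q; split => // i.
    by apply: le_trans (h i) _; have := phs (tag p); have := s0 (tag p); move: rp; lra.
  have {}e : tag q = tag p by apply: val_inj.
  apply: contrapT => npq.
  case: p q e h Gp Gq npq rp rq {nbp} => [i j] [i' j'] /= e; move: j'; rewrite e => j'.
  move=> h Gp Gq npq rp _.
  have [l nl] : exists l, j l != j' l.
    apply: contrapT => /forallNP hl; apply: npq; congr (existT _ _ _).
    by apply/ffunP => l; apply/eqP/negPn/negP; apply: hl.
  have h1 := hz (Tagged (fun i : 'I_N => {ffun 'I_n -> 'I_(J i)}) j) l Gp; have h2 := hz (Tagged (fun i : 'I_N => {ffun 'I_n -> 'I_(J i)}) j') l Gq.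
  have {}h := h l; move: h1 h2 h; rewrite /x /grid_point stepE /= => h1 h2 h.
  have sep : lam * s i <= `|lam * s i * (j l)%:R - lam * s i * (j' l)%:R|.
    rewrite -mulrBr normrM (gtr0_norm (pos_ls i)) ler_peMr ?(ltW (pos_ls i)) //.
    have [lt|lt|/val_inj eq] := ltngtP (j l) (j' l).
    - rewrite distrC -natrB ?(ltnW lt) // normr_nat ler1n subn_gt0 //.
    - rewrite -natrB ?(ltnW lt) // normr_nat ler1n subn_gt0 //.
    - by rewrite eq eqxx in nl.
  have := phs i; have := s0 i; move: h1 h2 h rp.
  have -> : lam * s i = 2 * (K * s i) + 4 * s i by rewrite lamE; ring.
  move: sep; rewrite lamE.
  have -> : (2 * K + 4) * s i = 2 * (K * s i) + 4 * s i by ring.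
  move: (_ * (j l)%:R) (_ * (j' l)%:R) => u v sep.
  set z1 := z _ _; set z2 := z _ _ => h1 h2 h rp sp pp.
  have : `|u - v| <= `|c l + phi / 4 + u - z1| + `|c l + phi / 4 + v - z2| + `|z1 - z2|.
    have -> : u - v = (c l + phi / 4 + u - z1) - (c l + phi / 4 + v - z2) + (z1 - z2) by ring.
    by apply: le_trans (ler_normD _ _) _; rewrite lerD2r; apply: ler_normB.
  lra.
- move=> y r r0.
  pose F (i : 'I_N) (j : {ffun 'I_n -> 'I_(J i)}) : R :=
    if s i <= r then [forall l, `|c l + phi / 4 + lam * s i * (j l)%:R - y l|
       <= 2 * r + K * s i]%:R * (t i * s i ^+ n) else 0.
  apply: (@le_trans _ _ (\sum_(p : I) F (tag p) (tagged p))).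
    rewrite big_mkcond; apply: ler_sum => p _; rewrite /F.
    have w0 : 0 <= t (tag p) * s (tag p) ^+ n.
      by rewrite mulr_ge0 ?exprn_ge0 ?(ltW (s0 _)) //; case/andP: (t01 (tag p)).
    case: (boolP (kept p)) => /= [/andP[Gp _]|_]; last by case: ifP => // _; rewrite mulr_ge0.
    have [sr|_] /= := leP (s (tag p)) r; last by [].
    case: asboolP => [hn|_]; last by rewrite mulr_ge0.
    rewrite (_ : [forall l, _] = true) ?mul1r //.
    apply/forallP => l; have := hz p l Gp; have := hn l.
    rewrite /x /grid_point stepE => a1 a2.
    have -> : c l + phi / 4 + lam * s (tag p) * (tagged p l)%:R - y l =
      (c l + phi / 4 + lam * s (tag p) * (tagged p l)%:R - z p l) + (z p l - y l) by ring.
    by apply: le_trans (ler_normD _ _) _; rewrite addrC; apply: lerD.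
  rewrite -(@sig_big_dep _ _ _ _ _ xpredT (fun=> xpredT) F) /=.
  apply: (@le_trans _ _ (\sum_(i < N) 2 ^+ n * r ^+ n * t i)); last first.
    rewrite -big_distrr /= [leRHS]mulrAC ler_wpM2l //.
    by rewrite mulr_ge0 ?exprn_ge0 // ltW.
  apply: ler_sum => i _; rewrite /F; have /andP[ti0 _] := t01 i.
  have [sr|_] := leP (s i) r; last first.
    by rewrite big1 // mulr_ge0 // mulr_ge0 ?exprn_ge0 // ltW.
  rewrite -big_distrl /=.
  have rr0 : 0 <= 2 * r + K * s i by rewrite addr_ge0 ?mulr_ge0 // ltW.
  apply: (@le_trans _ _ ((2 * (2 * r + K * s i) / (lam * s i) + 1) ^+ n * (t i * s i ^+ n))).
    rewrite ler_wpM2r ?mulr_ge0 ?exprn_ge0 ?(ltW (s0 _)) //.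
    apply: (@count_box R n (J i) (fun l u =>
      `|c l + phi / 4 + lam * s i * u%:R - y l| <= 2 * r + K * s i)) => l.
    exact: count_near.
  apply: (@le_trans _ _ ((2 * r / s i) ^+ n * (t i * s i ^+ n))); last first.
    rewrite exprMn exprVn exprMn le_eqVlt; apply/orP; left; apply/eqP; field.
    by rewrite expf_neq0 // lt0r_neq0.
  rewrite ler_wpM2r ?mulr_ge0 ?exprn_ge0 ?(ltW (s0 _)) //.
  apply: lerXn2r; rewrite ?nnegrE.
  + by rewrite addr_ge0 // divr_ge0 ?mulr_ge0 // ltW.
  + by rewrite divr_ge0 ?mulr_ge0 // ltW.
  (* Since [s i <= r], the numerator [4 * r + 2 * K * s i + lam * s i] is at most [2 * r * lam]. *)
  rewrite -[X in _ + X](divff (lt0r_neq0 (pos_ls i))) -mulrDl ler_pdivrMr //.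
  have -> : 2 * r / s i * (lam * s i) = 2 * r * lam by field; rewrite lt0r_neq0.
  rewrite lamE; have : K * s i <= K * r by rewrite ler_wpM2l.
  move: sr; lra.
(* At least three quarters of the grid is good; the lower balls and their margins discard at most an
   eighth each. *)
- have half (i : 'I_N) : 1 / 2 * (J i)%:R ^+ n <=
      \sum_(j : {ffun 'I_n -> 'I_(J i)}) (kept (Tagged (fun i : 'I_N => {ffun 'I_n -> 'I_(J i)}) j))%:R :> R.
    have [_ _ hgood] := lvl i.
    have split_kept : \sum_(j : {ffun 'I_n -> 'I_(J i)}) (G (Tagged (fun i : 'I_N => {ffun 'I_n -> 'I_(J i)}) j))%:R <=
       \sum_(j : {ffun 'I_n -> 'I_(J i)}) (kept (Tagged (fun i : 'I_N => {ffun 'I_n -> 'I_(J i)}) j))%:R +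
       \sum_(j : {ffun 'I_n -> 'I_(J i)}) (G (Tagged (fun i : 'I_N => {ffun 'I_n -> 'I_(J i)}) j) && bad (Tagged (fun i : 'I_N => {ffun 'I_n -> 'I_(J i)}) j))%:R :> R.
      rewrite -big_split /=; apply: ler_sum => j _; rewrite /kept.
      by case: (G _); case: (bad _); rewrite /= ?addr0 ?add0r.
    pose Z (i' : 'I_N) : R := (2 * (ph i' + (3 + K) * s i) / (lam * s i) + 1) ^+ n.
    have rho0 i' : 0 <= ph i' + (3 + K) * s i.
      by rewrite addr_ge0 ?(ltW (ph0 _)) // mulr_ge0 ?addr_ge0 // ltW.
    have nbad : \sum_(j : {ffun 'I_n -> 'I_(J i)}) (G (Tagged (fun i : 'I_N => {ffun 'I_n -> 'I_(J i)}) j) && bad (Tagged (fun i : 'I_N => {ffun 'I_n -> 'I_(J i)}) j))%:R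
        <= \sum_(i' < N | (i' < i)%N) (J i')%:R ^+ n * Z i'.
      apply: (@le_trans _ _ (\sum_(p' : I | (tag p' < i)%N)
         \sum_(j : {ffun 'I_n -> 'I_(J i)})
           [forall l, `|c l + phi / 4 + lam * s i * (j l)%:R - z p' l|
             <= ph (tag p') + (3 + K) * s i]%:R)).
        apply: count_union => j /andP[Gj /asboolP[p' [lt Gp' hn]]].
        exists p' => //; apply/forallP => l.
        have := hz _ l Gj; have := hn l; rewrite /x /grid_point stepE /= => a1 a2.
        have -> : c l + phi / 4 + lam * s i * (j l)%:R - z p' l =
          (c l + phi / 4 + lam * s i * (j l)%:R - z (Tagged (fun i : 'I_N => {ffun 'I_n -> 'I_(J i)}) j) l)
          + (z (Tagged (fun i : 'I_N => {ffun 'I_n -> 'I_(J i)}) j) l - z p' l) by ring.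
        apply: le_trans (ler_normD _ _) _; apply: le_trans (lerD a2 a1) _; lra.
      apply: (@le_trans _ _ (\sum_(p' : I | (tag p' < i)%N) Z (tag p'))).
        apply: ler_sum => p' _; apply: (@count_box R n (J i) (fun l u =>
          `|c l + phi / 4 + lam * s i * u%:R - z p' l|
             <= ph (tag p') + (3 + K) * s i)) => l.
        exact: count_near.
      have -> : \sum_(p' : I | (tag p' < i)%N) Z (tag p') =
          \sum_(i' < N | (i' < i)%N) \sum_(j : {ffun 'I_n -> 'I_(J i')}) Z i'.
        by rewrite sig_big_dep; apply: eq_bigl => p'; rewrite andbT.
      apply: ler_sum => i' _.
      by rewrite sumr_const card_ffun !card_ord -natrX mulr_natl.
    pose A : R := (phi / (4 * (lam * s i))) ^+ n.
    have Age0 : 0 <= A by rewrite exprn_ge0 // divr_ge0 ?mulr_ge0 // ltW.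
    pose q : R := (level_base)%:R^-1.
    have base_gt0 : 0 < (level_base)%:R :> R by rewrite ltr0n.
    have q0 : 0 <= q by rewrite invr_ge0 ltW.
    have h12 : 0 < 12 ^+ n :> R by rewrite exprn_gt0.
    have q12 : 12 ^+ n * q = 1 / 16.
      by rewrite /q /level_base natrM natrX; field; rewrite lt0r_neq0.
    have q1 : q <= 1 / 2.
      have : 1 * q <= 12 ^+ n * q.
        by rewrite ler_wpM2r // exprn_ege1 // ler1n.
      by rewrite q12; lra.
    have each (i' : 'I_N) : (i' < i)%N -> (J i')%:R ^+ n * Z i' <=
        A * (8 ^+ n * eps * t i' + 12 ^+ n * q ^+ (i - i')).
      move=> lt.
      apply: (@le_trans _ _ (A * (8 ^+ n * (ph i' / s i') ^+ n + 12 ^+ n * q ^+ (i - i')))).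
        apply: discarded_bound => //; first exact: ltW.
          exact: grid_size_le.
        have sE : s i / s i' = (q ^+ (i - i')) ^+ n.+1.
          rewrite /s /M -[X in (k0 + X)%N](subnKC (ltnW lt)) addnA spacingD //.
          by rewrite -/q mulrAC divff ?mul1r // lt0r_neq0 // spacing_gt0 // expn_gt0 base0.
        have qe0 : 0 <= q ^+ (i - i') by rewrite exprn_ge0.
        have qe1 : q ^+ (i - i') <= 1 by rewrite exprn_ile1 //; lra.
        rewrite sE -exprM; have : (0 < n.+1 * n)%N by rewrite muln_gt0.
        case: (n.+1 * n)%N => // e _; rewrite exprS ler_piMr //.
        exact: exprn_ile1.
      rewrite ler_wpM2l // lerD2r -mulrA ler_wpM2l ?exprn_ge0 //.
      rewrite exprMn exprVn ler_pdivrMr ?exprn_gt0 // -mulrA; exact: pht.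
    have tsum : \sum_(i' < N | (i' < i)%N) t i' <= T + 1.
      apply: le_trans NT; rewrite big_mkcond; apply: ler_sum => i' _.
      by case: ifP => // _; case/andP: (t01 i').
    have qsum : \sum_(i' < N | (i' < i)%N) q ^+ (i - i') <= 2 * q.
      rewrite -(big_ord_widen _ (fun i' => q ^+ (i - i'))) ?(ltnW (ltn_ord i)) //.
      by apply: sum_geometric_le; rewrite q0.
    have AJ : A <= (J i)%:R ^+ n.
      apply: lerXn2r; rewrite ?nnegrE ?divr_ge0 ?mulr_ge0 ?(ltW phi0) ?(ltW lam_gt0) ?(ltW (s0 i)) //.
      by apply: grid_size_ge => //; apply: step8.
    have total_bad : \sum_(i' < N | (i' < i)%N) (J i')%:R ^+ n * Z i' <= 1 / 4 * A.
      apply: le_trans (ler_sum _ each) _.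
      rewrite -big_distrr /= big_split /= -!big_distrr /= mulrC ler_wpM2r //.
      have e8 : 8 ^+ n * eps * (T + 1) = 1 / 8.
        rewrite /eps; field; rewrite lt0r_neq0 //=; apply/lt0r_neq0; exact: exprn_gt0.
      have : 8 ^+ n * eps * \sum_(i' < N | (i' < i)%N) t i' <= 1 / 8.
        by rewrite -e8 ler_wpM2l // mulr_ge0 ?exprn_ge0 // ltW.
      have : 12 ^+ n * \sum_(i' < N | (i' < i)%N) q ^+ (i - i') <= 12 ^+ n * (2 * q).
        by rewrite ler_wpM2l // ltW.
      by move: q12; lra.
    move: hgood split_kept nbad; rewrite /G /=; lra.
  have -> : \sum_(p | kept p) t (tag p) * s (tag p) ^+ n =
      \sum_(i < N) \sum_(j : {ffun 'I_n -> 'I_(J i)} | kept (Tagged (fun i : 'I_N => {ffun 'I_n -> 'I_(J i)}) j)) t i * s i ^+ n.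
    by rewrite sig_big_dep; apply: eq_bigl => -[i j].
  apply: (@le_trans _ _ (\sum_(i < N) 1 / 2 * (phi / (4 * lam)) ^+ n * t i)).
    by rewrite -big_distrr /= ler_wpM2l // mulr_ge0 // exprn_ge0 // divr_ge0 ?mulr_ge0 // ltW.
  apply: ler_sum => i _; have /andP[ti0 _] := t01 i.
  have -> : \sum_(j : {ffun 'I_n -> 'I_(J i)} | kept (Tagged (fun i : 'I_N => {ffun 'I_n -> 'I_(J i)}) j)) t i * s i ^+ n =
      \sum_(j : {ffun 'I_n -> 'I_(J i)}) (kept (Tagged (fun i : 'I_N => {ffun 'I_n -> 'I_(J i)}) j))%:R * (t i * s i ^+ n).
    rewrite big_mkcond; apply: eq_bigr => j _.
    by case: (kept _); rewrite ?mul1r ?mul0r.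
  rewrite -big_distrl /=.
  apply: (@le_trans _ _ (1 / 2 * (J i)%:R ^+ n * (t i * s i ^+ n))); last first.
    by rewrite ler_wpM2r // mulr_ge0 ?exprn_ge0 // ltW.
  have -> : 1 / 2 * (J i)%:R ^+ n * (t i * s i ^+ n) =
      1 / 2 * ((J i)%:R * s i) ^+ n * t i by rewrite exprMn; ring.
  rewrite ler_wpM2r // ler_wpM2l //.
  have l40 : 0 < 4 * lam by rewrite mulr_gt0.
  apply: lerXn2r; rewrite ?nnegrE ?(divr_ge0 (ltW phi0) (ltW l40)) ?(mulr_ge0 _ (ltW (s0 i))) //.
  apply: (@le_trans _ _ (phi / (4 * (lam * s i)) * s i)).
    by rewrite le_eqVlt; apply/orP; left; apply/eqP; field; rewrite !lt0r_neq0.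
  rewrite ler_wpM2r ?(ltW (s0 i)) //.
  by apply: grid_size_ge => //; apply: step8.
Qed.

(** * A limit point outside a given cover *)

Variables (V : nat -> set ('I_n -> R)) (r : nat -> R) (S : R).
Hypothesis r0 : forall i, 0 < r i.
Hypothesis Vr : forall i x y, V i x -> V i y -> sup_close x y (r i).
Hypothesis rS : forall m, \sum_(i < m) f (r i) <= S.

Let lam0 : 0 < lam. Proof. by rewrite ltr0n /grid_ratio addn_gt0 orbT. Qed.

(** Chosen so that wide sets cost [2 ^+ n * (T + 1) * (eta * phi ^+ n) = (T + 1) / 16 * X] with
    [X = (phi / (4 * lam)) ^+ n], at most a quarter of the guaranteed weight [X * T / 2]. *)
Definition cover_const : R := (16 * 2 ^+ n * (4 * (grid_ratio n)%:R) ^+ n)^-1.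
Let eta := cover_const.

Let eta0 : 0 < eta.
Proof. by rewrite invr_gt0 !mulr_gt0 // exprn_gt0 // mulr_gt0. Qed.

Let eta1 : eta < 1.
Proof.
rewrite invf_lt1 ?mulr_gt0 ?exprn_gt0 ?mulr_gt0 //.
have a1 : 1 <= 2 ^+ n :> R by apply: exprn_ege1; rewrite ler1n.
have b1 : 1 <= (4 * lam) ^+ n.
  apply: exprn_ege1; rewrite -natrM ler1n muln_gt0 /= /grid_ratio addn_gt0 orbT //.
have : 1 * 1 <= 2 ^+ n * (4 * lam) ^+ n by apply: ler_pM.
by rewrite -/lam -mulrA; lra.
Qed.

(** The center of a ball becomes the lower corner of the next box. As the next center exceeds this
    corner strictly in every coordinate, the limit point differs from every center used. *)
Definition box (c : 'I_n -> R) (phi : R) (x : 'I_n -> R) : Prop :=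
  forall i, c i <= x i <= c i + phi.

Definition sparse_in (c : 'I_n -> R) (phi : R) : Prop :=
  forall m, \sum_(i < m | `[< exists2 x, V i x & box c phi x >]) r i ^+ n
    <= eta * phi ^+ n.

(* If every ball of the family is bad, its weight is paid for either by a set
   [V i] with [r i >= s p], which the packing bound and sparseness make
   negligible, or by sets with [r i < s p], each of which meets a single ball;
   the latter contribute at most [S / eta], a bound that [T] is chosen to beat. *)
Lemma stage (c : 'I_n -> R) (phi : R) : 0 < phi -> sparse_in c phi ->
  exists (z : 'I_n -> R) (rho : R),
  [/\ 0 < rho <= phi / 2,
      exists (b : nat) (a : 'I_n -> int),
        [/\ (0 < b)%N, rho <= Phi b & forall i, z i = (a i)%:~R / b%:R],
      forall i, c i + rho < z i /\ z i + rho <= c i + phi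
    & forall m, \sum_(i < m | `[< exists2 x, V i x & sup_close x z rho >]) f (r i)
        <= eta * f rho].
Proof.
move=> phi0 hD.
pose X := (phi / (4 * lam)) ^+ n.
have X0 : 0 < X by rewrite exprn_gt0 // divr_gt0 // mulr_gt0.
(* Makes [S / eta] at most [X * T / 8], again a quarter of the guaranteed weight. *)
pose T := 1 + 8 * `|S| / (eta * X).
have T1 : 1 <= T by rewrite lerDl divr_ge0 // mulr_ge0 // ltW.
have T0 : 0 < T by lra.
have [I [kept [z [s [w_ [w [hb hr hi hs hp ht]]]]]]] :=
  ex_family c phi0 T1.
set ph := w_ in hb hr hi hs.
pose meets (i : nat) (p : I) := `[< exists2 x, V i x & sup_close x (z p) (ph p) >].
suff [p kp goodp] : exists2 p, kept p &
    forall m, \sum_(i < m | meets i p) f (r i) <= eta * f (ph p).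
  exists (z p), (ph p); have [_ -> _ -> _] := hb p kp.
  by split => //; [apply: hr|move=> i; apply: hi].
apply: contrapT => noP.
(* Each failure is witnessed by a finite part of the cover; the family being finite, one [m] serves
   all its members. *)
have /choice[mm hmm] : forall p, exists m, kept p ->
    eta * f (ph p) < \sum_(i < m | meets i p) f (r i).
  move=> p; have [kp|nk] := boolP (kept p); last by exists 0%N.
  apply: contrapT => /forallNP hm; apply: noP; exists p => // m.
  by rewrite leNgt; apply/negP => ?; apply: (hm m).
pose m := (\max_p mm p)%N.
have fr0 i : 0 < f (r i) by apply: fpos.
have hm p : kept p -> eta * f (ph p) < \sum_(i < m | meets i p) f (r i).
  move=> /hmm lt; apply: lt_le_trans lt _.
  rewrite (big_ord_widen_cond m (fun i => meets i p) (fun i => f (r i))) ?leq_bigmax //.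
  rewrite [leRHS](bigID (fun i : 'I_m => (i < mm p)%N)) /= lerDl.
  by apply: sumr_ge0 => i _; apply: ltW.
have each p : kept p -> w p <= \sum_(i < m)
    ((if meets i p && (s p <= r i) then w p else 0) +
     (if meets i p && (r i < s p) then eta^-1 * f (r i) else 0)).
  move=> kp; have [_ ph0 _ _ /andP[w0 wf]] := hb p kp.
  have nn i : 0 <= (if meets i p && (s p <= r i) then w p else 0).
    by case: ifP.
  have nn' i : 0 <= (if meets i p && (r i < s p) then eta^-1 * f (r i) else 0).
    by case: ifP => // _; rewrite mulr_ge0 ?invr_ge0 ?(ltW eta0) ?(ltW (fr0 i)).
  have [[i /andP[mi si]]|nA] := pselect (exists i : 'I_m, meets i p && (s p <= r i)).
    rewrite (bigD1 i) //= mi si /= -addrA lerDl addr_ge0 ?nn' //.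
      by case: ifP => // _; rewrite mulr_ge0 ?invr_ge0 ?(ltW eta0) ?(ltW (fr0 i)).
    by apply: sumr_ge0 => j _; rewrite addr_ge0.
  have h : f (ph p) <= \sum_(i < m | meets i p) eta^-1 * f (r i).
    by rewrite -big_distrr /= ler_pdivlMl //; apply: ltW; apply: hm.
  apply: le_trans wf (le_trans h _).
  rewrite big_mkcond; apply: ler_sum => i _.
  case: ifP => mi /=; last by rewrite addr0.
  have -> : s p <= r i = false.
    by apply/negP => si; apply: nA; exists i; rewrite mi.
  have -> : r i < s p.
    by rewrite ltNge; apply/negP => si; apply: nA; exists i; rewrite mi.
  by rewrite add0r.
(* As [ph p <= s p <= r i], a center whose ball meets [V i] is within [2 * r i] of every point [y]
   of [V i]. *)
have perA (i : 'I_m) : \sum_(p | kept p) (if meets i p && (s p <= r i) then w p else 0)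
    <= if `[< exists2 x, V i x & box c phi x >] then 2 ^+ n * (T + 1) * r i ^+ n else 0.
  have [|nb] := asboolP (exists2 x, V i x & box c phi x).
    move=> [y Vy _]; apply: le_trans (hp y (r i) (r0 i)).
    rewrite -big_mkcondr /= [leLHS]big_mkcond [leRHS]big_mkcond /=; apply: ler_sum => p _.
    case: (boolP (kept p)) => //= kp; have [_ _ phs _ /andP[w_ge0 _]] := hb p kp.
    case: (boolP (meets i p)) => /= [/asboolP[x Vx xz]|_]; last by case: ifP.
    have [sr|_] := leP (s p) (r i) => //=.
    rewrite (_ : `[< _ >] = true) //; apply/asboolP => l.
    have := Vr Vx Vy l; have := xz l; rewrite distrC => h1 h2.
    have -> : z p l - y l = (z p l - x l) + (x l - y l) by ring.
    by apply: le_trans (ler_normD _ _) _; lra.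
  rewrite big1 // => p kp; case: ifP => // /andP[/asboolP[x Vx xz] _].
  exfalso; apply: nb; exists x => // l.
  have := xz l; have [h1 h2] := hi p l kp; rewrite ler_norml => /andP[h3 h4].
  by apply/andP; split; have [_ ? _ _ _] := hb p kp; lra.
have perB (i : 'I_m) : \sum_(p | kept p) (if meets i p && (r i < s p) then eta^-1 * f (r i) else 0)
    <= eta^-1 * f (r i).
  have e0 : 0 <= eta^-1 * f (r i) by rewrite mulr_ge0 ?invr_ge0 ?(ltW eta0) ?(ltW (fr0 i)).
  have [[p /and3P[kp mp rp]]|nB] := pselect (exists p, [&& kept p, meets i p & r i < s p]).
    rewrite (bigD1 p) //= mp rp /= big1 ?addr0 // => q /andP[kq qp].
    case: ifP => // /andP[mq rq]; exfalso; move/eqP: qp; apply.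
    move/asboolP: mp => [x Vx xz]; move/asboolP: mq => [y Vy yz].
    apply: (hs _ _ (r i)) => // l.
    have := xz l; have := yz l; have := Vr Vy Vx l; rewrite [`|y l - z q l|]distrC => h1 h2 h3.
    have -> : z q l - z p l = (z q l - y l) + (y l - x l) + (x l - z p l) by ring.
    apply: le_trans (ler_normD _ _) _.
    by apply: le_trans (lerD (ler_normD _ _) (lexx _)) _; lra.
  rewrite big1 // => p kp; case: ifP => // /andP[mp rp].
  by exfalso; apply: nB; exists p; rewrite kp mp rp.
have S0 : 0 <= S.
  by have := rS 0; rewrite big_ord0.
have total : \sum_(p | kept p) w p <= 2 ^+ n * (T + 1) * (eta * phi ^+ n) + eta^-1 * S.
  apply: le_trans (ler_sum _ each) _; rewrite exchange_big /=.
  under eq_bigr do rewrite big_split /=.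
  rewrite big_split /=; apply: lerD.
    apply: le_trans (ler_sum _ (fun i _ => perA i)) _.
    rewrite -big_mkcond -big_distrr /=; apply: ler_wpM2l; last exact: hD.
    by rewrite mulr_ge0 ?exprn_ge0 //; lra.
  apply: le_trans (ler_sum _ (fun i _ => perB i)) _.
  by rewrite -big_distrr /=; apply: ler_wpM2l; [rewrite invr_ge0 ltW|exact: rS].
have := le_trans ht total; rewrite -/lam -/X.
have -> : eta * phi ^+ n = (16 * 2 ^+ n)^-1 * X.
  rewrite /eta /cover_const /X -/lam expr_div_n; field.
  by rewrite !expf_neq0 // ?mulf_neq0 // lt0r_neq0.
have -> : 2 ^+ n * (T + 1) * ((16 * 2 ^+ n)^-1 * X) = (T + 1) / 16 * X.
  by field; rewrite expf_neq0.
have : eta^-1 * S <= 1 / 8 * X * T.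
  rewrite /T ger0_norm //.
  have -> : 1 / 8 * X * (1 + 8 * S / (eta * X)) = 1 / 8 * X + eta^-1 * S.
    by field; rewrite !lt0r_neq0.
  by rewrite lerDr; lra.
have : X * 1 <= X * T by rewrite ler_pM2l.
have : 0 < X * T by rewrite mulr_gt0.
lra.
Qed.

(** For [r i <= rho], the monotonicity of [r ^- n * f r] turns the bound on [f (r i)] into one on
    [r i ^+ n]. A set with [r i > rho] cannot meet the ball, since
    [f (r i) >= f rho > eta * f rho]. *)
Lemma sparse_next (z : 'I_n -> R) (rho : R) : 0 < rho ->
  (forall m, \sum_(i < m | `[< exists2 x, V i x & sup_close x z rho >]) f (r i)
        <= eta * f rho) -> sparse_in z rho.
Proof.
move=> rho0 h m.
have frho := fpos rho0.
rewrite -(ler_pM2l frho).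
have sub i x : V i x -> box z rho x -> sup_close x z rho.
  by move=> _ bx l; have /andP[h1 h2] := bx l; rewrite ler_norml; apply/andP; split; lra.
apply: (@le_trans _ _ (rho ^+ n * \sum_(i < m | `[< exists2 x, V i x & sup_close x z rho >]) f (r i))).
  rewrite !big_distrr /= [leLHS]big_mkcond [leRHS]big_mkcond /=; apply: ler_sum => i _.
  case: asboolP => [[x Vx bx]|_]; last first.
    by case: ifP => // _; rewrite mulr_ge0 ?exprn_ge0 ?(ltW rho0) ?(ltW (fpos (r0 i))).
  have xz := sub _ _ Vx bx.
  rewrite (_ : `[< _ >] = true); last by apply/asboolP; exists x.
  rewrite mulrC; apply: fdecr => //.
  rewrite leNgt; apply/negP => lt.
  have le := fmono rho0 (ltW lt).
  have := h i.+1; rewrite big_mkcond big_ord_recr /= (_ : `[< _ >] = true); last first.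
    by apply/asboolP; exists x.
  have : 0 <= \sum_(i0 < i) (if `[< exists2 x, V i0 x & sup_close x z rho >] then f (r i0) else 0).
    by apply: sumr_ge0 => j _; case: ifP => // _; rewrite ltW // fpos.
  have : eta * f rho < 1 * f rho by rewrite ltr_pM2r.
  lra.
rewrite [leRHS](_ : _ = rho ^+ n * (eta * f rho)); last by ring.
by apply: ler_wpM2l; [rewrite exprn_ge0 // ltW|exact: h].
Qed.

(** The corners of the nested boxes increase to [x] in each coordinate. If [x] were in [V i], this
    set would meet every ball, so [f (r i) <= eta * f (rho k)] at every stage, while the right side
    tends to [0]. *)
Lemma avoiding_point : sparse_in (fun=> 0) 1 ->
  exists x : 'I_n -> R,
  [/\ forall i, 0 <= x i <= 1,
      forall i, ~ V i x
    & forall e : R, 0 < e -> exists (b : nat) (a : 'I_n -> int),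
      [/\ (0 < b)%N, forall i, 0 <= ((a i)%:~R / b%:R : R) <= 1,
          forall i, (a i)%:~R / b%:R != x i,
          sup_close x (fun i => (a i)%:~R / b%:R) (Phi b)
        & sup_close x (fun i => (a i)%:~R / b%:R) e]].
Proof.
move=> sp0.
pose st := (('I_n -> R) * R)%type.
pose inv (u : st) := 0 < u.2 /\ sparse_in u.1 u.2.
pose rel (u v : st) := [/\ 0 < v.2 <= u.2 / 2,
      exists (b : nat) (a : 'I_n -> int),
        [/\ (0 < b)%N, v.2 <= Phi b & forall i, v.1 i = (a i)%:~R / b%:R],
      forall i, u.1 i + v.2 < v.1 i /\ v.1 i + v.2 <= u.1 i + u.2
    & forall m, \sum_(i < m | `[< exists2 x, V i x & sup_close x v.1 v.2 >]) f (r i)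
        <= eta * f v.2].
have /choice[g hg] : forall u, exists v, inv u -> rel u v /\ inv v.
  move=> [c phi]; have [[/= p0 sp]|ni] := pselect (inv (c, phi)); last by exists (c, phi).
  have [z [rho [h1 h2 h3 h4]]] := stage p0 sp.
  exists (z, rho) => _; split => //; split; first by case/andP: h1.
  by apply: sparse_next h4; case/andP: h1.
pose u k := iter k g (fun=> 0, 1).
have invu k : inv (u k) by elim: k => [|k /hg[]]; first by split.
have relu k : rel (u k) (u k.+1) by have [] := hg _ (invu k).
pose z k := (u k).1; pose rho k := (u k).2.
have rho0 k : 0 < rho k by case: (invu k).
have nest i j k : (j <= k)%N -> z j i <= z k i /\ z k i + rho k <= z j i + rho j.
  move=> /subnKC <-; elim: (k - j)%N => [|l [h1 h2]]; first by rewrite addn0.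
  rewrite addnS; have [/andP[p0 _] _ /(_ i)[h3 h4] _] := relu (j + l)%N.
  by split; rewrite /z /rho in h1 h2 h3 h4 *; lra.
have rhole k : rho k <= (2 ^+ k)^-1.
  elim: k => [|k IH]; first by rewrite expr0 invr1.
  have [/andP[_ h] _ _ _] := relu k; apply: le_trans h _.
  rewrite exprS invfM mulrC; apply: ler_wpM2l => //; by rewrite invr_ge0.
pose E i := [set z k i | k in [set: nat]].
pose x i := sup (E i).
have E_has i : has_sup (E i).
  split; first by exists (z 0%N i), 0%N.
  exists (z 0%N i + rho 0%N) => _ [k _ <-].
  by have [_] := nest i 0%N k (leq0n k); have := rho0 k; lra.
have zx k i : z k i <= x i by apply: sup_upper_bound => //; exists k.
have xz k i : x i <= z k i + rho k.
  apply: ge_sup; first by case: (E_has i).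
  move=> _ [j _ <-].
  have [jk|kj] := leqP j k.
    by have [h _] := nest i j k jk; have := rho0 k; lra.
  by have [_ h] := nest i k j (ltnW kj); have := rho0 j; lra.
have zxlt k i : z k i < x i.
  have [/andP[h0 _] _ /(_ i)[h _] _] := relu k.
  by have := zx k.+1 i; rewrite /z in h *; lra.
have xnear k : sup_close x (z k) (rho k).
  by move=> i; rewrite ler_norml; have := zx k i; have := xz k i; have := rho0 k; lra.
have small (e : R) : 0 < e -> exists k, rho k.+1 <= e.
  move=> e0; have [N hN] := exists_nat_ge e^-1.
  exists N; apply: le_trans (rhole _) _; rewrite -[e]invrK lef_pV2 ?posrE ?invr_gt0 ?exprn_gt0 //.
  apply: le_trans (hN N.+1 _) _ => //.
  by rewrite -natrX ler_nat ltnW // ltn_expl.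
exists x; split.
- by move=> i; have := zx 0%N i; have := xz 0%N i; rewrite /z /rho /= add0r => -> ->.
- move=> i Vx; have fri := fpos (r0 i).
  have [e e0 he] := flim0 (e := f (r i) / 2) (divr_gt0 fri (ltr0n _ 2)).
  have [k rk] := small e e0.
  have [_ _ _ /(_ i.+1)] := relu k.
  rewrite big_mkcond big_ord_recr /= (_ : `[< _ >] = true); last first.
    by apply/asboolP; exists x => //; exact: (xnear k.+1).
  have : 0 <= \sum_(i0 < i) (if `[< exists2 x, V i0 x & sup_close x (u k.+1).1 (u k.+1).2 >] then f (r i0) else 0).
    by apply: sumr_ge0 => j _; case: ifP => // _; rewrite ltW // fpos.
  have := he _ (rho0 k.+1) rk; have := fpos (rho0 k.+1).
  have : eta * f (rho k.+1) <= 1 * f (rho k.+1).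
    by rewrite ler_pM2r ?(ltW eta1) // fpos.
  by rewrite /rho /=; move: fri; lra.
- move=> e e0; have [k rk] := small e e0.
  have [_ [b [a [b0 rb za]]] _ _] := relu k.
  have zE : (fun i => (a i)%:~R / b%:R) = z k.+1 by apply/funext => i; rewrite -za.
  exists b, a; split => // [i|i||].
  + rewrite -za -/(z k.+1 i); have [h1 h2] := nest i 0%N k.+1 isT.
    have z00 : z 0%N i = 0 by [].
    have rho00 : rho 0%N = 1 by [].
    by move: h1 h2 (rho0 k.+1); rewrite z00 rho00; lra.
  + by rewrite -za; have := zxlt k.+1 i; rewrite /z; case: ltgtP.
  + by rewrite zE => i; apply: le_trans (xnear k.+1 i) rb.
  + by rewrite zE => i; apply: le_trans (xnear k.+1 i) rk.
Qed.

End Jarnik.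

(** * Geometry of the graph *)

(** Integers in [[-N, N]] are coded by ordinals below [N.*2.+1]. *)
Lemma absz_shift (a : int) (N : nat) : `|a| <= N%:Z -> (absz (a + N%:Z))%:Z = a + N%:Z.
Proof. by move=> h; rewrite gez0_abs //; lia. Qed.

Lemma absz_shift_lt (a : int) (N : nat) : `|a| <= N%:Z ->
  (absz (a + N%:Z)%R < N.*2.+1)%N.
Proof. by lia. Qed.

Section Geometry.
Variable R : realType.

Lemma rV_norm_leP (k : nat) (x : 'rV[R]_k) (r : R) : 0 <= r ->
  `|x| <= r <-> forall i, `|x ord0 i| <= r.
Proof.
move=> r0; rewrite [`|x|]mx_normrE; split => [h i|h].
  apply: le_trans h.
  by apply: (le_bigmax _ (fun ij : 'I_1 * 'I_k => `|x ij.1 ij.2|) (ord0, i)).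
by apply: bigmax_le => // -[i j] _ /=; rewrite ord1.
Qed.

Lemma coord_le_norm (k : nat) (x : 'rV[R]_k) i : `|x ord0 i| <= `|x|.
Proof. by move: i; apply/rV_norm_leP. Qed.

Lemma norm_le_eucl_dist (k : nat) (x y : 'rV[R]_k) : `|x - y| <= eucl_dist x y.
Proof.
apply/rV_norm_leP => [|i]; first exact: sqrtr_ge0.
rewrite !mxE -sqrtr_sqr /eucl_dist; apply: ler_wsqrtr.
rewrite (bigD1 i) //= lerDl; apply: sumr_ge0 => j _; exact: sqr_ge0.
Qed.

Lemma eucl_dist_le (k : nat) (x y : 'rV[R]_k) : eucl_dist x y <= k%:R * `|x - y|.
Proof.
have r0 : 0 <= k%:R * `|x - y| by rewrite mulr_ge0.
rewrite -[leRHS]ger0_norm // -sqrtr_sqr; apply: ler_wsqrtr.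
apply: (@le_trans _ _ (\sum_(i < k) `|x - y| ^+ 2)).
  apply: ler_sum => i _; rewrite -[leLHS]ger0_norm ?sqr_ge0 // normrX.
  by apply: lerXn2r; rewrite ?nnegrE //; have := coord_le_norm (x - y) i; rewrite !mxE.
rewrite sumr_const card_ord exprMn -[leLHS]mulr_natl ler_wpM2r ?sqr_ge0 //.
by case: (k) => [|l]; rewrite ?expr0n // ler_eXnr // ler1n.
Qed.

Lemma diam_ge0 (k : nat) (U : set 'rV[R]_k) : (0 <= diam U)%E.
Proof. by rewrite /diam le_max lexx. Qed.

Lemma eucl_dist_le_diam (k : nat) (U : set 'rV[R]_k) x y : U x -> U y ->
  ((eucl_dist x y)%:E <= diam U)%E.
Proof.
move=> Ux Uy; rewrite /diam le_max; apply/orP; right.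
by apply: ereal_sup_ubound; exists x => //; exists y.
Qed.

Lemma diam_le (k : nat) (U : set 'rV[R]_k) (D : R) : 0 <= D ->
  (forall x y, U x -> U y -> eucl_dist x y <= D) -> (diam U <= D%:E)%E.
Proof.
move=> D0 h; rewrite /diam ge_max lee_fin D0 /=.
by apply: ge_ereal_sup => _ [x Ux [y Uy <-]]; rewrite lee_fin h.
Qed.

Lemma diam_set0 (k : nat) : diam (set0 : set 'rV[R]_k) = 0%E.
Proof.
by apply/eqP; rewrite eq_le diam_ge0 andbT; apply: diam_le.
Qed.

(** The bound [A] is carried along because the Lipschitz constant of a product involves the sizes of
    the factors. *)
Definition lipschitz_on_box (n : nat) (B : R) (F : ('I_n -> R) -> R) : Prop :=
  exists L A : R, [/\ 0 <= L, 0 <= A,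
    forall x, (forall i, `|x i| <= B) -> `|F x| <= A
  & forall x y e, (forall i, `|x i| <= B) -> (forall i, `|y i| <= B) ->
    (forall i, `|x i - y i| <= e) -> 0 <= e -> `|F x - F y| <= L * e].

Lemma lipschitz_cst n B c : @lipschitz_on_box n B (fun=> c).
Proof.
by exists 0, `|c|; split => // x y e _ _ _ _; rewrite subrr normr0 mul0r.
Qed.

Lemma lipschitz_coord n B i : 0 <= B -> @lipschitz_on_box n B (fun x => x i).
Proof. by move=> B0; exists 1, B; split => // x y e _ _ h _; rewrite mul1r. Qed.

Lemma lipschitzD n B F G : @lipschitz_on_box n B F -> @lipschitz_on_box n B G ->
  @lipschitz_on_box n B (fun x => F x + G x).
Proof.
move=> [L [A [L0 A0 hA hL]]] [M [C [M0 C0 hC hM]]].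
exists (L + M), (A + C); split; [exact: addr_ge0|exact: addr_ge0|move=> x hx|move=> x y e hx hy hxy e0].
  by apply: le_trans (ler_normD _ _) _; rewrite lerD ?hA ?hC.
rewrite opprD addrACA mulrDl; apply: le_trans (ler_normD _ _) _.
exact: lerD (hL _ _ _ hx hy hxy e0) (hM _ _ _ hx hy hxy e0).
Qed.

Lemma lipschitzM n B F G : @lipschitz_on_box n B F -> @lipschitz_on_box n B G ->
  @lipschitz_on_box n B (fun x => F x * G x).
Proof.
move=> [L [A [L0 A0 hA hL]]] [M [C [M0 C0 hC hM]]].
exists (L * C + A * M), (A * C); split;
  [by rewrite addr_ge0 // mulr_ge0|exact: mulr_ge0|move=> x hx|move=> x y e hx hy hxy e0].
  by rewrite normrM ler_pM ?hA ?hC.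
have -> : F x * G x - F y * G y = (F x - F y) * G x + F y * (G x - G y) by ring.
apply: le_trans (ler_normD _ _) _; rewrite !normrM.
have -> : (L * C + A * M) * e = L * e * C + A * (M * e) by ring.
by apply: lerD; apply: ler_pM; rewrite ?hL ?hM ?hA ?hC.
Qed.

Lemma lipschitz_sum n B (T : Type) (r : seq T) F :
  (forall t, @lipschitz_on_box n B (F t)) ->
  @lipschitz_on_box n B (fun x => \sum_(t <- r) F t x).
Proof.
move=> h; elim: r => [|t r IH].
  by under eq_fun do rewrite big_nil; apply: lipschitz_cst.
by under eq_fun do rewrite big_cons; apply: lipschitzD.
Qed.

Lemma lipschitz_prod n B (T : Type) (r : seq T) F :
  (forall t, @lipschitz_on_box n B (F t)) ->
  @lipschitz_on_box n B (fun x => \prod_(t <- r) F t x).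
Proof.
move=> h; elim: r => [|t r IH].
  by under eq_fun do rewrite big_nil; apply: lipschitz_cst.
by under eq_fun do rewrite big_cons; apply: lipschitzM.
Qed.

Lemma lipschitzX n B F k : @lipschitz_on_box n B F ->
  @lipschitz_on_box n B (fun x => F x ^+ k).
Proof.
move=> h; elim: k => [|k IH].
  by under eq_fun do rewrite expr0; apply: lipschitz_cst.
by under eq_fun do rewrite exprS; apply: lipschitzM.
Qed.

Lemma lipschitz_eval_int_poly n (P : mpoly n int) B : 0 <= B ->
  lipschitz_on_box B (fun x => eval_int_poly P x : R).
Proof.
move=> B0; under eq_fun do rewrite eval_int_polyE.
apply: lipschitz_sum => mu; apply: lipschitzM; first exact: lipschitz_cst.
by apply: lipschitz_prod => i; apply: lipschitzX; apply: lipschitz_coord.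
Qed.

(** [1 <= L] lets the same constant control the base coordinates of a graph point. *)
Lemma ex_lipschitz_const (n m : nat) (P : 'I_m -> mpoly n int) B : 0 <= B ->
  exists2 L : R, 1 <= L & forall j (x y : 'I_n -> R) (e : R), (forall i, `|x i| <= B) ->
    (forall i, `|y i| <= B) -> (forall i, `|x i - y i| <= e) -> 0 <= e ->
    `|eval_int_poly (P j) x - eval_int_poly (P j) y| <= L * e.
Proof.
move=> B0; have /choice[L hL] : forall j, exists L : R, 0 <= L /\
    forall (x y : 'I_n -> R) (e : R), (forall i, `|x i| <= B) ->
    (forall i, `|y i| <= B) -> (forall i, `|x i - y i| <= e) -> 0 <= e ->
    `|eval_int_poly (P j) x - eval_int_poly (P j) y| <= L * e.
  by move=> j; have [L [A [L0 _ _ h]]] := lipschitz_eval_int_poly (P j) B0; exists L.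
have s0 : 0 <= \sum_j L j by apply: sumr_ge0 => j _; case: (hL j).
exists (1 + \sum_j L j); first by rewrite lerDl.
move=> j x y e hx hy hxy e0; have [L0 h] := hL j.
apply: le_trans (h x y e hx hy hxy e0) _; apply: ler_wpM2r => //.
rewrite (bigD1 j) //= addrCA lerDl addr_ge0 //.
by apply: sumr_ge0 => i _; case: (hL i).
Qed.

(** * Parametrization of the graph and its rational points *)

Definition graph_point (n m : nat) (P : 'I_m -> mpoly n int) (x : 'I_n -> R) :
  'rV[R]_(n + m) :=
  row_mx (\row_i x i) (\row_j eval_int_poly (P j) x).

Definition base_point (n m : nat) (z : 'rV[R]_(n + m)) (i : 'I_n) : R :=
  lsubmx z ord0 i.

Lemma graph_pointK n m (P : 'I_m -> mpoly n int) x :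
  base_point (graph_point P x) = x.
Proof. by apply/funext => i; rewrite /base_point row_mxKl mxE. Qed.

Lemma poly_graph_point n m (P : 'I_m -> mpoly n int) x :
  poly_graph R P (graph_point P x).
Proof.
move=> j; rewrite row_mxKr mxE; congr (eval_int_poly _ _).
by apply/funext => i; rewrite row_mxKl mxE.
Qed.

Lemma poly_graphP n m (P : 'I_m -> mpoly n int) z :
  poly_graph R P z -> z = graph_point P (base_point z).
Proof.
move=> h; rewrite -[LHS]hsubmxK; congr (row_mx _ _); apply/rowP => j.
  by rewrite mxE.
by rewrite h mxE.
Qed.

Lemma base_point_norm n m (z : 'rV[R]_(n + m)) i : `|base_point z i| <= `|z|.
Proof. by rewrite /base_point mxE; apply: coord_le_norm. Qed.

Lemma norm_row_mx_le n m (x : 'rV[R]_n) (y : 'rV[R]_m) r : 0 <= r ->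
  (forall i, `|x ord0 i| <= r) -> (forall j, `|y ord0 j| <= r) ->
  `|row_mx x y| <= r.
Proof.
move=> r0 hx hy; apply/rV_norm_leP => // i.
by case: (split_ordP i) => j ->; rewrite ?row_mxEl ?row_mxEr.
Qed.

Lemma graph_point_dist n m (P : 'I_m -> mpoly n int) B : 0 <= B ->
  exists2 L : R, 1 <= L & forall (x y : 'I_n -> R) (e : R), (forall i, `|x i| <= B) ->
    (forall i, `|y i| <= B) -> (forall i, `|x i - y i| <= e) -> 0 <= e ->
    `|graph_point P x - graph_point P y| <= L * e.
Proof.
move=> B0; have [L L1 hL] := ex_lipschitz_const P B0.
exists L => // x y e hx hy hxy e0.
rewrite /graph_point opp_row_mx add_row_mx; apply: norm_row_mx_le => [|i|j].
- by rewrite mulr_ge0 // (le_trans _ L1).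
- by rewrite !mxE; apply: le_trans (hxy i) _; rewrite ler_peMl.
- by rewrite !mxE; apply: hL.
Qed.

Lemma rat_pointE k (p : 'rV[int]_k) q i :
  rat_point R p q ord0 i = (p ord0 i)%:~R / q%:R.
Proof. by rewrite /rat_point !mxE mulrC. Qed.

(** Serves to discard small denominators: an infinite bounded set of rational points contains
    denominators beyond any [q0]. *)
Lemma finite_rat_points (k : nat) (B : R) (q0 : nat) : 0 <= B ->
  finite_set [set z : 'rV[R]_k | exists (p : 'rV[int]_k) (q : nat),
    [/\ (0 < q)%N, (q < q0)%N, z = rat_point R p q & `|z| <= B]].
Proof.
move=> B0; have [M hM] := exists_nat_ge (B * q0%:R).
pose g (t : 'I_q0 * {ffun 'I_k -> 'I_(M.*2.+1)}) : 'rV[R]_k :=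
  rat_point R (\row_i ((t.2 i)%:Z - M%:Z)) t.1.
apply: (@sub_finite_set _ _ [set g t | t in setT]); last first.
  by apply: finite_image; apply: finite_finset.
move=> _ [p [q [q_gt0 qq0 -> hz]]].
have bnd i : `|p ord0 i| <= M%:Z.
  rewrite -(ler_int R) intr_norm.
  have := le_trans (coord_le_norm _ i) hz; rewrite rat_pointE normrM normfV normr_nat.
  rewrite ler_pdivrMr ?ltr0n // => h; apply: le_trans h _.
  apply: le_trans (hM M (leqnn M)); rewrite ler_wpM2l // ler_nat ltnW //.
have lt i : (`|(p ord0 i + M%:Z)%R| < M.*2.+1)%N by apply: absz_shift_lt.
exists (Ordinal qq0, [ffun i => Ordinal (lt i)]) => //.
rewrite /g /=; congr rat_point; apply/rowP => i; rewrite !mxE ffunE /=.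
by rewrite absz_shift ?addrK.
Qed.

End Geometry.

(** * Intrinsic and ambient approximation *)

(** For [d = 0] the forms are constants; vanishing at [0], they would vanish at [(1, ..., 1)]
    too. *)
Lemma degree_gt0 (n m : nat) (P : 'I_m -> mpoly n int) (d : nat) : (0 < n)%N ->
  (forall z : 'I_n -> algC,
     (forall i : 'I_m, eval_int_poly (homog_part d (P i)) z = 0) <->
     (forall l : 'I_n, z l = 0)) -> (0 < d)%N.
Proof.
move=> n0 h; rewrite lt0n; apply/eqP => d0; subst d.
have cst i (z : 'I_n -> algC) : eval_int_poly (homog_part 0 (P i)) z =
    eval_int_poly (homog_part 0 (P i)) (fun=> 0).
  rewrite !homog_partE; apply: eq_bigr => mu; rewrite mdeg_eq0 => /eqP ->.
  by congr (_ * _); apply: eq_bigr => l _; rewrite mnmE !expr0.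
have [_ z0] := h (fun=> 0).
have [one0 _] := h (fun=> 1).
have := one0 (fun i => etrans (cst i _) (z0 (fun=> erefl) i)) (Ordinal n0).
by move/eqP; rewrite oner_eq0.
Qed.

Section Rational.
Variables (R : realType) (n m : nat) (P : 'I_m -> mpoly n int) (d : nat).
Hypothesis d0 : (0 < d)%N.
Hypothesis hd : forall j mu, mu \in msupp (P j) -> (mdeg mu <= d)%N.

Lemma graph_point_rational (a : 'I_n -> int) (b : nat) : (0 < b)%N ->
  graph_point P (fun i => (a i)%:~R / b%:R : R) =
  rat_point R (row_mx (\row_i (a i * b%:Z ^+ d.-1)) (\row_j homog_eval (P j) d a b%:Z))
    (b ^ d)%N.
Proof.
move=> b0; have bR : b%:R != 0 :> R by rewrite pnatr_eq0 -lt0n.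
apply/rowP => i; rewrite rat_pointE natrX.
case: (split_ordP i) => j ->; rewrite /graph_point ?row_mxEl ?row_mxEr !mxE.
  rewrite rmorphM rmorphXn /= -pmulrn -{2}(prednK d0) exprS.
  by field; rewrite expf_neq0.
rewrite homog_evalE; [|exact: hd|by rewrite -lt0n].
by rewrite -pmulrn mulrAC divff ?mul1r // expf_neq0.
Qed.

Lemma intrinsic_sub_ambient (psi : nat -> R) (M : set 'rV[R]_(n + m)) :
  intrinsic_approx psi M `<=` ambient_approx psi M.
Proof.
move=> x [Mx inf]; split => //.
by apply: sub_infinite_set inf => z [_ h].
Qed.

Lemma intrinsic_eq_ambient (psi : nat -> R) : approximation_function psi ->
  (r%:R ^+ d * psi r @[r --> \oo] --> (0 : R)) ->
  intrinsic_approx psi (poly_graph R P) = ambient_approx psi (poly_graph R P).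
Proof.
move=> [psi0 psi_decr] lim0; apply/seteqP; split; first exact: intrinsic_sub_ambient.
move=> x [Gx inf]; split => //.
have p1 : 0 < psi 1%N by apply: psi0.
have B0 : 0 <= `|x| + psi 1%N by rewrite addr_ge0 // ltW.
have [L L1 hL] := ex_lipschitz_const P B0.
have L10 : 0 < L + 1 by lra.
(* The distance from [P_j (a / q)] to [e / q] is at most [(L + 1) * psi q], with [L] from the
   variation of [P_j] and [1] from the coordinate itself; beyond [q0] its multiple by [q ^ d] is
   below [1]. *)
have [q0 _ hq0] : \forall r \near \oo, r%:R ^+ d * psi r < (L + 1)^-1.
  by apply: (cvgr_lt 0); rewrite // invr_gt0.
have fin := finite_rat_points (n + m) q0 B0.
apply: sub_infinite_set (infinite_setD inf fin) => z [[p [q [q_gt0 zE hz]]] nfin].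
split; last by exists p, q.
have zB : `|z| <= `|x| + psi 1%N.
  rewrite -[z](subKr x); apply: le_trans (ler_normB _ _) _; rewrite lerD2l.
  by apply: le_trans hz _; apply: psi_decr.
have qq0 : (q0 <= q)%N.
  by rewrite leqNgt; apply/negP => lt; apply: nfin; exists p, q.
have {}hq0 := hq0 q qq0.
have qR : 0 < q%:R :> R by rewrite ltr0n.
move=> j.
pose a i := p ord0 (lshift m i); pose e := p ord0 (rshift n j).
have baseE : base_point z = fun i => (a i)%:~R / q%:R.
  by apply/funext => i; rewrite /base_point mxE zE rat_pointE.
have yE : rsubmx z ord0 j = e%:~R / q%:R by rewrite mxE zE rat_pointE.
rewrite -/(base_point z) baseE yE.
pose X : int := homog_eval (P j) d a q%:Z - e * q%:Z ^+ d.-1.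
have qN : q%:R != 0 :> R by rewrite lt0r_neq0.
have XE : X%:~R = q%:R ^+ d * (eval_int_poly (P j) (fun i => (a i)%:~R / q%:R) - e%:~R / q%:R) :> R.
  rewrite /X intrB homog_evalE; [|exact: hd|by rewrite -lt0n].
  rewrite -!pmulrn rmorphM rmorphXn /= -!pmulrn mulrBr; congr (_ - _).
  by rewrite -{2}(prednK d0) exprS; field.
have dist : `|eval_int_poly (P j) (fun i => (a i)%:~R / q%:R) - e%:~R / q%:R| <= (L + 1) * psi q.
  rewrite -baseE -yE.
  have -> : eval_int_poly (P j) (base_point z) - rsubmx z ord0 j =
    (eval_int_poly (P j) (base_point z) - eval_int_poly (P j) (base_point x))
      + (rsubmx x ord0 j - rsubmx z ord0 j) by rewrite (Gx j); ring.
  apply: le_trans (ler_normD _ _) _; rewrite mulrDl mul1r; apply: lerD.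
    apply: hL => [i|i|i|]; last by rewrite ltW // psi0.
    - exact: le_trans (base_point_norm z i) zB.
    - by apply: le_trans (base_point_norm x i) _; rewrite lerDl ltW.
    - apply: le_trans hz; rewrite distrC.
      have -> : base_point x i - base_point z i = base_point (x - z) i.
        by rewrite /base_point !mxE.
      exact: base_point_norm.
  apply: le_trans hz.
  have -> : rsubmx x ord0 j - rsubmx z ord0 j = (x - z) ord0 (rshift n j) by rewrite !mxE.
  exact: coord_le_norm.
have X1 : `|X|%:~R < 1 :> R.
  rewrite intr_norm XE normrM ger0_norm ?exprn_ge0 ?(ltW qR) //.
  apply: le_lt_trans (_ : q%:R ^+ d * ((L + 1) * psi q) < 1).
    by rewrite ler_pM2l // exprn_gt0.
  by rewrite mulrCA -ltr_pdivlMl // mulr1.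
have X0 : X = 0.
  by apply/eqP; rewrite -normr_le0 -ltzD1 add0r -(ltr_int R).
move: XE; rewrite X0 => /esym/eqP; rewrite mulf_eq0 expf_eq0 (negbTE qN) andbF /=.
by rewrite subr_eq0 => /eqP ->.
Qed.

End Rational.

(** * The divergence case *)

Section HausdorffInfinite.
Variable R : realType.

Lemma sum_half_powers (N : nat) : \sum_(i < N) (2 ^+ i.+1)^-1 <= 1 :> R.
Proof.
suff -> : \sum_(i < N) (2 ^+ i.+1)^-1 = 1 - (2 ^+ N)^-1 :> R.
  by rewrite gerBl invr_ge0 exprn_ge0.
elim: N => [|k IH]; first by rewrite big_ord0 expr0 invr1 subrr.
by rewrite big_ord_recr /= IH exprS; field; rewrite expf_neq0.
Qed.

Lemma near_right0 (Q : R -> Prop) : (\forall x \near 0^'+, Q x) ->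
  exists2 e : R, 0 < e & forall x, 0 < x -> x < e -> Q x.
Proof.
move=> /nbhs_ballP[e /= e0 he]; exists e => // x x0 xe.
by apply: he => //; rewrite /ball /= sub0r normrN gtr0_norm.
Qed.

Lemma nneseries_le_partial (u : nat -> R) (k : nat) (S : R) : (forall i, 0 <= u i) ->
  (forall N, \sum_(k <= i < N) u i <= S) ->
  (\sum_(k <= i <oo) (u i)%:E <= S%:E)%E.
Proof.
move=> u0 h; apply: lime_le.
  by apply: is_cvg_nneseries => i _ _; rewrite lee_fin.
by apply: nearW => N; rewrite sumEFin lee_fin.
Qed.

Lemma partial_le_nneseries (u : nat -> R) (k N : nat) : (forall i, 0 <= u i) ->
  ((\sum_(k <= i < N) u i)%:E <= \sum_(k <= i <oo) (u i)%:E)%E.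
Proof.
move=> u0; rewrite -sumEFin; apply: nneseries_lim_ge => i _ _.
by rewrite lee_fin.
Qed.

Lemma nneseries_pinfty_diverges (u : nat -> R) (k : nat) : (forall i, 0 <= u i) ->
  (\sum_(k <= i <oo) (u i)%:E = +oo)%E ->
  forall S, exists N, S <= \sum_(k <= i < N) u i.
Proof.
move=> u0 h S; apply: contrapT => /forallNP hN.
have : (\sum_(k <= i <oo) (u i)%:E <= S%:E)%E.
  apply: nneseries_le_partial => // N; apply: ltW; rewrite ltNge; apply/negP.
  exact: hN.
by rewrite h leye_eq.
Qed.

(** Applied to the distances from a point to its approximants: if they come arbitrarily close
    without reaching the point, they are infinitely many. *)
Lemma finite_gap (T : choiceType) (F : set T) (g : T -> R) : finite_set F ->
  exists2 e : R, 0 < e & forall z, F z -> 0 < g z -> e < g z.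
Proof.
move=> /finite_seqP[s ->].
elim: s => [|t s [e e0 IH]]; first by exists 1.
have [gt|ngt] := ltP 0 (g t); last first.
  exists e => // z /=; rewrite inE => /orP[/eqP ->|]; last exact: IH.
  by move=> /(le_lt_trans ngt); rewrite ltxx.
exists (Num.min e (g t / 2)) => [|z /=]; first by rewrite lt_min e0 divr_gt0.
rewrite inE => /orP[/eqP -> _|zs gz]; rewrite gt_min.
  by apply/orP; right; lra.
by rewrite IH.
Qed.

End HausdorffInfinite.

Section Divergence.
Variables (R : realType) (n m : nat) (P : 'I_m -> mpoly n int) (d : nat).
Variables (psi : nat -> R) (f : R -> R).
Hypothesis n0 : (0 < n)%N.
Hypothesis d0 : (0 < d)%N.
Hypothesis hdeg : forall j mu, mu \in msupp (P j) -> (mdeg mu <= d)%N.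
Hypothesis hpsi : approximation_function psi.
Hypothesis hf : dimension_function f.
Hypothesis hii : forall C : R, 0 < C -> exists2 c : R, 0 < c &
     \forall x \near 0^'+, f (C * x) <= c * f x.
Hypothesis hlim : r ^- n * f r @[r --> 0^'+] --> +oo.
Hypothesis hdecr : forall r s : R, 0 < r -> r <= s -> s ^- n * f s <= r ^- n * f r.

Lemma dimension_lim0 (e : R) : 0 < e -> exists2 r0 : R, 0 < r0 &
  forall r : R, 0 < r -> r <= r0 -> f r <= e.
Proof.
move=> e0; have [_ fpos _ _ f0] := hf.
have : \forall r \near 0^'+, `|0 - f r| < e by apply: cvgr_dist_lt.
move=> /near_right0[r0 r00 h].
exists (r0 / 2) => [|r rpos rle]; first by rewrite divr_gt0.
have := h r rpos; rewrite sub0r normrN (gtr0_norm (fpos _ rpos)) => h'.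
by apply/ltW/h'; lra.
Qed.

Lemma dimension_lim_pinfty (A : R) : exists2 r0 : R, 0 < r0 &
  forall r : R, 0 < r -> r <= r0 -> A * r ^+ n <= f r.
Proof.
have : \forall r \near 0^'+, A <= r ^- n * f r by move/cvgryPge : hlim; apply.
move=> /near_right0[r0 r00 h].
exists (r0 / 2) => [|r rpos rle]; first by rewrite divr_gt0.
have rn : 0 < r ^+ n by rewrite exprn_gt0.
by rewrite mulrC -ler_pdivlMl //; apply: h => //; lra.
Qed.

Lemma dimension_decr (r s : R) : 0 < r -> r <= s -> r ^+ n * f s <= s ^+ n * f r.
Proof.
move=> r0 rs; have s0 : 0 < s by apply: lt_le_trans rs.
have rn : 0 < r ^+ n by rewrite exprn_gt0.
have sn : 0 < s ^+ n by rewrite exprn_gt0.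
have := hdecr r0 rs.
by rewrite ler_pdivrMl // mulrCA ler_pdivlMl.
Qed.

(* Doubling holds for [x] near [0]; on [[x0, B]] it follows from monotonicity. *)
Lemma dimension_shrink (L B : R) : 0 < L -> exists2 c : R, 0 < c &
  forall x : R, 0 < x -> x <= B -> f x <= c * f (x / L).
Proof.
move=> L0; have [_ fpos fmono _ _] := hf.
have [c c0 /near_right0[e e0 hc]] := hii L0.
have eL : 0 < e / 2 by rewrite divr_gt0.
have fe := fpos _ eL; have fB : 0 < f (`|B| + 1) by apply: fpos; rewrite ltr_wpDl.
exists (c + f (`|B| + 1) / f (e / 2)).
  by rewrite addr_gt0 // divr_gt0.
move=> x x0 xB; have xL : 0 < x / L by rewrite divr_gt0.
have [lt|le] := ltP (x / L) e.
  have := hc _ xL lt; rewrite mulrCA divff ?lt0r_neq0 // mulr1 => h.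
  apply: le_trans h _; rewrite ler_pM2r ?fpos // lerDl.
  by rewrite divr_ge0 // ?(ltW fB) ?(ltW fe).
have h1 : f x <= f (`|B| + 1).
  apply: fmono => //; apply: le_trans xB (le_trans (ler_norm B) _).
  by rewrite lerDl.
have h2 : f (e / 2) <= f (x / L).
  apply: fmono => //; apply: le_trans le; lra.
apply: le_trans h1 _.
apply: (@le_trans _ _ (f (`|B| + 1) / f (e / 2) * f (e / 2))).
  by rewrite divfK // lt0r_neq0.
have q0 : 0 < f (`|B| + 1) / f (e / 2) by rewrite divr_gt0.
apply: ler_pM => //; rewrite ?ltW // ltrDr //.
Qed.

(** A cover of sum below [A], projected to the base, satisfies the hypotheses of [avoiding_point];
    the graph point above the point so obtained is in the set but not in the cover. *)
Lemma hausdorff_delta_ge (A : R) :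
  (\sum_(1 <= r <oo) (r%:R ^+ n * f (psi (r ^ d)%N))%:E = +oo)%E ->
  0 < A -> exists2 delta0 : R, 0 < delta0 & forall delta, 0 < delta -> delta < delta0 ->
  (A%:E <= hausdorff_delta f delta (intrinsic_approx psi (poly_graph R P)))%E.
Proof.
move=> sum_inf A0.
have [f_0 fpos fmono _ _] := hf; have [psi0 psi_decr] := hpsi.
have fge0 x : 0 <= x -> 0 <= f x.
  by rewrite le_eqVlt => /orP[/eqP <-|/fpos/ltW //]; rewrite f_0.
have [L L1 hL] := graph_point_dist P (ler01 : 0 <= 1 :> R).
have L0 : 0 < L by lra.
(* Lifting from the unit cube to the graph multiplies distances by at most [L]. *)
pose Phi b := psi (b ^ d)%N / L.
have bd0 b : (0 < b)%N -> (0 < b ^ d)%N by rewrite expn_gt0 => ->.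
have Ppos b : (0 < b)%N -> 0 < Phi b by move=> b0; rewrite divr_gt0 // psi0 // bd0.
have Pmono b b' : (0 < b)%N -> (b <= b')%N -> Phi b' <= Phi b.
  move=> b0 le; rewrite ler_pM2r ?invr_gt0 //; apply: psi_decr; first exact: bd0.
  by rewrite leq_exp2r.
have Pdiv (S : R) : exists N, S <= \sum_(1 <= b < N) b%:R ^+ n * f (Phi b).
  have [c c0 hc] := dimension_shrink (psi 1%N) L0.
  have u0 i : 0 <= i%:R ^+ n * f (psi (i ^ d)%N) :> R.
    case: i => [|i]; first by rewrite expr0n eqn0Ngt n0 mul0r.
    by rewrite mulr_ge0 ?exprn_ge0 // ltW // fpos // psi0 // bd0.
  have [N hN] := nneseries_pinfty_diverges u0 sum_inf (c * S).
  exists N; rewrite -(ler_pM2l c0); apply: le_trans hN _.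
  rewrite big_distrr /=; apply: ler_sum_nat => b /andP[b0 _].
  rewrite mulrCA ler_wpM2l ?exprn_ge0 //; apply: hc; first by rewrite psi0 // bd0.
  by apply: psi_decr => //; apply: bd0.
have eta0 : 0 < cover_const R n.
  by rewrite invr_gt0 !mulr_gt0 // exprn_gt0 // mulr_gt0 // ltr0n /grid_ratio addn_gt0 orbT.
(* Below [delta0], [r ^+ n] is at most [cover_const R n / (A + 1) * f r], so a cover of sum at most
   [A + 1] is sparse in the unit box. *)
have [delta0 delta00 hdelta] := dimension_lim_pinfty ((A + 1) / cover_const R n).
exists delta0 => // delta dpos dlt.
apply: le_ereal_inf_tmp => _ [U [cov hU] <-].
rewrite leNgt; apply/negP => ltA.
pose a i : R := fine (diam (U i)).
have aE i : diam (U i) = (a i)%:E.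
  rewrite /a fineK // ge0_fin_numE ?diam_ge0 //.
  by apply: lt_trans (hU i) _; rewrite ltry.
have a0 i : 0 <= a i by rewrite -lee_fin -aE diam_ge0.
have ad i : a i < delta by rewrite -lte_fin -aE.
(* Sets of diameter [0] cost nothing but need a positive radius; the allowances [2 ^- i.+1] add at
   most [1] to the sum. *)
have /choice[r hr] : forall i, exists r : R,
    [/\ 0 < r, a i <= r, r <= delta & f r <= f (a i) + (2 ^+ i.+1)^-1].
  move=> i; have p0 : 0 < (2 ^+ i.+1)^-1 :> R by rewrite invr_gt0 exprn_gt0.
  have := a0 i; rewrite le_eqVlt => /orP[/eqP e|lt].
    have [r1 r10 h] := dimension_lim0 p0.
    exists (Num.min r1 delta); rewrite -e f_0 add0r; split.
    - by rewrite lt_min r10.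
    - by rewrite le_min !ltW.
    - by rewrite ge_min lexx orbT.
    - by apply: h; rewrite ?lt_min ?r10 // ge_min lexx.
  exists (a i); split => //; first exact: ltW.
  by rewrite lerDl ltW.
pose V i : set ('I_n -> R) := [set base_point z | z in U i].
have Vr i x y : V i x -> V i y -> sup_close x y (r i).
  move=> [z Uz <-] [w Uw <-] l.
  have [_ ar _ _] := hr i; apply: le_trans ar.
  have := eucl_dist_le_diam Uz Uw; rewrite aE lee_fin => h.
  apply: le_trans h; apply: le_trans (norm_le_eucl_dist z w).
  have -> : base_point z l - base_point w l = base_point (z - w) l.
    by rewrite /base_point !mxE.
  exact: base_point_norm.
have rpos i : 0 < r i by case: (hr i).
have rS N : \sum_(i < N) f (r i) <= A + 1.
  apply: (@le_trans _ _ (\sum_(i < N) (f (a i) + (2 ^+ i.+1)^-1))).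
    by apply: ler_sum => i _; case: (hr i).
  rewrite big_split /=; apply: lerD; last exact: sum_half_powers.
  rewrite -(big_mkord xpredT (fun i => f (a i))) -lee_fin.
  by apply: le_trans (partial_le_nneseries 0 N (fun i => fge0 _ (a0 i))) (ltW ltA).
have sp : sparse_in V r (fun=> 0) 1.
  move=> k; rewrite expr1n mulr1.
  apply: (@le_trans _ _ (\sum_(i < k) cover_const R n / (A + 1) * f (r i))).
    rewrite big_mkcond; apply: ler_sum => i _.
    have A1 : 0 < A + 1 by lra.
    have q0 : 0 <= cover_const R n / (A + 1) by rewrite divr_ge0 // ltW.
    case: ifP => _; last by rewrite mulr_ge0 // ltW // fpos.
    have [_ _ rd _] := hr i.
    have := hdelta _ (rpos i) (le_trans rd (ltW dlt)) => h.
    have -> : r i ^+ n = cover_const R n / (A + 1) * ((A + 1) / cover_const R n * r i ^+ n).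
      by field; rewrite !lt0r_neq0.
    exact: ler_wpM2l.
  rewrite -big_distrr /= mulrAC ler_pdivrMr; last by lra.
  by rewrite ler_pM2l //; apply: rS.
have [x [x01 nV hx]] := avoiding_point n0 fpos fmono dimension_lim0
  dimension_lim_pinfty dimension_decr Ppos Pmono Pdiv rpos Vr rS sp.
have x1 i : `|x i| <= 1 by have /andP[h1 h2] := x01 i; rewrite ger0_norm.
have [i _ Ui] : (\bigcup_i U i) (graph_point P x).
  apply: cov; split; first exact: poly_graph_point.
  set F := [set z | _] => finF.
  have [e e0 he] := finite_gap (fun z => `|graph_point P x - z|) finF.
  have [b [c [b0 c01 cx cP ce]]] := hx (e / L) (divr_gt0 e0 L0).
  pose y i : R := (c i)%:~R / b%:R.
  have y1 i : `|y i| <= 1 by have /andP[h1 h2] := c01 i; rewrite ger0_norm.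
  have le_e : `|graph_point P x - graph_point P y| <= e.
    apply: le_trans (hL x y _ x1 y1 ce (ltW (divr_gt0 e0 L0))) _.
    by rewrite mulrC divfK // lt0r_neq0.
  have Fy : F (graph_point P y).
    split; first exact: poly_graph_point.
    exists (row_mx (\row_i (c i * b%:Z ^+ d.-1)) (\row_j homog_eval (P j) d c b%:Z)), (b ^ d)%N.
    split; first exact: bd0.
      by rewrite -graph_point_rational.
    apply: le_trans (hL x y _ x1 y1 cP (ltW (Ppos b b0))) _.
    by rewrite /Phi mulrC divfK // lt0r_neq0.
  have pos : 0 < `|graph_point P x - graph_point P y|.
    rewrite lt_neqAle normr_ge0 andbT eq_sym normr_eq0 subr_eq0.
    apply/eqP => /(congr1 (fun z => base_point z (Ordinal n0))).
    by rewrite !graph_pointK => /eqP; rewrite eq_sym; apply/negP; apply: cx.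
  by have := he _ Fy pos; rewrite ltNge le_e.
apply: (nV i); exists (graph_point P x) => //; exact: graph_pointK.
Qed.

Lemma hausdorff_measure_pinfty :
  (\sum_(1 <= r <oo) (r%:R ^+ n * f (psi (r ^ d)%N))%:E = +oo)%E ->
  hausdorff_measure f (intrinsic_approx psi (poly_graph R P)) = +oo%E.
Proof.
move=> sum_inf; apply: cvg_lim => //.
apply/cvgeyPge => A.
have A1 : 0 < `|A| + 1 by rewrite ltr_wpDl.
have [delta0 d00 h] := hausdorff_delta_ge sum_inf A1.
near=> delta.
apply: le_trans (h delta _ _); first by rewrite lee_fin; have := ler_norm A; lra.
- by near: delta; exact: nbhs_right_gt.
- by near: delta; exact: nbhs_right_lt.
Unshelve. all: by end_near.
Qed.

End Divergence.

(** * The convergence case *)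

Section Covers.
Variable R : realType.

Lemma sum_ltn_le (M c : nat) : \sum_(j < M) (j < c)%N%:R <= c%:R :> R.
Proof.
suff : \sum_(j < M) (j < c)%N%:R <= (minn M c)%:R :> R.
  by move=> h; apply: le_trans h _; rewrite ler_nat geq_minr.
elim: M => [|M IH]; first by rewrite big_ord0 min0n.
rewrite big_ord_recr /=; apply: le_trans (lerD IH (lexx _)) _.
rewrite -natrD ler_nat; case: (ltnP M c) => h /=; lia.
Qed.

Lemma tail_small (u : nat -> R) (S e : R) : (forall i, 0 <= u i) ->
  (forall N, \sum_(i < N) u i <= S) -> 0 < e ->
  exists B, forall M, \sum_(i < M | (B <= i)%N) u i <= e.
Proof.
move=> u0 hS e0.
pose E := [set \sum_(i < N) u i | N in [set: nat]].
have hE : has_sup E.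
  by split; [exists (\sum_(i < 0) u i), 0%N|exists S => _ [N _ <-]].
have [_ [B _ <-] hB] := sup_adherent e0 hE.
exists B => M; have [MB|BM] := leqP M B.
  rewrite big1 ?ltW // => i Bi; have := ltn_ord i.
  by rewrite ltnNge (leq_trans MB Bi).
have hM : \sum_(i < M) u i <= sup E by apply: sup_upper_bound => //; exists M.
have : \sum_(i < M) u i = \sum_(i < B) u i + \sum_(i < M | (B <= i)%N) u i.
  rewrite (bigID (fun i : 'I_M => (i < B)%N)) /=; congr (_ + _).
    by rewrite -(big_ord_widen _ u (ltnW BM)).
  by apply: eq_bigl => i; rewrite -leqNgt.
move=> E1; rewrite E1 in hM; lra.
Qed.

(** [K] stands for a bounded part of [E], [b] for a denominator and [j] for a center. The triples
    are coded by [pickle], and a partial sum over codes is dominated by the sum over a finite cube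
    of triples. *)
Lemma hausdorff_delta_le (k : nat) (f : R -> R) (delta e : R) (E : set 'rV[R]_k)
    (U : nat -> nat -> nat -> set 'rV[R]_k) (h : nat -> nat -> R) :
  f 0 = 0 -> (forall x, 0 <= x -> 0 <= f x) -> 0 < delta -> 0 <= e ->
  (forall x, E x -> exists K b j, U K b j x) ->
  (forall K b j, (diam (U K b j) < delta%:E)%E) ->
  (forall K b M, \sum_(j < M) f (fine (diam (U K b j))) <= h K b) ->
  (forall K M, \sum_(b < M) h K b <= e / 2 ^+ K.+1) ->
  (hausdorff_delta f delta E <= e%:E)%E.
Proof.
move=> f_0 f_ge0 delta0 e0 cov hU hj hb.
pose G (t : nat * nat * nat) := f (fine (diam (U t.1.1 t.1.2 t.2))).
have dge0 (V : set 'rV[R]_k) : 0 <= fine (diam V) by apply/fine_ge0/diam_ge0.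
have G0 t : 0 <= G t by apply: f_ge0.
pose U' i := if @pickle_inv (nat * nat * nat)%type i is Some t then U t.1.1 t.1.2 t.2 else set0.
apply: (@le_trans _ _ (\sum_(0 <= i <oo) (f (fine (diam (U' i))))%:E)%E).
  apply: ereal_inf_lbound; exists U' => //; split.
    move=> x /cov[K [b [j Ux]]]; exists (pickle (K, b, j)) => //.
    by rewrite /U' pickleK_inv.
  move=> i; rewrite /U'; case: (pickle_inv _) => [t|]; first exact: hU.
  by rewrite diam_set0 lte_fin.
apply: nneseries_le_partial => [i|M]; first exact: f_ge0.
rewrite big_mkord.
pose A := (\max_(i < M) (if @pickle_inv (nat * nat * nat)%type i is Some t
  then maxn (maxn t.1.1 t.1.2) t.2 else 0)).+1.
have hA (i : 'I_M) t : pickle_inv i = Some t -> [/\ t.1.1 < A, t.1.2 < A & t.2 < A]%N.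
  move=> it; have : (maxn (maxn t.1.1 t.1.2) t.2 < A)%N.
    rewrite ltnS; apply: leq_trans (leq_bigmax i); by rewrite it.
  by rewrite !gtn_max => /andP[/andP[-> ->] ->].
pose tv (t : 'I_A * 'I_A * 'I_A) : nat * nat * nat := (t.1.1 : nat, t.1.2 : nat, t.2 : nat).
apply: (@le_trans _ _ (\sum_(i < M) \sum_t (pickle (tv t) == i)%:R * G (tv t))).
  apply: ler_sum => i _; rewrite /U'.
  case it : (pickle_inv _) => [t|]; last first.
    rewrite diam_set0 f_0; apply: sumr_ge0 => t _; by rewrite mulr_ge0.
  have [t1 t2 t3] := hA _ _ it.
  rewrite (bigD1 (Ordinal t1, Ordinal t2, Ordinal t3)) //=.
  have -> : tv (Ordinal t1, Ordinal t2, Ordinal t3) = t by rewrite /tv /= -!surjective_pairing.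
  have -> : (pickle t == i) = true.
    have := @pickle_invK (nat * nat * nat)%type i; rewrite it /= => ->; exact: eqxx.
  by rewrite mul1r lerDl; apply: sumr_ge0 => s _; rewrite mulr_ge0.
rewrite exchange_big /=.
apply: (@le_trans _ _ (\sum_(t : 'I_A * 'I_A * 'I_A) G (tv t))).
  apply: ler_sum => t _; rewrite -big_distrl /= ler_piMl //.
  have [lt|ge] := ltnP (pickle (tv t)) M.
    rewrite (bigD1 (Ordinal lt)) //= eqxx big1 ?addr0 // => i ne.
    by case: eqP => // eq; case/negP: ne; apply/eqP/val_inj.
  by rewrite big1 // => i _; case: eqP => // eq; move: ge; rewrite eq leqNgt ltn_ord.
rewrite -(pair_bigA _ (fun p j => G (tv (p, j)))) /=.
rewrite -(pair_bigA _ (fun K b => \sum_(j < A) G (tv ((K, b), j)))) /=.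
apply: (@le_trans _ _ (\sum_(K < A) e / 2 ^+ K.+1)).
  apply: ler_sum => K _; apply: le_trans (hb K A); apply: ler_sum => b _; exact: hj.
rewrite -big_distrr /= ler_piMr //; exact: sum_half_powers.
Qed.

End Covers.

Section Convergence.
Variables (R : realType) (n m : nat) (P : 'I_m -> mpoly n int) (d : nat).
Variables (psi : nat -> R) (f : R -> R).
Hypothesis n0 : (0 < n)%N.
Hypothesis d0 : (0 < d)%N.
Hypothesis hdeg : forall j mu, mu \in msupp (P j) -> (mdeg mu <= d)%N.
Hypothesis hzero : forall z : 'I_n -> algC,
  (forall j, eval_int_poly (homog_part d (P j)) z = 0) -> forall l, z l = 0.
Hypothesis hpsi : approximation_function psi.
Hypothesis hf : dimension_function f.
Hypothesis hi : forall delta : R, 0 < delta -> exists2 c : R, 0 < c &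
     \forall r \near \oo, f (psi_ceil psi (delta * r%:R)) <= c * f (psi r).
Hypothesis hii : forall C : R, 0 < C -> exists2 c : R, 0 < c &
     \forall x \near 0^'+, f (C * x) <= c * f x.
Hypothesis sum_fin :
  (\sum_(1 <= r <oo) (r%:R ^+ n * f (psi (r ^ d)%N))%:E < +oo)%E.

Let term r : R := r%:R ^+ n * f (psi (r ^ d)%N).

Let term_ge0 r : 0 <= term r.
Proof.
have [_ fpos _ _ _] := hf; have [psi0 _] := hpsi.
(* [psi 0] is unconstrained; at [r = 0] the factor [0 ^+ n = 0] settles the sign. *)
case: r => [|r]; first by rewrite /term expr0n eqn0Ngt n0 mul0r.
by rewrite mulr_ge0 ?exprn_ge0 // ltW // fpos // psi0 // expn_gt0.
Qed.

Let term_bounded : exists S, forall N, \sum_(i < N) term i <= S.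
Proof.
have fin : (\sum_(1 <= r <oo) (term r)%:E)%E \is a fin_num.
  by rewrite ge0_fin_numE //; apply: nneseries_ge0 => i _ _; rewrite lee_fin.
exists (fine (\sum_(1 <= r <oo) (term r)%:E)%E) => N.
rewrite -(big_mkord xpredT term); case: N => [|N].
  by rewrite big_geq // fine_ge0 // nneseries_ge0 // => i _ _; rewrite lee_fin.
rewrite big_nat_recl // {1}/term expr0n eqn0Ngt n0 mul0r add0r.
rewrite -(big_add1 _ _ 0 N.+1 xpredT term).
rewrite -lee_fin fineK //; exact: partial_le_nneseries.
Qed.

(** If [psi] stayed above [e], the terms of the convergent series would be at least [f e > 0]. *)
Lemma psi_lim0 (e : R) : 0 < e -> exists N, forall q, (N <= q)%N -> psi q < e.
Proof.
move=> e0; have [_ fpos fmono _ _] := hf; have [psi0 psi_decr] := hpsi.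
have [[N [N0 hN]]|h] := pselect (exists N, (0 < N)%N /\ psi N < e).
  by exists N => q Nq; apply: le_lt_trans hN; apply: psi_decr.
have {}h q : (0 < q)%N -> e <= psi q.
  by move=> q0; rewrite leNgt; apply/negP => lt; apply: h; exists q.
have [S hS] := term_bounded; have fe := fpos _ e0.
have [N hN] := exists_nat_ge ((S + 1) / f e).
have := hS N.+1; rewrite big_ord_recl /= => hS'.
have : \sum_(i < N) f e <= \sum_(i < N) term (lift ord0 i).
  apply: ler_sum => i _; rewrite /term /= -[leLHS]mul1r.
  apply: ler_pM => //; first exact: ltW.
    by rewrite exprn_ege1 // ler1n.
  by apply: fmono => //; apply: h; rewrite expn_gt0.
rewrite sumr_const card_ord -mulr_natl.
have := hN N (leqnn N); rewrite ler_pdivrMr //.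
have := term_ge0 0; move: hS'; lra.
Qed.

(** Bounds the approximants of a point of norm at most [K], since [psi q <= psi 1]. *)
Let B (K : nat) : R := K%:R + psi 1%N.

Let psi1 : 0 < psi 1%N. Proof. by case: hpsi => h _; apply: h. Qed.

(* [radius C b] bounds [psi q] for every denominator [q] of a rational point of
   the graph lying above a reduced fraction of denominator [b]. *)
Definition radius (C b : nat) : R := psi_ceil psi (C%:R^-1 * (b ^ d)%N%:R).

Lemma ceil_scaled_gt0 (C b : nat) : (0 < C)%N -> (0 < b)%N ->
  (0 < `|Num.ceil (C%:R^-1 * (b ^ d)%N%:R : R)|)%N.
Proof.
move=> C0 b0; rewrite absz_gt0 gt_eqF // ceil_gt0 mulr_gt0 ?invr_gt0 ?ltr0n //.
by rewrite expn_gt0 b0.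
Qed.

Lemma ceil_scaled_le (C b q : nat) : (0 < C)%N -> (b ^ d <= C * q)%N ->
  (`|Num.ceil (C%:R^-1 * (b ^ d)%N%:R : R)| <= q)%N.
Proof.
move=> C0 le.
have x0 : 0 <= C%:R^-1 * (b ^ d)%N%:R :> R by rewrite mulr_ge0 ?invr_ge0.
rewrite -lez_nat gez0_abs ?ceil_ge0 ?(lt_le_trans _ x0) //.
rewrite ceil_le_int -pmulrn ler_pdivrMl ?ltr0n // -natrM ler_nat //.
Qed.

Lemma ceil_scaled_ge (C b q : nat) : (0 < C)%N -> (C * q <= b)%N ->
  (q <= `|Num.ceil (C%:R^-1 * (b ^ d)%N%:R : R)|)%N.
Proof.
move=> C0 le.
have x0 : 0 <= C%:R^-1 * (b ^ d)%N%:R :> R by rewrite mulr_ge0 ?invr_ge0.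
rewrite -(ler_nat R) [leRHS]pmulrn gez0_abs ?ceil_ge0 ?(lt_le_trans _ x0) //.
apply: le_trans (ceil_ge _).
rewrite ler_pdivlMl ?ltr0n // -natrM ler_nat; apply: leq_trans le _.
by case: (b) => // b'; rewrite -{1}[b'.+1]expn1 leq_pexp2l.
Qed.

Lemma close_reduced_points : exists2 C : nat, (0 < C)%N &
  forall x, intrinsic_approx psi (poly_graph R P) x ->
  forall K b1 : nat, `|x| <= K%:R ->
  exists (b : nat) (a : 'I_n -> int), [/\ (0 < b)%N, (b1 <= b)%N,
    forall i, `|(a i)%:~R / b%:R| <= B K
  & `|x - graph_point P (fun i => (a i)%:~R / b%:R)| <= radius C b].
Proof.
have [psi0 psi_decr] := hpsi.
have [C C0 hC] := homog_denominator_bound hdeg hzero.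
exists C => // x [Gx inf] K b1 xK.
have B0 : 0 <= B K by rewrite addr_ge0 // ltW.
(* A point of the graph is determined by its base, so the fractions of denominator below [b1]
   account for finitely many approximants. *)
pose F := [set graph_point P (fun i => (w : 'rV[R]_n) ord0 i) | w in
  [set z : 'rV[R]_n | exists (p : 'rV[int]_n) (q : nat),
    [/\ (0 < q)%N, (q < b1)%N, z = rat_point R p q & `|z| <= B K]]].
have finF : finite_set F by apply/finite_image/finite_rat_points.
have /infinite_setN0[z [[Gz [p [q [q_gt0 zE hz]]]] nF]] := infinite_setD inf finF.
have [a [b [b0 hab cop]]] := ex_reduced_fraction (fun l => p ord0 (lshift m l)) q_gt0.
have bR : b%:R != 0 :> R by rewrite pnatr_eq0 -lt0n.
have qR : q%:R != 0 :> R by rewrite pnatr_eq0 -lt0n.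
have baseE : base_point z = fun i => (a i)%:~R / b%:R.
  apply/funext => i; rewrite /base_point mxE zE rat_pointE.
  apply/eqP; rewrite eqr_div //.
  by rewrite !pmulrn -!intrM hab.
have zB : `|z| <= B K.
  rewrite -[z](subKr x); apply: le_trans (ler_normB _ _) _; apply: lerD => //.
  by apply: le_trans hz _; apply: psi_decr.
have aB i : `|(a i)%:~R / b%:R| <= B K :> R.
  by have := base_point_norm z i; rewrite baseE => h; apply: le_trans h zB.
exists b, a; split => //.
  rewrite leqNgt; apply/negP => lt; apply: nF.
  exists (rat_point R (\row_i a i) b).
    exists (\row_i a i), b; split => //; apply/rV_norm_leP => // i.
    by rewrite rat_pointE mxE.
  rewrite [RHS](poly_graphP Gz) baseE; congr graph_point.
  by apply/funext => i; rewrite rat_pointE mxE.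
rewrite -baseE -(poly_graphP Gz); apply: le_trans hz _.
apply: psi_decr; first exact: ceil_scaled_gt0.
apply: ceil_scaled_le => //; apply: dvdn_leq; first by rewrite muln_gt0 C0.
apply: hC cop _ => // j.
have eE : rsubmx z ord0 j = (p ord0 (rshift n j))%:~R / q%:R by rewrite mxE zE rat_pointE.
have := Gz j; rewrite eE -/(base_point z) baseE => /esym PE.
(* The equation [P_j (a / b) = p_j / q], cleared of denominators, is the divisibility that bounds
   [b ^ d]. *)
have : (q%:Z * homog_eval (P j) d a b)%:~R = (b%:Z ^+ d * p ord0 (rshift n j))%:~R :> R.
  rewrite !intrM homog_evalE; [|exact: hdeg|by rewrite -lt0n].
  by rewrite rmorphXn /= -!pmulrn PE; field.
by move=> /intr_inj ->; rewrite dvdz_mulr.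
Qed.

(** The graph is unbounded and the number of fractions with a given denominator grows with the
    region, so the part of norm at most [K] is covered separately at cost [e / 2 ^+ K.+1]. *)
Lemma hausdorff_delta_null (delta e : R) : 0 < delta -> 0 < e ->
  (hausdorff_delta f delta (intrinsic_approx psi (poly_graph R P)) <= e%:E)%E.
Proof.
move=> delta0 e0.
have [f_0 fpos fmono _ _] := hf; have [psi0 psi_decr] := hpsi.
have fge0 x : 0 <= x -> 0 <= f x.
  by rewrite le_eqVlt => /orP[/eqP <-|/fpos/ltW //]; rewrite f_0.
have [C C0 hC] := close_reduced_points.
(* Passes from the radius of a sup-norm ball to its Euclidean diameter. *)
pose D : R := (n + m)%N%:R * 2.
have D0 : 0 < D by rewrite mulr_gt0 // ltr0n addn_gt0 n0.
have CV0 : 0 < C%:R^-1 :> R by rewrite invr_gt0 ltr0n.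
have [c1 c10 [R1 _ hR1]] := hi CV0.
have [c2 c20 /near_right0[e2 e20 he2]] := hii D0.
have rad0 b : (0 < b)%N -> 0 < radius C b by move=> b0; apply/psi0/ceil_scaled_gt0.
have m0 : 0 < Num.min e2 (delta / D) by rewrite lt_min e20 divr_gt0.
have [N hN] := psi_lim0 m0.
(* From [b0] on, [C * N <= b] makes the radius small enough for the doubling of [f] and for [delta],
   and [R1 <= b ^ d] allows the comparison of [psi] at [b ^ d / C] and [b ^ d]. *)
pose b0 := (C * N + R1).+1.
have rad_small b : (b0 <= b)%N -> radius C b < e2 /\ D * radius C b < delta.
  move=> le; have := hN _ (@ceil_scaled_ge C b N C0 _).
  have CN : (C * N <= b)%N by apply: leq_trans le; rewrite leqW // leq_addr.
  move=> /(_ CN); rewrite lt_min => /andP[h1 h2]; split => //.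
  by move: h2; rewrite ltr_pdivlMr // mulrC.
pose c := c2 * c1.
have c_gt0 : 0 < c by rewrite mulr_gt0.
have vle b : (b0 <= b)%N -> f (D * radius C b) <= c * f (psi (b ^ d)%N).
  move=> le; have b_gt0 : (0 < b)%N by apply: leq_trans le.
  have [h1 _] := rad_small b le.
  apply: le_trans (he2 _ (rad0 b b_gt0) h1) _; rewrite /c -mulrA ler_pM2l //.
  apply: hR1 => /=; apply: (@leq_trans b).
    by apply: leq_trans le; rewrite leqW // leq_addl.
  by case: (b) b_gt0 => // b' _; rewrite -{1}[b'.+1]expn1 leq_pexp2l.
have B0 K : 0 < B K by rewrite ltr_wpDl.
pose Nn K b := Num.truncn (B K * b%:R).
pose T K b : finType := {ffun 'I_n -> 'I_((Nn K b).*2.+1)}.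
pose Q K : R := (2 * B K + 1) ^+ n * c.
have Q0 K : 0 < Q K by rewrite mulr_gt0 // exprn_gt0 // addr_gt0 // mulr_gt0.
have cnt K b : (0 < b)%N -> #|T K b|%:R <= (2 * B K + 1) ^+ n * b%:R ^+ n :> R.
  move=> b_gt0; rewrite card_ffun !card_ord natrX -exprMn.
  apply: lerXn2r; rewrite ?nnegrE //.
    by rewrite mulr_ge0 // addr_ge0 // mulr_ge0 // ltW.
  rewrite -[_.*2.+1%:R]natr1 -mul2n natrM [leRHS]mulrDl mul1r.
  have x0 : 0 <= B K * b%:R by rewrite mulr_ge0 // ltW.
  have /andP[h _] := truncn_itv x0.
  by apply: lerD; [rewrite -mulrA ler_pM2l|rewrite ler1n].
have [S hS] := term_bounded.
(* [Q K] collects the number of centers per [b ^ n] and the constant [c]; starting the denominators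
   at [s K] keeps part [K] within its share. *)
have /choice[s hs] : forall K, exists s, (b0 <= s)%N /\
    forall M, \sum_(b < M | (s <= b)%N) term b <= e / 2 ^+ K.+1 / Q K.
  move=> K; have eK : 0 < e / 2 ^+ K.+1 / Q K by rewrite !divr_gt0 // exprn_gt0.
  have [s hs] := tail_small term_ge0 hS eK.
  exists (b0 + s)%N; split; first exact: leq_addr.
  move=> M; apply: le_trans (hs M); rewrite big_mkcond [leRHS]big_mkcond.
  apply: ler_sum => b _; case: ifP => h; last by case: ifP.
  by rewrite (leq_trans (leq_addl b0 s) h).
pose ctr K b (t : T K b) (i : 'I_n) : int := (t i)%:Z - (Nn K b)%:Z.
pose ball K b (t : T K b) : set 'rV[R]_(n + m) :=
  [set z | `|z - graph_point P (fun i => (ctr K b t i)%:~R / b%:R)| <= radius C b].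
pose U K b j : set 'rV[R]_(n + m) :=
  if (s K <= b)%N then
    if insub j is Some o then ball K b (enum_val (o : 'I_#|T K b|)) else set0
  else set0.
have diam_ball K b (t : T K b) : (0 < b)%N -> (diam (ball K b t) <= (D * radius C b)%:E)%E.
  move=> b_gt0; apply: diam_le => [|x y hx hy].
    by rewrite mulr_ge0 // ltW // rad0.
  apply: le_trans (eucl_dist_le x y) _; rewrite /D -mulrA ler_wpM2l //.
  pose w : 'rV[R]_(n + m) := graph_point P (fun i => (ctr K b t i)%:~R / b%:R).
  have {}hx : `|x - w| <= radius C b := hx.
  have {}hy : `|y - w| <= radius C b := hy.
  have -> : x - y = (x - w) - (y - w) by rewrite opprB addrA subrK.
  by apply: le_trans (ler_normB _ _) _; rewrite mulr_natl mulr2n lerD.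
have sb K b : (s K <= b)%N -> (b0 <= b)%N by move=> h; case: (hs K) => h' _; apply: leq_trans h.
apply: (@hausdorff_delta_le R (n + m) f delta e _ U
  (fun K b => if (s K <= b)%N then #|T K b|%:R * f (D * radius C b) else 0)) => //.
- exact: ltW.
- move=> x Ex; have [K hK] := exists_nat_ge `|x|.
  have [b [a [b_gt0 sKb aB xa]]] := hC x Ex K (s K) (hK K (leqnn K)).
  have bR : 0 < b%:R :> R by rewrite ltr0n.
  have bnd i : `|a i| <= (Nn K b)%:Z.
    have : `|a i|%:~R <= B K * b%:R :> R.
      by have := aB i; rewrite normrM normfV normr_nat -intr_norm ler_pdivrMr.
    rewrite -abszE -pmulrn => h; rewrite lez_nat truncn_ge_nat //.
    by rewrite mulr_ge0 // ltW.
  have lt i : (`|(a i + (Nn K b)%:Z)%R| < (Nn K b).*2.+1)%N by apply: absz_shift_lt.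
  pose t : T K b := [ffun i => Ordinal (lt i)].
  exists K, b, (enum_rank t); rewrite /U sKb valK enum_rankK /ball /=.
  rewrite (_ : (fun i => (ctr K b t i)%:~R / b%:R) = (fun i => (a i)%:~R / b%:R)) //.
  apply/funext => i; congr (_%:~R / _); rewrite /ctr ffunE /=.
  by rewrite absz_shift ?addrK.
- move=> K b j; rewrite /U; case: ifP => [h|_]; last by rewrite diam_set0 lte_fin.
  case: (insub _) => [w|]; last by rewrite diam_set0 lte_fin.
  have b_gt0 : (0 < b)%N by apply: leq_trans (sb K b h).
  apply: le_lt_trans (diam_ball _ _ _ b_gt0) _; rewrite lte_fin.
  by case: (rad_small b (sb K b h)).
- move=> K b M; rewrite /U; case: ifP => [h|_]; last first.
    by rewrite big1 // => j _; rewrite diam_set0.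
  have b_gt0 : (0 < b)%N by apply: leq_trans (sb K b h).
  have v0 : 0 <= f (D * radius C b) by apply: fge0; rewrite mulr_ge0 // ltW // rad0.
  apply: (@le_trans _ _ (\sum_(j < M) (j < #|T K b|)%N%:R * f (D * radius C b))).
    apply: ler_sum => j _; case: insubP => [w lt _|nlt].
      rewrite lt mul1r.
      have : (0 <= diam (ball K b (enum_val w)))%E by apply: diam_ge0.
      have := diam_ball K b (enum_val w) b_gt0.
      case: (diam _) => [r| |] //=; rewrite !lee_fin => rle.
      rewrite le_eqVlt => /orP[/eqP <-|r0]; first by rewrite f_0.
      exact: fmono.
    by rewrite diam_set0 /= f_0 mulr_ge0.
  by rewrite -big_distrl /= ler_wpM2r // sum_ltn_le.
- move=> K M; have [_ hsK] := hs K.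
  apply: (@le_trans _ _ (\sum_(b < M | (s K <= b)%N) Q K * term b)).
    rewrite [leRHS]big_mkcond; apply: ler_sum => b _; case: ifP => // h.
    have b_gt0 : (0 < b)%N by apply: leq_trans (sb K b h).
    have -> : Q K * term b = ((2 * B K + 1) ^+ n * b%:R ^+ n) * (c * f (psi (b ^ d)%N)).
      by rewrite /Q /term; ring.
    apply: ler_pM => //; last by apply/vle/(sb K).
      by apply: fge0; rewrite mulr_ge0 // ltW // rad0.
    exact: cnt.
  rewrite -big_distrr /= mulrC -ler_pdivlMr //; exact: hsK.
Qed.

Lemma hausdorff_measure_eq0 :
  hausdorff_measure f (intrinsic_approx psi (poly_graph R P)) = 0%E.
Proof.
have [f_0 fpos _ _ _] := hf.
apply: cvg_lim => //; apply: cvg_near_cst; near=> delta.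
have delta0 : 0 < delta by near: delta; exact: nbhs_right_gt.
apply/eqP; rewrite eq_le; apply/andP; split.
  apply/lee_addgt0Pr => e e0; rewrite add0e; exact: hausdorff_delta_null.
apply: le_ereal_inf_tmp => _ [U _ <-]; apply: nneseries_ge0 => i _ _.
rewrite lee_fin; have : 0 <= fine (diam (U i)) by apply/fine_ge0/diam_ge0.
by rewrite le_eqVlt => /orP[/eqP <-|/fpos/ltW //]; rewrite f_0.
Unshelve. all: by end_near.
Qed.

End Convergence.

Theorem theorem4 (R : realType) (n m : nat) (hn : (0 < n)%N) (hm : (0 < m)%N)
  (P : 'I_m -> mpoly n int) (d : nat) (hd : d = max_degree P)
  (psi : nat -> R) (hpsi : approximation_function psi)
  (f : R -> R) (hf : dimension_function f)
  (hi : forall delta : R, 0 < delta -> exists2 c : R, 0 < c &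
     \forall r \near \oo, f (psi_ceil psi (delta * r%:R)) <= c * f (psi r))
  (hii : forall C : R, 0 < C -> exists2 c : R, 0 < c &
     \forall x \near 0^'+, f (C * x) <= c * f x)
  (hiii_lim : r ^- n * f r @[r --> 0^'+] --> +oo)
  (hiii_decr : forall r s : R, 0 < r -> r <= s -> s ^- n * f s <= r ^- n * f r)
  (hzero : forall z : 'I_n -> algC,
     (forall i : 'I_m, eval_int_poly (homog_part d (P i)) z = 0) <->
     (forall l : 'I_n, z l = 0)) :
  [/\ (\sum_(1 <= r <oo) (r%:R ^+ n * f (psi (r ^ d)%N))%:E < +oo)%E ->
        hausdorff_measure f (intrinsic_approx psi (poly_graph R P)) = 0%E,
      (\sum_(1 <= r <oo) (r%:R ^+ n * f (psi (r ^ d)%N))%:E = +oo)%E ->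
        hausdorff_measure f (intrinsic_approx psi (poly_graph R P)) = +oo%E
    & (r%:R ^+ d * psi r @[r --> \oo] --> (0 : R)) ->
        intrinsic_approx psi (poly_graph R P) =
        ambient_approx psi (poly_graph R P)].
Proof.
have hd0 : (0 < d)%N := degree_gt0 hn hzero.
have hdeg j mu : mu \in msupp (P j) -> (mdeg mu <= d)%N.
  by rewrite hd; apply: max_degree_msupp.
have hzero' (z : 'I_n -> algC) : (forall j, eval_int_poly (homog_part d (P j)) z = 0) ->
    forall l, z l = 0 by case: (hzero z).
split=> h.
- exact: (hausdorff_measure_eq0 hn hd0 hdeg hzero' hpsi hf hi hii h).
- exact: (hausdorff_measure_pinfty hn hd0 hdeg hpsi hf hii hiii_lim hiii_decr h).
- exact: (intrinsic_eq_ambient hd0 hdeg hpsi h).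
Qed.
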